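(* Let $2\le k<l$ be integers, and let $\mathfrak a^{I}_{k,l},\mathfrak a^{II}_{k,l}\subset\mathfrak{gl}(V)$ be the symmetry algebras of the curves $\gamma^{I}\subset\operatorname{Gr}(k+l-2,V)$ and $\gamma^{II}\subset\operatorname{Gr}(2,V)$ respectively. Then the Sternberg prolongations of $\mathfrak a^{I}_{k,l}$ and $\mathfrak a^{II}_{k,l}$ are finite-dimensional and coincide (up to natural isomorphism of Lie algebras) with the Lie algebras $\mathfrak g^{I}_{k,l}$ and $\mathfrak g^{II}_{k,l}$ of symmetries of first and second kind, respectively, of the system $y^{(k)}(x)=0$, $z^{(l)}(x)=0$.
   Context: Curves. $V$ is the real vector space with basis $e_0,\dots,e_{k-1},f_0,\dots,f_{l-1}$, and $X\colon V\to V$ is the nilpotent operator $X(e_i)=e_{i-1}$ $(i\ge1)$, $X(e_0)=0$, $X(f_j)=f_{j-1}$ $(j\ge1)$, $X(f_0)=0$. $\gamma^{I}$ is the closure in $\operatorname{Gr}(k+l-2,V)$ of the orbit of the one-parameter group $\exp(tX)$ through the codimension-two subspace $\langle e_1,\dots,e_{k-1},f_1,\dots,f_{l-1}\rangle$; $\gamma^{II}$ is the closure in $\operatorname{Gr}(2,V)$ of the orbit of $\exp(tX)$ through $\langle e_{k-1},f_{l-1}\rangle$. $\mathfrak a^{I}_{k,l}$, $\mathfrak a^{II}_{k,l}$ are the Lie algebras of the subgroups of $GL(V)$ preserving $\gamma^{I}$, $\gamma^{II}$ respectively. Sternberg prolongation. For a finite-dimensional vector space $V$ let $D(V)=\bigoplus_{i\ge-1}S^{i+1}(V^*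 )\otimes V$ be the graded Lie algebra of polynomial vector fields on $V$, with $D_i(V)=S^{i+1}(V^* )\otimes V$, so $D_{-1}(V)=V$ and $D_0(V)=\mathfrak{gl}(V)$. The Sternberg prolongation of a subalgebra $\mathfrak a\subset\mathfrak{gl}(V)$ is the graded subalgebra $\mathfrak g=\bigoplus_{i\ge-1}\mathfrak g_i\subset D(V)$ with $\mathfrak g_{-1}=V$, $\mathfrak g_0=\mathfrak a$, and $\mathfrak g_{i+1}=\{u\in D_{i+1}(V):[u,\mathfrak g_{-1}]\subset\mathfrak g_i\}$ for $i\ge0$. Symmetry algebras. Let $\mathcal E=\mathbb R^{k+l+1}$ with coordinates $(x,y_0,\dots,y_{k-1},z_0,\dots,z_{l-1})$, and let $$\mathcal X=\frac{\partial}{\partial x}+\sum_{i=0}^{k-2}y_{i+1}\frac{\partial}{\partial y_i}+\sum_{j=0}^{l-2}z_{j+1}\frac{\partial}{\partial z_j},$$ $F_1=\langle\frac{\partial}{\partial y_i}\,(1\le i\le k-1),\frac{\partial}{\partial z_j}\,(1\le j\le l-1)\rangle$, $D=\langle\mathcal X,\frac{\partial}{\partial y_{k-1}},\frac{\partial}{\partial z_{l-1}}\rangle$. $\mathfrak g^{I}_{k,l}$ is the Lie algebra of vector fields $S$ on $\mathcal E$ with $[S,\langle\mathcal X\rangle]\subset\langle\mathcal X\rangle$ and $[S,F_1]\subset F_1$; $\mathfrak g^{II}_{k,l}$ is the Lie algebra of vector fields $S$ on $\mathcal E$ with $[S,\langle\mathcal X\rangle]\subset\langle\mathcal X\rangle$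 and $[S,D]\subset D$. *)

(* Defs.v *)
(* The reals are an arbitrary [R : realType].  V = R^(k+l) is the space of
   column vectors 'cV[R]_(k + l), operators on V are matrices, and the equation
   manifold E = R^(k+l+1) is 'cV[R]_(1 + (k + l)), with coordinates x, y, z in
   this order. *)
From HB Require Import structures.
From mathcomp Require Import all_boot all_order all_algebra.
From mathcomp Require Import all_classical all_reals all_analysis.
(* The notations of mpoly clash with those of mathcomp-analysis. *)
From mathcomp Require Import -(notations) mpoly.
Set Implicit Arguments.
Unset Strict Implicit.
Unset Printing Implicit Defensive.
Import Order.TTheory GRing.Theory Num.Theory.
Import numFieldNormedType.Exports.
Local Open Scope classical_set_scope.
Local Open Scope ring_scope.

Definition finite_dimensional (R : realType) (W : lmodType R) (g : set W) :
    Prop :=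
  exists (d : nat) (b : 'I_d -> W),
    g = [set u | exists c : 'I_d -> R, u = \sum_(i < d) c i *: b i].

Definition lie_subalgebra (R : realType) (W : lmodType R) (br : W -> W -> W)
    (g : set W) : Prop :=
  [/\ g 0,
      forall (a : R) (u v : W), g u -> g v -> g (a *: u + v) &
      forall u v : W, g u -> g v -> g (br u v)].

(* Only the values of phi on g matter. *)
Definition lie_isomorphism (R : realType) (U W : lmodType R)
    (brU : U -> U -> U) (brW : W -> W -> W) (g : set U) (h : set W)
    (phi : U -> W) : Prop :=
  [/\ lie_subalgebra brU g,
      lie_subalgebra brW h,
      set_bij g h phi,
      forall (a : R) (u v : U), g u -> g v ->
        phi (a *: u + v) = a *: phi u + phi v &
      forall u v : U, g u -> g v -> phi (brU u v) = brW (phi u) (phi v)].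

Definition colspan (R : realType) (n m : nat) (B : 'M[R]_(n, m)) :
    {vspace 'cV[R]_n} :=
  limg (linfun (mulmx B : 'cV[R]_m -> 'cV[R]_n)).

Definition mximg (R : realType) (n : nat) (g : 'M[R]_n)
    (W : {vspace 'cV[R]_n}) : {vspace 'cV[R]_n} :=
  (linfun (mulmx g : 'cV[R]_n -> 'cV[R]_n) @: W)%VS.

Definition Gr (R : realType) (n m : nat) : Type :=
  {W : {vspace 'cV[R]_n} | \dim W == m}.
HB.instance Definition _ (R : realType) (n m : nat) :=
  Choice.on (Gr R n m).

(* Gr carries the quotient topology of the space of m-frames, i.e. of n x m
   matrices of rank m, under B |-> colspan B: U is open iff its preimage is
   relatively open among the matrices of rank m. *)
Definition Gr_open (R : realType) (n m : nat) : set_system (Gr R n m) :=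
  fun U => exists2 O : set 'M[R]_(n, m), open O &
    forall B : 'M[R]_(n, m), \rank B = m ->
      (O B <-> exists2 W : Gr R n m, U W & val W = colspan B).

Lemma dim_colspan (R : realType) (n m : nat) (B : 'M[R]_(n, m)) :
  \rank B = m -> \dim (colspan B) = m.
Proof.
move=> rB; have injB : (lker (linfun (mulmx B : 'cV[R]_m -> 'cV[R]_n)) == 0)%VS.
  apply/lker0P => x y; rewrite !lfunE /= => BxBy.
  have rfB : row_free B^T by rewrite /row_free mxrank_tr rB.
  by apply: trmx_inj; apply: (row_free_inj rfB); rewrite -!trmx_mul BxBy.
by rewrite limg_dim_eq ?dimvf ?(eqP injB) ?capv0 //= /dim /= muln1.
Qed.

Lemma Gr_openT (R : realType) (n m : nat) : @Gr_open R n m setT.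
Proof.
exists setT; first exact: openT.
move=> B rB; split=> // _; have dB := introT eqP (dim_colspan rB).
by exists (exist _ (colspan B) dB : Gr R n m).
Qed.

Lemma Gr_openI (R : realType) (n m : nat) : setI_closed (@Gr_open R n m).
Proof.
move=> U1 U2 [A oA H1] [B0 oB0 H2]; exists (A `&` B0); first exact: openI.
move=> B rB; split.
  move=> [/(H1 _ rB)[W U1W WB] /(H2 _ rB)[W' U2W W'B]].
  have WW' : W = W' by apply: val_inj; rewrite WB W'B.
  by exists W => //; split=> //; rewrite WW'.
move=> [W [U1W U2W] WB]; split.
  by apply/(H1 _ rB); exists W.
by apply/(H2 _ rB); exists W.
Qed.

Lemma Gr_open_bigU (R : realType) (n m : nat) (I : Type)
    (f : I -> set (Gr R n m)) :
  (forall i, Gr_open (f i)) -> Gr_open (\bigcup_i f i).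
Proof.
move=> fo.
have /choice[A HA] : forall i, exists A : set 'M[R]_(n, m), open A /\
    forall B : 'M[R]_(n, m), \rank B = m ->
      (A B <-> exists2 W : Gr R n m, f i W & val W = colspan B).
  by move=> i; have [A ? ?] := fo i; exists A.
exists (\bigcup_i A i).
  by apply: bigcup_open => i _; have [] := HA i.
move=> B rB; split.
  move=> [i _ AiB]; have [_ /(_ _ rB)[/(_ AiB)[W fW WB] _]] := HA i.
  by exists W => //; exists i.
move=> [W [i _ fW] WB]; exists i => //.
by have [_ /(_ _ rB)[_]] := HA i; apply; exists W.
Qed.

HB.instance Definition _ (R : realType) (n m : nat) :=
  isOpenTopological.Build (Gr R n m)
    (@Gr_openT R n m) (@Gr_openI R n m) (@Gr_open_bigU R n m).

Definition expmx (R : realType) (n : nat) (A : 'M[R]_n) : 'M[R]_n :=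
  limn (series (fun j : nat => (j`!%:R)^-1 *: A ^+ j)).

Definition basis_e (R : realType) (k l : nat) (i : 'I_k) : 'cV[R]_(k + l) :=
  delta_mx (lshift l i) 0.
Arguments basis_e R {k} l i.
Definition basis_f (R : realType) (k l : nat) (j : 'I_l) : 'cV[R]_(k + l) :=
  delta_mx (rshift k j) 0.
Arguments basis_f R k {l} j.

Definition shift_mx (R : realType) (n : nat) : 'M[R]_n :=
  \matrix_(i < n, j < n) (j == i.+1 :> nat)%:R.

(* Column convention: X *m e_j = e_(j-1) and X *m e_0 = 0, likewise for f. *)
Definition Xmx (R : realType) (k l : nat) : 'M[R]_(k + l) :=
  block_mx (shift_mx R k) 0 0 (shift_mx R l).

Definition baseI (R : realType) (k l : nat) : {vspace 'cV[R]_(k + l)} :=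
  (<<[seq basis_e R l i | i : 'I_k <- enum 'I_k & (0 < i)%N] ++
     [seq basis_f R k j | j : 'I_l <- enum 'I_l & (0 < j)%N]>>)%VS.

Definition baseII (R : realType) (k l : nat) : {vspace 'cV[R]_(k + l)} :=
  (<<[seq basis_e R l i | i : 'I_k <- enum 'I_k & i.+1 == k] ++
     [seq basis_f R k j | j : 'I_l <- enum 'I_l & j.+1 == l]>>)%VS.

Definition orbit_closure (R : realType) (n m : nat) (X : 'M[R]_n)
    (W0 : {vspace 'cV[R]_n}) : set (Gr R n m) :=
  closure [set W : Gr R n m |
    exists t : R, val W = mximg (expmx (t *: X)) W0].

Definition gammaI (R : realType) (k l : nat) : set (Gr R (k + l) (k + l - 2)%N) :=
  orbit_closure (Xmx R k l) (baseI R k l).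
Arguments gammaI : clear implicits.

Definition gammaII (R : realType) (k l : nat) : set (Gr R (k + l) 2) :=
  orbit_closure (Xmx R k l) (baseII R k l).
Arguments gammaII : clear implicits.

Definition stabilizer (R : realType) (n m : nat) (gamma : set (Gr R n m)) :
    set 'M[R]_n :=
  [set g | g \in unitmx /\
    [set mximg g (val W) | W in gamma] = [set val W | W in gamma]].

(* The Lie algebra of a (closed) subgroup of GL(n, R). *)
Definition lie_algebra_of (R : realType) (n : nat) (G : set 'M[R]_n) :
    set 'M[R]_n :=
  [set A | forall t : R, G (expmx (t *: A))].

Definition symI (R : realType) (k l : nat) : set 'M[R]_(k + l) :=
  lie_algebra_of (stabilizer (gammaI R k l)).
Arguments symI : clear implicits.

Definition symII (R : realType) (k l : nat) : set 'M[R]_(k + l) :=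
  lie_algebra_of (stabilizer (gammaII R k l)).
Arguments symII : clear implicits.

(* u stands for the vector field \sum_i (u i) d/dv_i. *)
Definition pvfield (R : realType) (n : nat) : lmodType R :=
  {ffun 'I_n -> mpoly n R}.

Definition pbracket (R : realType) (n : nat) (u v : pvfield R n) :
    pvfield R n :=
  [ffun i => \sum_(j < n) (u j * mderiv j (v i) - v j * mderiv j (u i))].

Definition phomog (R : realType) (n d : nat) (u : pvfield R n) : Prop :=
  forall i : 'I_n, u i \is ishomog1 d mdeg.

(* The element of D_0(R^n) = gl(R^n) given by A, i.e. the field v |-> A v. *)
Definition lin_pvfield (R : realType) (n : nat) (A : 'M[R]_n) : pvfield R n :=
  [ffun i => \sum_(j < n) A i j *: mpolyX R (mnm1 j)].

(* Indexed by the polynomial degree d of the coefficients, so that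
   [prolong a d] is g_(d-1): d = 0 is g_(-1) = V and d = 1 is g_0 = a. *)
Fixpoint prolong (R : realType) (n : nat) (a : set 'M[R]_n) (d : nat) :
    set (pvfield R n) :=
  match d with
  | 0 => [set u | phomog 0 u]
  | d'.+1 =>
    if d' is 0 then [set lin_pvfield A | A in a]
    else [set u | phomog d'.+1 u /\
           forall v : pvfield R n, phomog 0 v -> prolong a d' (pbracket u v)]
  end.

Definition sternberg_prolongation (R : realType) (n : nat) (a : set 'M[R]_n) :
    set (pvfield R n) :=
  [set u | exists (N : nat) (w : nat -> pvfield R n),
    (forall d, prolong a d (w d)) /\ u = \sum_(d < N) w d].

Definition peval (R : realType) (n : nat) (u : pvfield R n) (v : 'cV[R]_n) :
    'cV[R]_n :=
  \col_i meval (fun j => v j 0) (u i).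

Fixpoint Cdiff (R : realType) (n m : nat) (r : nat)
    (f : 'cV[R]_n -> 'cV[R]_m) : Prop :=
  match r with
  | 0 => continuous f
  | r'.+1 => (forall p : 'cV[R]_n, differentiable f p) /\
             (forall v : 'cV[R]_n, Cdiff r' (fun p => 'D_v f p))
  end.

Definition smooth (R : realType) (n m : nat) (f : 'cV[R]_n -> 'cV[R]_m) :
    Prop :=
  forall r : nat, Cdiff r f.

Definition vfield (R : realType) (n : nat) : lmodType R :=
  'cV[R]_n -> 'cV[R]_n.

Definition vbracket (R : realType) (n : nat) (S T : vfield R n) : vfield R n :=
  fun p => 'D_(S p) T p - 'D_(T p) S p.

Definition span_at (R : realType) (n : nat) (L : seq (vfield R n))
    (p : 'cV[R]_n) : {vspace 'cV[R]_n} :=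
  (<<[seq (Y : vfield R n) p | Y <- L]>>)%VS.

(* [S, D] is contained in D, where D is the distribution spanned pointwise by L
   and its sections are the global smooth T with values in D. *)
Definition preserves (R : realType) (n : nat) (S : vfield R n)
    (L : seq (vfield R n)) : Prop :=
  forall T : vfield R n, smooth T -> (forall p, T p \in span_at L p) ->
    forall p, vbracket S T p \in span_at L p.

Definition ix (k l : nat) : 'I_(1 + (k + l)) := lshift (k + l) ord0.
Definition iy (k l : nat) (i : 'I_k) : 'I_(1 + (k + l)) := rshift 1 (lshift l i).
Definition iz (k l : nat) (j : 'I_l) : 'I_(1 + (k + l)) := rshift 1 (rshift k j).

Definition ddx (R : realType) (k l : nat) : vfield R (1 + (k + l)) :=
  fun=> delta_mx (ix k l) 0.
Arguments ddx : clear implicits.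
Definition ddy (R : realType) (k l : nat) (i : 'I_k) : vfield R (1 + (k + l)) :=
  fun=> delta_mx (iy l i) 0.
Arguments ddy R {k} l i _.
Definition ddz (R : realType) (k l : nat) (j : 'I_l) : vfield R (1 + (k + l)) :=
  fun=> delta_mx (iz k j) 0.
Arguments ddz R k {l} j _.

(* The inner sums have one term, or none when i = k-1 (resp. i = l-1). *)
Definition calX (R : realType) (k l : nat) : vfield R (1 + (k + l)) :=
  fun p => ddx R k l p
    + \sum_(i < k) \sum_(j < k | j == i.+1 :> nat) p (iy l j) 0 *: ddy R l i p
    + \sum_(i < l) \sum_(j < l | j == i.+1 :> nat) p (iz k j) 0 *: ddz R k i p.
Arguments calX : clear implicits.

Definition distX (R : realType) (k l : nat) : seq (vfield R (1 + (k + l))) :=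
  [:: calX R k l].
Arguments distX : clear implicits.

Definition distF1 (R : realType) (k l : nat) : seq (vfield R (1 + (k + l))) :=
  [seq ddy R l i | i : 'I_k <- enum 'I_k & (0 < i)%N] ++
  [seq ddz R k j | j : 'I_l <- enum 'I_l & (0 < j)%N].
Arguments distF1 : clear implicits.

Definition distD (R : realType) (k l : nat) : seq (vfield R (1 + (k + l))) :=
  calX R k l ::
  [seq ddy R l i | i : 'I_k <- enum 'I_k & i.+1 == k] ++
  [seq ddz R k j | j : 'I_l <- enum 'I_l & j.+1 == l].
Arguments distD : clear implicits.

Definition gI (R : realType) (k l : nat) : set (vfield R (1 + (k + l))) :=
  [set S | [/\ smooth S, preserves S (distX R k l) &
               preserves S (distF1 R k l)]].
Arguments gI : clear implicits.

Definition gII (R : realType) (k l : nat) : set (vfield R (1 + (k + l))) :=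
  [set S | [/\ smooth S, preserves S (distX R k l) &
               preserves S (distD R k l)]].
Arguments gII : clear implicits.

(* The quotient map of E by the integral curves of calX, that is, the map
   sending a point to the solution through it: e_i, f_j stand for the solutions
   (x^i/i!, 0), (0, x^j/j!), X for d/dx, and the (y, z)-coordinates at x of the
   solution c are those of exp(x X) c. *)
Definition solution_of (R : realType) (k l : nat) (p : 'cV[R]_(1 + (k + l))) :
    'cV[R]_(k + l) :=
  expmx (- p (ix k l) 0 *: Xmx R k l) *m dsubmx p.

(* phi S is the push-forward of S along [solution_of]. *)
Definition pushes_forward (R : realType) (k l : nat)
    (g : set (vfield R (1 + (k + l))))
    (phi : vfield R (1 + (k + l)) -> pvfield R (k + l)) : Prop :=
  forall S, g S -> forall p : 'cV[R]_(1 + (k + l)),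
    'D_(S p) (@solution_of R k l) p = peval (phi S) (solution_of p).

(* Main.v *)
(* Let W_s = exp(sX) W_0.  A symmetry of the curve of the W_s is an operator which, for every s, acts
   as a multiple alpha(s) of X from W_s to V / W_s (for the second kind this is read off from the
   bilinear forms vanishing on all W_s x W_s, which also show that the closure of the orbit adds
   only the plane <e_0, f_0>; the first kind follows by duality, the reversal of the basis vectors
   in each block exchanging the two curves).  The solution of y^(k) = z^(l) = 0 through a point
   identifies the quotient of E by calX with V, and the fibre of F_1, resp. D, at x with W_(-x).
   Hence a vector field S preserving calX descends to a field u on V, and S preserves F_1, resp. D,
   iff all differentials of u are symmetries of the curve; the x-component of S is then -alpha, so
   that u determines S.  Since X : W_s -> V / W_s has rank at least 2 (this uses k, l >= 2), the
   symmetry of second derivatives makes alpha vanish after sufficiently many differentiations along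
   distinct W_s, and then u itself: u is polynomial of bounded degree.  The polynomial fields whose
   differentials are symmetries form the Sternberg prolongation. *)
Require Import Defs.
From HB Require Import structures.
From mathcomp Require Import all_boot all_order all_algebra.
From mathcomp Require Import all_classical all_reals all_analysis.
From mathcomp Require Import ring lra zify.
From mathcomp Require Import -(notations) mpoly.
Set Implicit Arguments.
Unset Strict Implicit.
Unset Printing Implicit Defensive.
Import Order.TTheory GRing.Theory Num.Theory.
Import numFieldNormedType.Exports.
Local Open Scope classical_set_scope.
Local Open Scope ring_scope.

(** * Differentials of matrix-valued maps *)

(** Both kinds are instances of one argument for W_s = exp(sX)(ker K), where K is the coordinate
    projection onto the indices missing from W_0. The obstacle is that the fields are merely smooth,
    so polynomiality has to be produced by counting. The input is quantitative: exp(sX) is a sum of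
    N monomials in s, so alpha(s) has degree below 2N and is zero once it vanishes at 2N values of
    s; and any D distinct W_s span V and meet in 0. One derivative along W_s kills alpha(s) for
    good, so 2N derivatives along distinct W_s kill alpha; each of D further ones then confines the
    field to one more W_s. Hence all derivatives of order 2N + D vanish, with N = D = k + l in the
    end. On the side of the curves, invariance under a one-parameter group is transferred to the
    bilinear forms that vanish on the curve: there the flow solves a linear differential equation,
    so infinitesimal invariance integrates. Orthogonality for the reversal pairing is shown to be
    compatible with closures in the Grassmannians, so that the closure of the first kind never has
    to be computed. *)

Section MatrixDifferential.
Variable R : realType.
Implicit Types V : normedModType R.

Lemma is_diff_derive V (W : normedModType R) (f df : V -> W) (p v : V) :
  is_diff p f df -> 'D_v f p = df v.
Proof. by move=> fdf; rewrite deriveE; [rewrite diff_val|apply: ex_diff]. Qed.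

Lemma is_diff_sum V (W : normedModType R) (I : Type) (r : seq I)
    (f df : I -> V -> W) (p : V) :
  (forall i, is_diff p (f i) (df i)) ->
  is_diff p (fun q => \sum_(i <- r) f i q) (fun v => \sum_(i <- r) df i v).
Proof.
move=> fdf; elim: r => [|i r IH].
  have -> : (fun q => \sum_(i <- [::]) f i q) = cst 0.
    by apply/funext => q; rewrite big_nil.
  apply: (is_diff_eq (is_diff_cst 0 p)).
  by apply/funext => v; rewrite big_nil.
have -> : (fun q => \sum_(i <- i :: r) f i q) =
    f i + (fun q => \sum_(i <- r) f i q).
  by apply/funext => q; rewrite big_cons.
apply: (is_diff_eq (is_diffD (fdf i) IH)).
by apply/funext => v; rewrite big_cons.
Qed.

Lemma is_diff_mx V m n (f df : V -> 'M[R]_(m, n)) (p : V) :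
  (forall i j, is_diff p (fun q => f q i j) (fun v => df v i j)) ->
  is_diff p f df.
Proof.
move=> fdf.
have E (g : V -> 'M[R]_(m, n)) :
    (fun q => \sum_(i < m) \sum_(j < n) g q i j *: delta_mx i j) = g.
  by apply/funext => q; rewrite [RHS]matrix_sum_delta.
rewrite -[f]E -[df]E.
apply: is_diff_sum => i; apply: is_diff_sum => j; split.
  by apply: differentiableZl; have [] := fdf i j.
by rewrite diffZl; [rewrite (@diff_val _ _ _ _ _ _ _ (fdf i j))|have [] := fdf i j].
Qed.

Lemma is_diff_entry V m n (f df : V -> 'M[R]_(m, n)) (p : V) i j :
  is_diff p f df -> is_diff p (fun q => f q i j) (fun v => df v i j).
Proof.
move=> fdf.
have h : is_diff (f p) (fun N : 'M[R]_(m, n) => N i j : R)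
    (fun N : 'M[R]_(m, n) => N i j : R).
  have @g : {linear 'M[R]_(m, n) -> R}.
    by exists (fun N : 'M[R]_(_, _) => N i j); do 2![eexists]; do ?[constructor];
       rewrite ?mxE// => ? *; rewrite ?mxE//; move=> ?; rewrite !mxE.
  split; first exact: differentiable_coord.
  rewrite (_ : (fun N : 'M[R]_(m, n) => N i j : R) = g) //.
  by rewrite diff_lin //; exact: coord_continuous.
exact: (is_diff_comp fdf h).
Qed.

Lemma is_diff_trmx V m n (f df : V -> 'M[R]_(m, n)) (p : V) :
  is_diff p f df -> is_diff p (fun q => (f q)^T) (fun v => (df v)^T).
Proof.
move=> fdf; apply: is_diff_mx => i j; under eq_fun do rewrite mxE.
by apply: (is_diff_eq (is_diff_entry j i fdf)); apply/funext => h; rewrite mxE.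
Qed.

Lemma is_diff_mul V (f g df dg : V -> R) (p : V) :
  is_diff p f df -> is_diff p g dg ->
  is_diff p (fun q => f q * g q) (fun v => df v * g p + f p * dg v).
Proof.
move=> F G; apply: (is_diff_eq (is_diffM F G)).
by apply/funext => v /=; rewrite !fctE /= addrC mulrC.
Qed.

Lemma is_diff_add V (W : normedModType R) (f g df dg : V -> W) (p : V) :
  is_diff p f df -> is_diff p g dg ->
  is_diff p (fun q => f q + g q) (fun v => df v + dg v).
Proof. by move=> F G; exact: (is_diffD F G). Qed.

Lemma is_diff_opp V (W : normedModType R) (f df : V -> W) (p : V) :
  is_diff p f df -> is_diff p (fun q => - f q) (fun v => - df v).
Proof. by move=> F; exact: (is_diffN F). Qed.

Lemma is_diff_sub V (W : normedModType R) (f g df dg : V -> W) (p : V) :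
  is_diff p f df -> is_diff p g dg ->
  is_diff p (fun q => f q - g q) (fun v => df v - dg v).
Proof. by move=> F G; apply: is_diff_add F _; apply: is_diff_opp. Qed.

Lemma is_diff_const V (W : normedModType R) (c : W) (p : V) :
  is_diff p (fun=> c) (fun=> 0).
Proof. exact: is_diff_cst. Qed.

Lemma is_diff_ident V (p : V) : is_diff p (fun q => q) (fun v => v).
Proof. exact: is_diff_id. Qed.

Lemma is_diff_mulmx V m n q (f df : V -> 'M[R]_(m, n)) (g dg : V -> 'M[R]_(n, q))
    (p : V) :
  is_diff p f df -> is_diff p g dg ->
  is_diff p (fun q => f q *m g q) (fun v => df v *m g p + f p *m dg v).
Proof.
move=> F G; apply: is_diff_mx => i j.
have -> : (fun x => (f x *m g x) i j) = (fun x => \sum_k f x i k * g x k j).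
  by apply/funext => x; rewrite mxE.
apply: (is_diff_eq (is_diff_sum (df := fun k v =>
   df v i k * g p k j + f p i k * dg v k j) _ _)).
  by move=> k; apply: is_diff_mul; apply: is_diff_entry.
by apply/funext => v; rewrite !mxE big_split.
Qed.

Lemma is_diff_mulmxr V m n q (A : 'M[R]_(m, n)) (g dg : V -> 'M[R]_(n, q)) (p : V) :
  is_diff p g dg -> is_diff p (fun q => A *m g q) (fun v => A *m dg v).
Proof.
move=> G; apply: (is_diff_eq (is_diff_mulmx (is_diff_const A p) G)).
by apply/funext => v; rewrite mul0mx add0r.
Qed.

Lemma is_diff_scale V m n (k dk : V -> R) (f df : V -> 'M[R]_(m, n)) (p : V) :
  is_diff p k dk -> is_diff p f df ->
  is_diff p (fun q => k q *: f q) (fun v => dk v *: f p + k p *: df v).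
Proof.
move=> F G; apply: is_diff_mx => i j.
have -> : (fun x => (k x *: f x) i j) = (fun x => k x * f x i j).
  by apply/funext => x; rewrite mxE.
apply: (is_diff_eq (is_diff_mul F (is_diff_entry i j G))).
by apply/funext => v; rewrite !mxE.
Qed.

Lemma is_diff_chain V (W U : normedModType R) (f df : V -> W) (g dg : W -> U) (p : V) :
  is_diff p f df -> is_diff (f p) g dg ->
  is_diff p (fun q => g (f q)) (fun v => dg (df v)).
Proof. by move=> F G; exact: (is_diff_comp F G). Qed.

Lemma is_diff_real (W : normedModType R) (f : R -> W) (x : R) (d : W) :
  is_derive x 1 f d -> is_diff x f (fun h => h *: d).
Proof.
move=> [fx fd]; split; first exact/derivable1_diffP.
by rewrite deriv1E // derive1E fd.
Qed.

Lemma is_diff_realD (W : normedModType R) (f df : R -> W) (x : R) :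
  is_diff x f df -> is_derive x 1 f (df 1).
Proof.
move=> fd; split; last exact: is_diff_derive.
by apply: diff_derivable; apply: ex_diff.
Qed.

Lemma is_diff_exprS (t : R) m :
  is_diff t (fun s : R => s ^+ m.+1) (fun h : R => h * (m.+1%:R * t ^+ m)).
Proof.
have h0 : is_diff t (fun s : R => s) (fun h : R => h) by exact: is_diff_ident.
elim: m => [|m IH].
  have -> : (fun s : R => s ^+ 1) = fun s => s by apply/funext => s; rewrite expr1.
  by apply: (is_diff_eq h0); apply/funext => h; rewrite expr0 !mulr1.
have -> : (fun s : R => s ^+ m.+2) = fun s => s * s ^+ m.+1.
  by apply/funext => s; rewrite exprS.
apply: (is_diff_eq (is_diff_mul h0 IH)); apply/funext => h.
by rewrite exprS -[m.+2%:R]natr1; ring.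
Qed.

End MatrixDifferential.

(** * The matrix exponential *)

Section MatrixExponential.
Variable R : realType.

Lemma cvg_cst_eq (W : normedModType R) (a b : W) :
  (cst a : nat -> W) @ \oo --> b -> b = a.
Proof.
move=> ab; apply: (@cvg_unique _ (@norm_hausdorff _ W) _ _ _ _ ab).
exact: cvg_cst.
Qed.

Lemma cvg_bigsum (W : normedModType R) (T I : Type) (F : set_system T) {FF : Filter F}
    (r : seq I) (f : I -> T -> W) (a : I -> W) :
  (forall i, f i @ F --> a i) ->
  (fun x => \sum_(i <- r) f i x) @ F --> \sum_(i <- r) a i.
Proof. by move=> fa; apply: cvg_big => [|i _]; [exact: add_continuous|exact: fa]. Qed.

Lemma cvg_mx (T : Type) (F : set_system T) {FF : Filter F} m n
    (f : T -> 'M[R]_(m, n)) (M : 'M[R]_(m, n)) :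
  (forall i j, (fun x => f x i j) @ F --> M i j) -> f @ F --> M.
Proof.
move=> fM; apply/cvgrPdist_lt => e e0.
have : \forall x \near F, forall ij : 'I_m * 'I_n,
    `|M ij.1 ij.2 - f x ij.1 ij.2| < e.
  apply: filter_forall => -[i j] /=.
  by have /cvgrPdist_lt/(_ e e0) := fM i j.
apply: filterS => x xe; rewrite [ltLHS]/Num.Def.normr/= mx_normrE.
by rewrite bigmax_lt //= => -[i j] _; rewrite !mxE; exact: (xe (i, j)).
Qed.

Lemma cvg_mx_entry (T : Type) (F : set_system T) m n
    (f : T -> 'M[R]_(m, n)) (M : 'M[R]_(m, n)) i j :
  f @ F --> M -> (fun x => f x i j) @ F --> M i j.
Proof. by move=> fM; exact: (cvg_comp _ _ fM (@coord_continuous R m n i j M)). Qed.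

Lemma continuous_mx (T : topologicalType) m n (f : T -> 'M[R]_(m, n)) :
  (forall i j, continuous (fun x => f x i j)) -> continuous f.
Proof. by move=> fc x; apply: cvg_mx => i j; exact: fc. Qed.

Variable n : nat.
Implicit Types A B : 'M[R]_n.

Definition expcoef A (i j : 'I_n) (m : nat) : R := (A ^+ m) i j / m`!%:R.

Definition rowsum_bound A : R := \sum_i \sum_j `|A i j|.

(** The total of the absolute entries bounds every row, so one more factor [A] multiplies the bound
    by at most [rowsum_bound A]. The entries of the exponential are thereby compared with a scalar
    exponential series. *)
Lemma expmx_entry_bound A (m : nat) i j : `|(A ^+ m) i j| <= rowsum_bound A ^+ m.
Proof.
elim: m i j => [|m IH] i j.
  by rewrite !expr0 mxE; case: (i == j); rewrite ?normr1 ?normr0.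
rewrite exprS mxE (le_trans (ler_norm_sum _ _ _)) //.
apply: (@le_trans _ _ (\sum_k `|A i k| * rowsum_bound A ^+ m)).
  by apply: ler_sum => k _; rewrite normrM ler_wpM2l.
have b0 : 0 <= rowsum_bound A.
  by apply: sumr_ge0 => a _; apply: sumr_ge0.
rewrite -mulr_suml exprS ler_wpM2r ?exprn_ge0 //.
rewrite /rowsum_bound [leRHS](bigD1 i) //= lerDl.
by apply: sumr_ge0 => a _; apply: sumr_ge0.
Qed.

Lemma expcoef_cvg A i j (t : R) : cvgn (pseries (expcoef A i j) t).
Proof.
apply: normed_cvg.
apply: (@series_le_cvg _ _ (exp_coeff (rowsum_bound A * `|t|))).
- by move=> m; exact: normr_ge0.
- move=> m; rewrite /exp_coeff /= divr_ge0 // exprn_ge0 // mulr_ge0 //.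
  by apply: sumr_ge0 => a _; apply: sumr_ge0.
- move=> m; rewrite /exp_coeff /= /expcoef !normrM normfV exprMn.
  rewrite [`|_%:R|]ger0_norm // normrX mulrAC ler_wpM2r ?invr_ge0 //.
  by rewrite ler_wpM2r ?exprn_ge0 //; exact: expmx_entry_bound.
- exact: is_cvg_series_exp_coeff.
Qed.

Lemma exprZmx A (t : R) m : (t *: A) ^+ m = t ^+ m *: A ^+ m.
Proof.
elim: m => [|m IH]; first by rewrite !expr0 scale1r.
by rewrite !exprS IH -!mulmxE -scalemxAl -scalemxAr scalerA.
Qed.

Lemma expmx_partial_entry A (t : R) i j m :
  series (fun r : nat => (r`!%:R)^-1 *: (t *: A) ^+ r) m i j =
  pseries (expcoef A i j) t m.
Proof.
rewrite /pseries /series /= summxE; apply: eq_bigr => r _.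
by rewrite exprZmx !mxE /expcoef; ring.
Qed.

Lemma expmx_cvg A :
  series (fun r : nat => (r`!%:R)^-1 *: A ^+ r) @ \oo --> expmx A.
Proof.
suff : cvgn (series (fun r : nat => (r`!%:R)^-1 *: (1 *: A) ^+ r)).
  by rewrite scale1r.
apply/cvg_ex; exists (\matrix_(i, j) limn (pseries (expcoef A i j) 1)).
apply: cvg_mx => i j; rewrite mxE.
under eq_fun do rewrite expmx_partial_entry.
exact: expcoef_cvg.
Qed.

Lemma expmxE A (t : R) i j : expmx (t *: A) i j = limn (pseries (expcoef A i j) t).
Proof.
have := cvg_mx_entry (i := i) (j := j) (@expmx_cvg (t *: A)).
under eq_fun do rewrite expmx_partial_entry.
by move=> /cvg_lim <-.
Qed.

(** Termwise differentiation of the entries of exp(tA) amounts to multiplication by [A]. Hence the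
    derived series converge as well, and their sums are the entries of A exp(tA). *)
Lemma expcoef_diffs A i j : pseries_diffs (expcoef A i j) =
  (fun m => \sum_k A i k * expcoef A k j m).
Proof.
apply/funext => m; rewrite /pseries_diffs /expcoef exprS mxE mulr_suml mulr_sumr.
apply: eq_bigr => k _; rewrite factS natrM.
by field; rewrite nat1r !pnatr_eq0 -lt0n fact_gt0.
Qed.

Lemma pseries_lincomb (a : 'I_n -> R) (c : 'I_n -> R ^nat) (t : R) :
  pseries (fun m => \sum_k a k * c k m) t =
  (fun m => \sum_k a k *: pseries (c k) t m).
Proof.
apply/funext => m; rewrite /pseries /series /=.
under [RHS]eq_bigr do rewrite scaler_sumr.
rewrite exchange_big /=; apply: eq_bigr => r _.
by rewrite mulr_suml; apply: eq_bigr => k _; rewrite -mulrA.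
Qed.

Lemma pseries_lincomb_cvg (a : 'I_n -> R) (c : 'I_n -> R ^nat) (t : R) :
  (forall k, cvgn (pseries (c k) t)) ->
  cvgn (pseries (fun m => \sum_k a k * c k m) t).
Proof.
move=> cc; rewrite pseries_lincomb.
apply/cvg_ex; exists (\sum_k a k *: limn (pseries (c k) t)).
by apply: cvg_bigsum => k; apply: cvgZl_tmp; exact: cc.
Qed.

Lemma expcoef_diffs_cvg A i j t : cvgn (pseries (pseries_diffs (expcoef A i j)) t).
Proof.
by rewrite expcoef_diffs; apply: pseries_lincomb_cvg => k; exact: expcoef_cvg.
Qed.

Lemma expcoef_diffs2_cvg A i j t :
  cvgn (pseries (pseries_diffs (pseries_diffs (expcoef A i j))) t).
Proof.
rewrite expcoef_diffs.
have -> : pseries_diffs (fun m => \sum_k A i k * expcoef A k j m) =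
    (fun m => \sum_k A i k * pseries_diffs (expcoef A k j) m).
  apply/funext => m; rewrite /pseries_diffs mulr_sumr.
  by apply: eq_bigr => k _; rewrite mulrCA.
exact: (pseries_lincomb_cvg (fun k => @expcoef_diffs_cvg A k j t)).
Qed.

Lemma is_diff_expmx A (t : R) :
  is_diff t (fun s => expmx (s *: A)) (fun h => h *: (A *m expmx (t *: A))).
Proof.
apply: is_diff_mx => i j.
have -> : (fun s => expmx (s *: A) i j) = (fun s => limn (pseries (expcoef A i j) s)).
  by apply/funext => s; rewrite expmxE.
have t1 : `|t| < `| (`|t| + 1) |.
  by rewrite [ltRHS]ger0_norm ?ltrDl ?addr_ge0.
have := pseries_snd_diffs (@expcoef_cvg A i j _) (@expcoef_diffs_cvg A i j _)
  (@expcoef_diffs2_cvg A i j _) t1.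
move/is_diff_real => h; apply: (is_diff_eq h).
apply/funext => x; rewrite mxE; congr (_ * _).
have : pseries (pseries_diffs (expcoef A i j)) t @ \oo --> (A *m expmx (t *: A)) i j.
  rewrite mxE expcoef_diffs pseries_lincomb.
  by apply: cvg_bigsum => k; rewrite expmxE; apply: cvgZl_tmp; exact: expcoef_cvg.
by move/cvg_lim => ->.
Qed.

(** A linear map of matrices is continuous, being a finite combination of coordinates, so it passes
    to the limit of the partial sums. Linear identities for exp(A) thus reduce to identities for the
    powers of [A]. *)
Lemma expmx_limit_pred m q (g : {linear 'M[R]_n -> 'M[R]_(m, q)}) A :
  (forall r, g (A ^+ r) = 0) -> g (expmx A) = 0.
Proof.
move=> gA.
have gc : continuous g.
  have -> : g = (fun M => \sum_i \sum_j M i j *: g (delta_mx i j)) :> (_ -> _).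
    apply/funext => M; rewrite {1}[M]matrix_sum_delta linear_sum.
    by apply: eq_bigr => i _; rewrite linear_sum; apply: eq_bigr => j _; rewrite linearZ.
  move=> M; apply: (cvg_bigsum (F := nbhs M)) => i.
  apply: (cvg_bigsum (F := nbhs M)) => j.
  by apply: cvgZr_tmp; exact: coord_continuous.
have := cvg_comp _ _ (@expmx_cvg A) (gc (expmx A)).
rewrite (_ : g \o _ = cst 0); last first.
  apply/funext => r /=; rewrite /series /= linear_sum big1 // => i _.
  by rewrite linearZ /= gA scaler0.
exact: cvg_cst_eq.
Qed.

Lemma expmx_comm A : A *m expmx A = expmx A *m A.
Proof.
pose g : {linear 'M[R]_n -> 'M[R]_n} := mulmx A \- mulmxr A.
have gr r : g (A ^+ r) = 0.
  by apply/eqP; rewrite /= subr_eq0 !mulmxE -exprS -exprSr.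
have /eqP := expmx_limit_pred gr.
by rewrite /= subr_eq0 => /eqP.
Qed.

Lemma expmx0 : expmx (0 : 'M[R]_n) = 1%:M.
Proof.
(* The partial sum of index 0 is empty; after the shift the sequence is constantly the identity. *)
have := @expmx_cvg 0; rewrite -(cvg_shiftS _) /=.
rewrite (_ : (fun k => _) = cst 1%:M); last first.
  apply/funext => m; rewrite /series /= big_nat_recl //= expr0 invr1 scale1r.
  by rewrite big1 ?addr0 // => i _; rewrite exprS mul0r scaler0.
exact: cvg_cst_eq.
Qed.

Lemma expmxZ_comm A (t : R) : A *m expmx (t *: A) = expmx (t *: A) *m A.
Proof.
have [->|t0] := eqVneq t 0; first by rewrite scale0r expmx0 mul1mx mulmx1.
by apply: (scalerI t0); rewrite scalemxAl expmx_comm scalemxAr.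
Qed.

Lemma mx_zero_diff_const m q (f : R -> 'M[R]_(m, q)) (x y : R) :
  (forall t, is_diff t f (fun=> 0)) -> f x = f y.
Proof.
move=> f0; apply/matrixP => i j.
apply: (is_derive_0_is_cst (f := fun t => f t i j)) => t.
by have := is_diff_realD (is_diff_entry i j (f0 t)); rewrite mxE.
Qed.

Lemma is_diff_expmxN A (t : R) :
  is_diff t (fun s => expmx (- s *: A)) (fun h => - h *: (expmx (- t *: A) *m A)).
Proof.
apply: (is_diff_eq (is_diff_chain (is_diff_opp (is_diff_ident t)) (is_diff_expmx A (- t)))).
by apply/funext => h /=; congr (_ *: _); exact: expmxZ_comm.
Qed.

(** The product exp(-tA) Y(t) has zero derivative. The resulting uniqueness gives the group law, the
    closed form of exp(tX) and the conjugation of exponentials without multiplying series. *)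
Lemma mx_linear_ode A m (Y : R -> 'M[R]_(n, m)) :
  (forall t, is_diff t Y (fun h => h *: (A *m Y t))) ->
  forall t, expmx (- t *: A) *m Y t = Y 0.
Proof.
move=> dY t.
have C (s : R) : is_diff s (fun t : R => expmx (- t *: A) *m Y t) (fun=> 0).
  apply: (is_diff_eq (is_diff_mulmx (is_diff_expmxN A s) (dY s))).
  by apply/funext => h; rewrite -scalemxAl -scalemxAr scaleNr mulmxA addNr.
have -> : Y 0 = expmx (- 0 *: A) *m Y 0 by rewrite oppr0 scale0r expmx0 mul1mx.
exact: (mx_zero_diff_const t 0 C).
Qed.

Lemma expmxNK A t : expmx (- t *: A) *m expmx (t *: A) = 1%:M.
Proof.
have := @mx_linear_ode A n (fun t => expmx (t *: A)) (is_diff_expmx A) t.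
by rewrite scale0r expmx0.
Qed.

Lemma expmxKN A t : expmx (t *: A) *m expmx (- t *: A) = 1%:M.
Proof. exact: (mulmx1C (expmxNK A t)). Qed.

Lemma mx_linear_ode_unique A m (Y : R -> 'M[R]_(n, m)) :
  (forall t, is_diff t Y (fun h => h *: (A *m Y t))) ->
  forall t, Y t = expmx (t *: A) *m Y 0.
Proof.
move=> dY t; rewrite -(mx_linear_ode dY t) mulmxA expmxKN mul1mx //.
Qed.

Lemma expmxD A s t : expmx ((s + t) *: A) = expmx (s *: A) *m expmx (t *: A).
Proof.
have h (r : R) : is_diff r (fun s : R => s + t) (fun h => h).
  apply: (is_diff_eq (is_diff_add (is_diff_ident r) (is_diff_const t r))).
  by apply/funext => h; exact: addr0.
have dY (r : R) : is_diff r (fun s : R => expmx ((s + t) *: A))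
    (fun h => h *: (A *m expmx ((r + t) *: A))).
  exact: (is_diff_chain (h r) (is_diff_expmx A (r + t))).
have := mx_linear_ode_unique dY s.
by rewrite (add0r t).
Qed.

Lemma expmx_unit A : expmx A \in unitmx.
Proof.
by have := expmxKN A 1; rewrite scale1r => /mulmx1_unit[].
Qed.

End MatrixExponential.

(** * Smooth maps and vector fields *)

Section ScalarSmooth.
Variables (R : realType) (n : nat).
Local Notation V := 'cV[R]_n.
Implicit Types (f g : V -> R) (p v w : V).

Fixpoint sCdiff (r : nat) (f : V -> R) : Prop :=
  match r with
  | 0 => continuous f
  | r'.+1 => (forall p, differentiable f p) /\
             (forall v, sCdiff r' (fun p => 'D_v f p))
  end.

Definition ssmooth f := forall r, sCdiff r f.

Lemma ssmooth_diff f p : ssmooth f -> is_diff p f (fun v => 'D_v f p).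
Proof.
move=> /(_ 1%N)[fd _]; split; first exact: fd.
by apply/funext => v; rewrite deriveE.
Qed.

Lemma ssmooth_derive f v : ssmooth f -> ssmooth (fun p => 'D_v f p).
Proof. by move=> fs r; have [_] := fs r.+1; apply. Qed.

Lemma ssmooth_continuous f : ssmooth f -> continuous f.
Proof. by move/(_ 0%N). Qed.

(** Induction on the order of differentiability. Smoothness is obtained by exhibiting a class closed
    under differentiation (coordinates and constants, polynomials, a generated algebra) instead of
    computing higher derivatives. *)
Lemma ssmooth_coind (F : set (V -> R)) :
  (forall f, F f -> (forall p, differentiable f p) /\
     forall v, F (fun p => 'D_v f p)) ->
  forall f, F f -> ssmooth f.
Proof.
move=> FP f Ff r; elim: r f Ff => [|r IH] f /FP[fd Fd] /=.
  by move=> p; apply: differentiable_continuous.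
by split=> // v; apply: IH.
Qed.

(** The algebra generated by the smooth functions and the constants. By the Leibniz rule it is
    stable under derivatives, which gives smoothness of products with no formula for their higher
    derivatives. *)
Inductive smooth_alg : (V -> R) -> Prop :=
| Salg_base f of ssmooth f : smooth_alg f
| Salg_cst (c : R) : smooth_alg (fun=> c)
| Salg_add f g of smooth_alg f & smooth_alg g : smooth_alg (fun p => f p + g p)
| Salg_mul f g of smooth_alg f & smooth_alg g : smooth_alg (fun p => f p * g p).

Lemma smooth_alg_ssmooth f : smooth_alg f -> ssmooth f.
Proof.
apply: (ssmooth_coind (F := smooth_alg)) => {}f.
suff H : smooth_alg f -> exists2 df : V -> V -> R,
    forall p, is_diff p f (df p) & forall v, smooth_alg (df^~ v).
  move=> /H[df dfP dfA]; split=> [p|v]; first by have [] := dfP p.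
  rewrite (_ : (fun p => _) = df^~ v) //.
  by apply/funext => p; rewrite (is_diff_derive v (dfP p)).
elim=> {f} [f fs|c|f g _ [df dfP dfA] _ [dg dgP dgA]|f g Af [df dfP dfA] Ag [dg dgP dgA]].
- exists (fun p v => 'D_v f p) => [p|v]; first exact: ssmooth_diff.
  exact/Salg_base/ssmooth_derive.
- exists (fun _ _ => 0) => [p|v]; [exact: is_diff_const|exact: Salg_cst].
- exists (fun p v => df p v + dg p v) => [p|v]; first exact: is_diff_add.
  exact: Salg_add.
- exists (fun p v => df p v * g p + f p * dg p v) => [p|v]; first exact: is_diff_mul.
  by apply: Salg_add; apply: Salg_mul.
Qed.

Lemma ssmooth_cst (c : R) : ssmooth (fun=> c).
Proof. exact/smooth_alg_ssmooth/Salg_cst. Qed.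

Lemma ssmooth_add f g : ssmooth f -> ssmooth g -> ssmooth (fun p => f p + g p).
Proof. by move=> fs gs; apply/smooth_alg_ssmooth/Salg_add; apply/Salg_base. Qed.

Lemma ssmooth_mul f g : ssmooth f -> ssmooth g -> ssmooth (fun p => f p * g p).
Proof. by move=> fs gs; apply/smooth_alg_ssmooth/Salg_mul; apply/Salg_base. Qed.

Lemma ssmooth_opp f : ssmooth f -> ssmooth (fun p => - f p).
Proof.
move=> fs; rewrite (_ : (fun p => _) = (fun p => -1 * f p)).
  exact: ssmooth_mul (ssmooth_cst _) fs.
by apply/funext => p; rewrite mulN1r.
Qed.

Lemma ssmooth_sum (I : Type) (r : seq I) (f : I -> V -> R) :
  (forall i, ssmooth (f i)) -> ssmooth (fun p => \sum_(i <- r) f i p).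
Proof.
move=> fs; elim: r => [|i r IH].
  rewrite (_ : (fun p => _) = (fun=> 0)); first exact: ssmooth_cst.
  by apply/funext => p; rewrite big_nil.
rewrite (_ : (fun p => _) = (fun p => f i p + \sum_(i <- r) f i p)).
  exact: ssmooth_add.
by apply/funext => p; rewrite big_cons.
Qed.

Lemma ssmooth_coord i : ssmooth (fun p => p i 0).
Proof.
pose F : set (V -> R) := [set f | f = (fun p : V => p i 0) \/ exists c : R, f = fun=> c].
apply: (ssmooth_coind (F := F)); last by left.
move=> f [->|[c ->]]; split.
- by move=> p; have [] := is_diff_entry i 0 (is_diff_ident p).
- move=> v; right; exists (v i 0); apply/funext => p.
  exact: is_diff_derive (is_diff_entry i 0 (is_diff_ident p)).
- by move=> p; have [] := is_diff_const c p.
- move=> v; right; exists 0; apply/funext => p.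
  exact: is_diff_derive (is_diff_const c p).
Qed.

Lemma is_diff_line p v (t : R) :
  is_diff t (fun s : R => p + s *: v) (fun h : R => h *: v).
Proof.
have h1 : is_diff t (fun s : R => s) (fun h : R => h) by exact: is_diff_ident.
have h2 : is_diff t (fun s : R => v) (fun h : R => 0) by exact: is_diff_const.
have h3 : is_diff t (fun s : R => p) (fun h : R => 0) by exact: is_diff_const.
apply: (is_diff_eq (is_diff_add h3 (is_diff_scale h1 h2))).
by apply/funext => h; rewrite add0r scaler0 addr0.
Qed.

Lemma ssmooth_line f p v (t : R) : ssmooth f ->
  is_derive t 1 (fun s : R => f (p + s *: v)) ('D_v f (p + t *: v)).
Proof.
move=> fs.
have h := is_diff_realD (is_diff_chain (is_diff_line p v t) (ssmooth_diff (p + t *: v) fs)).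
by rewrite scale1r in h.
Qed.

Lemma real_mvt (f df : R -> R) (h : R) : 0 < h ->
  (forall t : R, is_derive t (1 : R) f (df t)) ->
  exists2 c, c \in `[0, h] & f h - f 0 = df c * h.
Proof.
move=> h0 fdf; have fc : {within `[0, h], continuous f}.
  apply: continuous_subspaceT => x.
  by apply: differentiable_continuous; apply/derivable1_diffP; have [] := fdf x.
have [c ch E] := MVT_segment (ltW h0) (fun x _ => fdf x) fc.
by exists c => //; rewrite E subr0.
Qed.

(** The mean value theorem is applied twice: along [v] to the difference of [f] on two parallel
    segments, then along [w] to the derivative in direction [v]. *)
Lemma second_difference f p v w (h : R) : 0 < h -> ssmooth f ->
  exists a b, [/\ a \in `[0, h], b \in `[0, h] &
    f (p + h *: v + h *: w) - f (p + h *: v) - (f (p + h *: w) - f p) =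
    'D_w (fun q => 'D_v f q) (p + a *: v + b *: w) * h * h].
Proof.
move=> h0 fs.
pose phi (s : R) := f (p + h *: w + s *: v) - f (p + s *: v).
have phid (s : R) : is_derive s 1 phi ('D_v f (p + h *: w + s *: v) - 'D_v f (p + s *: v)).
  by apply: is_deriveB; exact: ssmooth_line.
have [a ah E1] := real_mvt h0 phid.
have [b bh E2] := real_mvt h0 (fun t => ssmooth_line (p + a *: v) w t (ssmooth_derive v fs)).
exists a, b; split => //.
move: E1; rewrite /phi !scale0r !addr0 [p + h *: w + h *: v]addrAC => ->.
by move: E2; rewrite scale0r addr0 [p + a *: v + h *: w]addrAC => ->.
Qed.

Lemma dist_half_le (x y z e : R) :
  `|x - z| < e / 2 -> `|y - z| < e / 2 -> `|x - y| <= e.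
Proof.
move=> xz yz; apply: ltW; rewrite [ltRHS]splitr.
apply: (le_lt_trans (ler_distD z x y)); apply: ltrD; first exact: xz.
by rewrite distrC.
Qed.

(** The second difference is symmetric in [v] and [w], so by [second_difference] the two mixed
    derivatives take a common value at two points close to [p]; continuity concludes. *)
Lemma ssmooth_schwarz f v w p : ssmooth f ->
  'D_w (fun q => 'D_v f q) p = 'D_v (fun q => 'D_w f q) p.
Proof.
move=> fs; apply/eqP; rewrite -subr_eq0.
set F := fun q => 'D_w (fun q => 'D_v f q) q.
set G := fun q => 'D_v (fun q => 'D_w f q) q.
have Fc : continuous F by apply/ssmooth_continuous/ssmooth_derive/ssmooth_derive.
have Gc : continuous G by apply/ssmooth_continuous/ssmooth_derive/ssmooth_derive.
have gc v' w' : continuous (fun ab : R * R => p + ab.1 *: v' + ab.2 *: w').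
  move=> ab; apply: cvgD; first apply: cvgD; first exact: cvg_cst.
    by apply: cvgZr_tmp; exact: cvg_fst.
  by apply: cvgZr_tmp; exact: cvg_snd.
have near0 (H : V -> R) v' w' (e : R) : continuous H -> 0 < e ->
    exists2 d : R, 0 < d & forall a b : R, `|a| < d -> `|b| < d ->
      `|H p - H (p + a *: v' + b *: w')| < e.
  move=> Hc e0.
  have Hp : H (p + (0 : R) *: v' + (0 : R) *: w') = H p by rewrite !scale0r !addr0.
  have : (fun ab : R * R => H (p + ab.1 *: v' + ab.2 *: w')) @ ((0, 0) : R * R) --> H p.
    by rewrite -Hp; exact: (cvg_comp _ _ (gc v' w' (0, 0)) (Hc _)).
  move=> /cvgrPdist_lt/(_ e e0)/nbhs_ballP[d d0 dH]; exists d => // a b ad bd.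
  by apply: (dH (a, b)); split; rewrite /ball /= sub0r normrN.
rewrite -normr_le0; apply/ler_addgt0Pl => e e0; rewrite addr0.
have e20 : 0 < e / 2 by rewrite divr_gt0.
have [d1 d10 H1] := near0 F v w _ Fc e20.
have [d2 d20 H2] := near0 G w v _ Gc e20.
(* Half of the minimum keeps the intermediate points, with parameters in [0, h], strictly within
   both radii. *)
pose h := Num.min d1 d2 / 2.
have m0 : 0 < Num.min d1 d2 by rewrite lt_min d10.
have h0 : 0 < h by rewrite divr_gt0.
have hm : h < Num.min d1 d2 by rewrite /h ltr_pdivrMr // ltr_pMr // ltr1n.
have [a [b [ah bh E1]]] := second_difference p v w h0 fs.
have [a' [b' [a'h b'h E2]]] := second_difference p w v h0 fs.
have small (c : R) : c \in `[0, h] -> `|c| < Num.min d1 d2.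
  by rewrite in_itv /= => /andP[c0 ch]; rewrite ger0_norm // (le_lt_trans ch).
have E : F (p + a *: v + b *: w) = G (p + a' *: w + b' *: v).
  have hn : h * h != 0 by rewrite mulf_neq0 // gt_eqF.
  apply: (mulIf hn); rewrite [LHS]mulrA [RHS]mulrA. apply: (etrans (esym E1)); apply: etrans E2.
  by rewrite [p + h *: w + h *: v]addrAC; ring.
have := H1 a b; have := H2 a' b'; rewrite -E.
move/(_ (lt_le_trans (small _ a'h) _) (lt_le_trans (small _ b'h) _)).
rewrite ge_min lexx orbT => /(_ isT isT) G1.
move/(_ (lt_le_trans (small _ ah) _) (lt_le_trans (small _ bh) _)).
rewrite ge_min lexx => /(_ isT isT) F1.
exact: (dist_half_le F1 G1).
Qed.

End ScalarSmooth.

(** * Smooth maps between column spaces and the bracket of vector fields *)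

Section VectorSmooth.
Variable R : realType.

Lemma derive_entry n m (f : 'cV[R]_n -> 'cV[R]_m) p v i :
  differentiable f p -> 'D_v (fun q => f q i 0) p = 'D_v f p i 0.
Proof.
move=> fd; rewrite (is_diff_derive v (is_diff_entry i 0 (differentiableP fd))).
by rewrite deriveE.
Qed.

Lemma smoothP n m (f : 'cV[R]_n -> 'cV[R]_m) :
  smooth f <-> forall i, ssmooth (fun p => f p i 0).
Proof.
split=> [fs i r|fs].
  elim: r f fs => [|r IH] f fs /=.
    by move=> p; apply: cvg_mx_entry; exact: (fs 0%N).
  have fd p : differentiable f p by have [] := fs 1%N.
  split=> [p|v]; first by have [] := is_diff_entry i 0 (differentiableP (fd p)).
  rewrite (_ : (fun p => 'D_v _ p) = fun p => ('D_v f p) i 0).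
    by apply: (IH (fun p => 'D_v f p)) => s; have [_] := fs s.+1; apply.
  by apply/funext => p; apply: derive_entry.
move=> r; elim: r f fs => [|r IH] f fs /=.
  by apply: continuous_mx => i j; rewrite ord1; exact/ssmooth_continuous/fs.
have fd p : differentiable f p.
  have := is_diff_mx (df := fun v => \col_i 'D_v (fun p => f p i 0) p) (p := p) (f := f).
  case=> // i j; rewrite ord1.
  by apply: (is_diff_eq (ssmooth_diff p (fs i))); apply/funext => v; rewrite mxE.
split=> // v; apply: (IH (fun p => 'D_v f p)) => i.
rewrite (_ : (fun p => _) = fun p => 'D_v (fun q => f q i 0) p).
  exact/ssmooth_derive/fs.
by apply/funext => p; rewrite derive_entry.
Qed.

Lemma smooth_differentiable n m (f : 'cV[R]_n -> 'cV[R]_m) p : smooth f -> differentiable f p.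
Proof. by move=> /(_ 1%N)[]. Qed.

Lemma smooth_is_diff n m (f : 'cV[R]_n -> 'cV[R]_m) p : smooth f ->
  is_diff p f (fun v => 'D_v f p).
Proof.
move=> fs; have fd := smooth_differentiable p fs; split=> //.
by apply/funext => v; rewrite deriveE.
Qed.

Lemma smooth_derive n m (f : 'cV[R]_n -> 'cV[R]_m) v : smooth f -> smooth (fun p => 'D_v f p).
Proof. by move=> fs r; have [_] := fs r.+1; apply. Qed.

Lemma derive_linear n m (f : 'cV[R]_n -> 'cV[R]_m) p (a : R) (v w : 'cV[R]_n) :
  differentiable f p -> 'D_(a *: v + w) f p = a *: 'D_v f p + 'D_w f p.
Proof. by move=> fd; rewrite !deriveE // linearP. Qed.

Lemma derive_lincomb n m (f : 'cV[R]_n -> 'cV[R]_m) p I (r : seq I) (a : I -> R)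
    (v : I -> 'cV[R]_n) :
  differentiable f p ->
  'D_(\sum_(i <- r) a i *: v i) f p = \sum_(i <- r) a i *: 'D_(v i) f p.
Proof.
move=> fd; rewrite deriveE // linear_sum; apply: eq_bigr => i _.
by rewrite linearZ /= deriveE.
Qed.

Lemma col_basis n (v : 'cV[R]_n) : v = \sum_i v i 0 *: delta_mx i 0.
Proof. by rewrite {1}[v]matrix_sum_delta; apply: eq_bigr => i _; rewrite big_ord1. Qed.

Lemma derive_basis n m (f : 'cV[R]_n -> 'cV[R]_m) p (v : 'cV[R]_n) :
  differentiable f p ->
  'D_v f p = \sum_i v i 0 *: 'D_(delta_mx i 0) f p.
Proof. by move=> fd; rewrite {1}[v]col_basis derive_lincomb. Qed.

Lemma smooth_cst n m (c : 'cV[R]_m) : smooth (fun _ : 'cV[R]_n => c).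
Proof. by apply/smoothP => i; exact: ssmooth_cst. Qed.

Lemma smooth_id n : smooth (fun p : 'cV[R]_n => p).
Proof. by apply/smoothP => i; exact: ssmooth_coord. Qed.

Lemma smooth_add n m (f g : 'cV[R]_n -> 'cV[R]_m) :
  smooth f -> smooth g -> smooth (fun p => f p + g p).
Proof.
move=> /smoothP fs /smoothP gs; apply/smoothP => i.
under eq_fun do rewrite mxE; exact: ssmooth_add.
Qed.

Lemma smooth_scale n m (k : 'cV[R]_n -> R) (f : 'cV[R]_n -> 'cV[R]_m) :
  ssmooth k -> smooth f -> smooth (fun p => k p *: f p).
Proof.
move=> ks /smoothP fs; apply/smoothP => i.
under eq_fun do rewrite mxE; exact: ssmooth_mul.
Qed.

Lemma smooth_sum n m I (r : seq I) (f : I -> 'cV[R]_n -> 'cV[R]_m) :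
  (forall i, smooth (f i)) -> smooth (fun p => \sum_(i <- r) f i p).
Proof.
move=> fs; apply/smoothP => i; under eq_fun do rewrite summxE.
by apply: ssmooth_sum => j; move/smoothP: (fs j); apply.
Qed.

Lemma smooth_mulmx n m q (A : 'M[R]_(q, m)) (f : 'cV[R]_n -> 'cV[R]_m) :
  smooth f -> smooth (fun p => A *m f p).
Proof.
move=> /smoothP fs; apply/smoothP => i; under eq_fun do rewrite mxE.
by apply: ssmooth_sum => j; apply: ssmooth_mul => //; exact: ssmooth_cst.
Qed.

Lemma smooth_sub n m (f g : 'cV[R]_n -> 'cV[R]_m) :
  smooth f -> smooth g -> smooth (fun p => f p - g p).
Proof.
move=> fs gs; apply: smooth_add => //.
under eq_fun do rewrite -scaleN1r; apply: smooth_scale => //; exact: ssmooth_cst.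
Qed.

Lemma smooth_schwarz n m (f : 'cV[R]_n -> 'cV[R]_m) v w p : smooth f ->
  'D_w (fun q => 'D_v f q) p = 'D_v (fun q => 'D_w f q) p.
Proof.
move=> fs; apply/colP => i.
have E a b : 'D_b (fun q => 'D_a f q) p i 0 = 'D_b (fun q => 'D_a (fun q => f q i 0) q) p.
  have F1 : (fun q => 'D_a f q i 0) = (fun q => 'D_a (fun q => f q i 0) q).
    by apply/funext => q; rewrite derive_entry //; exact: smooth_differentiable.
  have dD : differentiable (fun q => 'D_a f q) p.
    exact/smooth_differentiable/smooth_derive.
  by rewrite -(derive_entry b i dD) F1.
rewrite [LHS]E [RHS]E; apply: ssmooth_schwarz.
by move/smoothP: fs; apply.
Qed.

Definition lie n m (S : vfield R n) (f : 'cV[R]_n -> 'cV[R]_m) : 'cV[R]_n -> 'cV[R]_m :=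
  fun p => 'D_(S p) f p.

Lemma lieE n m (S : vfield R n) (f : 'cV[R]_n -> 'cV[R]_m) : smooth f ->
  lie S f = fun p => \sum_i S p i 0 *: 'D_(delta_mx i 0) f p.
Proof.
by move=> fs; apply/funext => p; rewrite /lie derive_basis //; exact: smooth_differentiable.
Qed.

Lemma smooth_lie n m (S : vfield R n) (f : 'cV[R]_n -> 'cV[R]_m) :
  smooth S -> smooth f -> smooth (lie S f).
Proof.
move=> /smoothP Ss fs; rewrite lieE //; apply: smooth_sum => i.
by apply: smooth_scale => //; exact: smooth_derive.
Qed.

Lemma derive_lie n m (S : vfield R n) (f : 'cV[R]_n -> 'cV[R]_m) v p :
  smooth S -> smooth f ->
  'D_v (lie S f) p = 'D_('D_v S p) f p + 'D_(S p) (fun q => 'D_v f q) p.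
Proof.
move=> Ss fs; rewrite lieE //.
have fsd i := smooth_derive (delta_mx i 0) fs.
rewrite (is_diff_derive v (is_diff_sum (df := fun i v =>
   'D_v S p i 0 *: 'D_(delta_mx i 0) f p +
   S p i 0 *: 'D_v (fun q => 'D_(delta_mx i 0) f q) p) _ _)); last first.
  by move=> i; apply: is_diff_scale (is_diff_entry i 0 (smooth_is_diff p Ss))
     (smooth_is_diff p (fsd i)).
rewrite big_split /= -!derive_basis; [congr (_ + _)|exact: smooth_differentiable..].
rewrite [RHS]derive_basis; last exact/smooth_differentiable/smooth_derive.
by apply: eq_bigr => i _; rewrite smooth_schwarz.
Qed.

Lemma sub_add_cancel (W : zmodType) (x y a b c d : W) :
  x = a + c -> y = b + d -> c = d -> x - y = a - b.
Proof. by move=> -> -> ->; rewrite opprD addrACA subrr addr0. Qed.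

(** Each iterated derivative is a first-order term plus a second derivative of [f]; the latter
    cancel by [smooth_schwarz]. *)
Lemma lie_vbracket n m (S T : vfield R n) (f : 'cV[R]_n -> 'cV[R]_m) p :
  smooth S -> smooth T -> smooth f ->
  lie (vbracket S T) f p = lie S (lie T f) p - lie T (lie S f) p.
Proof.
move=> Ss Ts fs.
have E1 : lie S (lie T f) p =
    'D_('D_(S p) T p) f p + 'D_(T p) (fun q => 'D_(S p) f q) p by exact: derive_lie.
have E2 : lie T (lie S f) p =
    'D_('D_(T p) S p) f p + 'D_(S p) (fun q => 'D_(T p) f q) p by exact: derive_lie.
have E3 := smooth_schwarz (T p) (S p) p fs.
rewrite (sub_add_cancel E1 E2 (esym E3)) /lie /vbracket.
have -> : 'D_(S p) T p - 'D_(T p) S p = (-1) *: 'D_(T p) S p + 'D_(S p) T p.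
  by rewrite scaleN1r; exact: addrC.
rewrite derive_linear; last exact: smooth_differentiable.
by rewrite scaleN1r; exact: addrC.
Qed.

Lemma smooth_vbracket n (S T : vfield R n) :
  smooth S -> smooth T -> smooth (vbracket S T).
Proof. by move=> Ss Ts; apply: smooth_sub; exact: smooth_lie. Qed.

Lemma derive_sub n m (f g : 'cV[R]_n -> 'cV[R]_m) v p :
  differentiable f p -> differentiable g p ->
  'D_v (fun q => f q - g q) p = 'D_v f p - 'D_v g p.
Proof.
move=> fd gd.
rewrite (is_diff_derive v (is_diff_sub (differentiableP fd) (differentiableP gd))).
by rewrite !deriveE.
Qed.

Lemma derive_addZ n m (a : R) (f g : 'cV[R]_n -> 'cV[R]_m) v p :
  differentiable f p -> differentiable g p ->
  'D_v (fun q => a *: f q + g q) p = a *: 'D_v f p + 'D_v g p.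
Proof.
move=> fd gd.
rewrite (is_diff_derive v (is_diff_add (is_diff_scale (is_diff_const a p)
  (differentiableP fd)) (differentiableP gd))).
by rewrite scale0r add0r !deriveE.
Qed.

Lemma jacobi_cancel n (a b c d e g : 'cV[R]_n) :
  - (g - d - (a - e)) = a - b - (c - d) - (e - c - (b - g)).
Proof. by apply/matrixP => i j; rewrite !mxE; ring. Qed.

(** A field is itself a vector-valued function, so [lie_vbracket] applies to it and expands every
    nested bracket into iterated Lie derivatives, which then cancel. *)
Lemma vbracket_jacobi n (S T Y : vfield R n) p :
  smooth S -> smooth T -> smooth Y ->
  vbracket (vbracket S T) Y p =
  vbracket S (vbracket T Y) p - vbracket T (vbracket S Y) p.
Proof.
move=> Ss Ts Ys.
have E (A B C : vfield R n) : smooth A -> smooth B -> smooth C ->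
    vbracket A (vbracket B C) p =
    lie A (lie B C) p - lie A (lie C B) p - (lie B (lie C A) p - lie C (lie B A) p).
  move=> As Bs Cs; rewrite {1}/vbracket -/(lie (vbracket B C) A p) lie_vbracket //.
  by rewrite derive_sub //; apply/smooth_differentiable/smooth_lie.
have E' : vbracket (vbracket S T) Y p = - vbracket Y (vbracket S T) p.
  by rewrite /vbracket opprB.
rewrite E' (E Y S T Ys Ss Ts) (E S T Y Ss Ts Ys) (E T S Y Ts Ss Ys).
exact: jacobi_cancel.
Qed.

Lemma vbracket_linear n (a : R) (S T Y : vfield R n) p :
  smooth S -> smooth T -> smooth Y ->
  vbracket (a *: S + T : vfield R n) Y p = a *: vbracket S Y p + vbracket T Y p.
Proof.
move=> Ss Ts Ys; rewrite /vbracket /=.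
rewrite [(a *: S + T) p]/(a *: S p + T p) derive_linear; last exact: smooth_differentiable.
rewrite [X in _ - X](_ : _ = a *: 'D_(Y p) S p + 'D_(Y p) T p).
  by rewrite scalerBr opprD addrACA.
by rewrite -derive_addZ //; exact: smooth_differentiable.
Qed.

End VectorSmooth.

(** * Finite type *)

Section IteratedDerivative.
Variables (R : realType) (n : nat).
Local Notation V := 'cV[R]_n.

Fixpoint iterD (vs : seq V) (f : V -> V) : V -> V :=
  if vs is v :: vs' then iterD vs' (fun c => 'D_v f c) else f.

Lemma iterD_sum (I : Type) (r : seq I) (f : I -> V -> V) vs c :
  (forall i, smooth (f i)) ->
  iterD vs (fun c => \sum_(i <- r) f i c) c = \sum_(i <- r) iterD vs (f i) c.
Proof.
elim: vs f => //= v vs IH f fs.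
rewrite -IH => [|i]; last exact: smooth_derive.
congr iterD; apply/funext => p.
by rewrite (is_diff_derive v (is_diff_sum r (fun i => smooth_is_diff p (fs i)))).
Qed.

End IteratedDerivative.

Lemma subnS_count (x y m e : nat) : (y.+1 = m - x + e)%N -> (x < m)%N ->
  y = (m - x.+1 + e)%N.
Proof. lia. Qed.

Section FiniteType.
Variables (R : realType) (n : nat) (X K : 'M[R]_n) (w0 : 'cV[R]_n) (lam : 'rV[R]_n).
Variables (N D : nat) (P : nat -> 'M[R]_n).
Local Notation V := 'cV[R]_n.
Local Notation E s := (expmx (s *: X)).

Definition memW (s : R) (v : V) := K *m (E (- s) *m v) = 0.

(** [lam] is a functional on V / ker K with value 1 on the class of X w0. [rankX] states that the
    map ker K -> V / ker K induced by X has rank at least 2. *)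
Hypothesis lamK : forall w : V, K *m w = 0 -> lam *m w = 0.
Hypothesis Kw0 : K *m w0 = 0.
Hypothesis lamX : (lam *m (X *m w0)) 0 0 = 1.
Hypothesis rankX : forall w : V, K *m w = 0 -> exists2 w' : V, K *m w' = 0 &
  forall c : R, K *m (X *m w') <> c *: (K *m (X *m w)).
Hypothesis expP : forall s, E s = \sum_(i < N) s ^+ i *: P i.
Hypothesis spanW : forall S : seq R, uniq S -> (D <= size S)%N -> forall v : V,
  exists2 c : R -> V, (forall s, memW s (c s)) & v = \sum_(s <- S) c s.
Hypothesis capW : forall S : seq R, uniq S -> (D <= size S)%N -> forall v : V,
  (forall s, s \in S -> memW s v) -> v = 0.

(* [A] is tangent to the curve s |-> W_s = exp(sX)(ker K): modulo W_s, it acts on W_s as a multiple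
   of X. *)
Definition infsym (A : 'M[R]_n) := forall s, exists a : R, forall w : V, K *m w = 0 ->
  K *m (E (- s) *m (A *m (E s *m w)) - a *: (X *m w)) = 0.

(** If the differential of [u] acts as a multiple of X from W_s to V / W_s, then [lam] reads off the
    multiple at the vector exp(sX) w0. The explicit formula makes alpha linear in [u] and polynomial
    in [s]. *)
Definition alpha (u : V -> V) (c : V) (s : R) : R :=
  (lam *m (E (- s) *m 'D_(E s *m w0) u c)) 0 0.

Definition infsym_field (u : V -> V) := smooth u /\
  forall c s v, memW s v ->
    K *m (E (- s) *m 'D_v u c) = alpha u c s *: (K *m (X *m (E (- s) *m v))).

Lemma expmx_cancel s (w : V) : E (- s) *m (E s *m w) = w.
Proof. by rewrite mulmxA expmxNK mul1mx. Qed.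

Lemma memW_exp s (w : V) : K *m w = 0 -> memW s (E s *m w).
Proof. by move=> Kw; rewrite /memW expmx_cancel. Qed.

Implicit Types (u : V -> V) (c v : V) (s : R).

(** The condition depends on the point [c] only through [u], so it can be differentiated in [c];
    exchanging derivatives puts the result into the form required of the derivative of [u]. *)
Lemma infsym_field_derive u v : infsym_field u -> infsym_field (fun c => 'D_v u c).
Proof.
move=> [us ua]; split=> [|c s v' v'W]; first exact: smooth_derive.
rewrite (smooth_schwarz v v' c us).
have us' := smooth_derive v' us.
have us0 := smooth_derive (E s *m w0) us.
have h1 := is_diff_derive v (is_diff_mulmxr K (is_diff_mulmxr (E (- s)) (smooth_is_diff c us'))).
apply: (etrans (esym h1)) => {h1}.
have -> : (fun q => K *m (E (- s) *m 'D_v' u q)) =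
    (fun q => alpha u q s *: (K *m (X *m (E (- s) *m v')))).
  by apply/funext => q; exact: ua.
have h2 := is_diff_entry 0 0 (is_diff_mulmxr lam (is_diff_mulmxr (E (- s)) (smooth_is_diff c us0))).
rewrite (is_diff_derive v (is_diff_scale h2 (is_diff_const _ c))) scaler0 addr0.
by rewrite /alpha -(smooth_schwarz v (E s *m w0) c us).
Qed.

Lemma derive_alpha u c s v : smooth u ->
  'D_v (fun c => alpha u c s) c = alpha (fun c => 'D_v u c) c s.
Proof.
move=> us; have us0 := smooth_derive (E s *m w0) us.
have h2 := is_diff_entry 0 0 (is_diff_mulmxr lam (is_diff_mulmxr (E (- s)) (smooth_is_diff c us0))).
apply: (etrans (is_diff_derive v h2)).
by rewrite /alpha (smooth_schwarz v (E s *m w0) c us).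
Qed.

Lemma alpha_derive0 u s v : infsym_field u -> (forall c, alpha u c s = 0) ->
  forall c, alpha (fun c => 'D_v u c) c s = 0.
Proof.
move=> [us _] a0 c; apply: (etrans (esym (derive_alpha c s v us))).
have -> : (fun c => alpha u c s) = (fun=> 0) by apply/funext => q; exact: a0.
exact: is_diff_derive v (is_diff_const 0 c).
Qed.

Lemma scale_indep (a b : R) (x y : V) : a != 0 -> (forall c : R, y <> c *: x) ->
  a *: y = b *: x -> False.
Proof.
move=> a0 yx E1; apply: (yx (a^-1 * b)).
by rewrite -scalerA -E1 scalerA mulVf // scale1r.
Qed.

(* For v, v' in W_s the class of D_v D_v' u = D_v' D_v u in V / W_s is at once a multiple of the
   class of X v and of that of X v'; these are independent for a suitable v'. *)
Lemma alpha_derive_memW u s v : infsym_field u -> memW s v ->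
  forall c, alpha (fun c => 'D_v u c) c s = 0.
Proof.
move=> ui vW c; apply/eqP/negP => /negP a0.
have us : smooth u by case: ui.
have [w' Kw' w'X] := rankX vW.
pose v' := E s *m w'.
have v'W : memW s v' by exact: memW_exp.
have H1 := (infsym_field_derive v ui).2 c s v' v'W.
have H2 := (infsym_field_derive v' ui).2 c s v vW.
have H3 := congr1 (fun z => K *m (E (- s) *m z)) (smooth_schwarz v' v c us).
have H4 := etrans (esym H1) (etrans (esym H3) H2).
apply: (scale_indep a0 w'X); rewrite -{1}(expmx_cancel s w'); exact: H4.
Qed.

(** The exponential occurs in alpha twice, with parameters s and -s, each time as a sum of N
    monomials; hence the bound N + N. *)
Lemma alpha_poly u c : smooth u -> exists2 p : {poly R}, (size p <= N + N)%N &
  forall s, alpha u c s = p.[s].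
Proof.
move=> us.
pose a i j := (-1) ^+ i * (lam *m (P i *m 'D_(P j *m w0) u c)) 0 0.
exists (\sum_(i < N) \sum_(j < N) a i j *: 'X^(i + j)).
  apply: (leq_trans (size_sum _ _ _)); apply/bigmax_leqP => i _.
  apply: (leq_trans (size_sum _ _ _)); apply/bigmax_leqP => j _.
  apply: (leq_trans (size_scale_leq _ _)); rewrite size_polyXn.
  by have := ltn_ord i; have := ltn_ord j; lia.
move=> s; have Ew : E s *m w0 = \sum_(j < N) s ^+ j *: (P j *m w0).
  by rewrite expP mulmx_suml; apply: eq_bigr => j _; rewrite scalemxAl.
rewrite /alpha Ew expP derive_lincomb; last exact: smooth_differentiable.
rewrite mulmx_suml mulmx_sumr summxE horner_sum; apply: eq_bigr => i _.
rewrite mulmx_sumr mulmx_sumr summxE horner_sum; apply: eq_bigr => j _.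
rewrite hornerZ hornerXn /a -!scalemxAl -!scalemxAr !scalerA mxE exprD [(- s) ^+ _]exprNn.
by move: ((lam *m _) 0 0) => z; ring.
Qed.

Lemma alpha_zero u (S : seq R) : smooth u -> uniq S -> (N + N <= size S)%N ->
  (forall s c, s \in S -> alpha u c s = 0) -> forall c s, alpha u c s = 0.
Proof.
move=> us uS sS a0 c s; have [p ps pE] := alpha_poly c us.
rewrite pE; suff -> : p = 0 by rewrite horner0.
apply: (@roots_geq_poly_eq0 _ p S) => //; last exact: leq_trans sS.
by apply/allP => t tS; rewrite /root -pE a0.
Qed.

(* Each direction is decomposed along W_s for D values of s that were not used before, so that the
   set of used values grows by one element at each derivation. *)
Lemma iterD_kill (G : seq R -> (V -> V) -> Prop) (m e : nat) :
  (forall S u, G S u -> smooth u) ->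
  (forall S u s v, G S u -> memW s v -> G (s :: S) (fun c => 'D_v u c)) ->
  (forall S u vs, uniq S -> size S = m -> G S u -> size vs = e -> iterD vs u = fun=> 0) ->
  forall vs (b : nat) S u, uniq S ->
    (forall s, s \in S -> exists2 k, (k < b)%N & s = k%:R) ->
    (size S <= m)%N -> size vs = (m - size S + e)%N -> G S u ->
    iterD vs u = fun=> 0.
Proof.
move=> Gs Gstep Gdone; elim=> [|v vs IH] b S u uS Sb Sm vsE GS.
  by apply: (Gdone S) => //=; move: vsE Sm => /=; lia.
have [Seq|Sne] := eqVneq (size S) m.
  by apply: (Gdone S) => //; rewrite vsE Seq subnn.
have Slt : (size S < m)%N by rewrite ltn_neqAle Sne.
(* The elements of [S] are naturals below [b], so the D naturals from [b] on are fresh values of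
   s. *)
pose T := [seq (k%:R : R) | k <- iota b D].
have uT : uniq T.
  by rewrite map_inj_uniq ?iota_uniq // => x y /eqP; rewrite eqr_nat => /eqP.
have [|c cW vE] := spanW uT _ v; first by rewrite size_map size_iota.
have us := Gs _ _ GS.
have -> : iterD (v :: vs) u = iterD vs (fun q => \sum_(s <- T) 'D_(c s) u q).
  rewrite /=; congr (iterD vs _); apply/funext => q; rewrite vE.
  have -> : \sum_(s <- T) c s = \sum_(s <- T) (1 : R) *: c s.
    by apply: eq_bigr => s _; rewrite scale1r.
  rewrite derive_lincomb; last exact: smooth_differentiable.
  by apply: eq_bigr => s _; rewrite scale1r.
apply/funext => q; rewrite iterD_sum; last by move=> s; exact: smooth_derive.
rewrite big_seq big1 // => s sT.
have [k kb sk] : exists2 k, (b <= k < b + D)%N & s = k%:R.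
  by move: sT => /mapP[k]; rewrite mem_iota => kb ->; exists k.
have sS : s \notin S.
  apply/negP => /Sb[k' k'b]; rewrite sk => /eqP; rewrite eqr_nat => /eqP kk'.
  by move: kb; rewrite kk' leqNgt k'b.
rewrite (IH (b + D)%N (s :: S)) //=.
- by rewrite sS.
- move=> t; rewrite inE => /orP[/eqP ->|/Sb[k' k'b ->]]; first by exists k; [case/andP: kb|].
  by exists k' => //; rewrite ltn_addr.
- exact: (subnS_count vsE Slt).
- exact: Gstep.
Qed.

(** With alpha = 0 a derivative along W_s takes values in W_s, and later derivatives stay in each
    W_s already met. After D distinct values of s, [capW] leaves only 0. *)
Lemma iterD_alpha0 u vs : infsym_field u -> (forall c s, alpha u c s = 0) ->
  size vs = D -> iterD vs u = fun=> 0.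
Proof.
move=> ui ua vsE.
pose G (S : seq R) u := [/\ infsym_field u, (forall c s, alpha u c s = 0) &
    forall s c, s \in S -> memW s (u c)].
have H1 S f : G S f -> smooth f by case=> -[].
have H2 S f s v : G S f -> memW s v -> G (s :: S) (fun c => 'D_v f c).
  move=> [fi fa fW] vW; split; first exact: infsym_field_derive.
    by move=> c t; apply: alpha_derive0.
  move=> t c; rewrite inE => /orP[/eqP ->|tS].
    apply: (etrans (fi.2 c s v vW)); rewrite fa; exact: scale0r.
  have h := is_diff_mulmxr K (is_diff_mulmxr (E (- t)) (smooth_is_diff c fi.1)).
  apply: (etrans (esym (is_diff_derive v h))).
  have -> : (fun q => K *m (E (- t) *m f q)) = (fun=> 0).
    by apply/funext => q; exact: fW.
  exact: is_diff_derive v (is_diff_const 0 c).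
have H3 S f ws : uniq S -> size S = D -> G S f -> size ws = 0%N -> iterD ws f = fun=> 0.
  move=> uS sS [_ _ fW] /size0nil ->.
  apply/funext => c /=; apply: (capW uS); first by rewrite sS.
  by move=> s sin; exact: fW.
have vsE' : size vs = (D - size ([::] : seq R) + 0)%N by rewrite subn0 addn0.
apply: (iterD_kill H1 H2 H3 (b := 0%N) _ _ _ vsE') => //.
Qed.

(** Each of the first N + N derivatives makes alpha vanish at one new value of s, so that
    [alpha_zero] applies; the remaining D derivatives are those of [iterD_alpha0]. *)
Lemma iterD_infsym0 u vs : infsym_field u -> size vs = (N + N + D)%N ->
  iterD vs u = fun=> 0.
Proof.
move=> ui vsE.
pose G (S : seq R) u := infsym_field u /\ forall s c, s \in S -> alpha u c s = 0.
have H1 S f : G S f -> smooth f by case=> -[].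
have H2 S f s v : G S f -> memW s v -> G (s :: S) (fun c => 'D_v f c).
  move=> [fi fa] vW; split; first exact: infsym_field_derive.
  move=> t c; rewrite inE => /orP[/eqP ->|tS]; first exact: alpha_derive_memW.
  by apply: alpha_derive0 => // c'; exact: fa.
have H3 S f ws : uniq S -> size S = (N + N)%N -> G S f -> size ws = D ->
    iterD ws f = fun=> 0.
  move=> uS sS [fi fa]; apply: iterD_alpha0 => //.
  exact: alpha_zero fi.1 uS (eq_leq (esym sS)) fa.
have vsE' : size vs = (N + N - size ([::] : seq R) + D)%N by rewrite subn0.
apply: (iterD_kill H1 H2 H3 (b := 0%N) _ _ _ vsE') => //.
Qed.

End FiniteType.

(** * Polynomial vector fields and prolongation *)

Section PolynomialFunctions.
Variables (R : realType) (n : nat).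
Local Notation V := 'cV[R]_n.
Local Notation mpol := (mpoly n R).
Implicit Types (P Q : mpol) (c v : V) (m : multinom n).

Definition mev P (c : V) : R := meval (fun j => c j 0) P.

Lemma mevE P Q c : (mev (P + Q) c = mev P c + mev Q c) * (mev (P * Q) c = mev P c * mev Q c).
Proof. by rewrite /mev mevalD mevalM. Qed.

Definition has_mderiv P := forall c,
  is_diff c (mev P) (fun v => \sum_j v j 0 * mev (mderiv j P) c).

Lemma has_mderiv_const (a : R) : has_mderiv (mpolyC n a).
Proof.
move=> c; have -> : mev (mpolyC n a) = fun=> a by apply/funext => q; exact: mevalC.
apply: (is_diff_eq (is_diff_const a c)); apply/funext => v.
by rewrite big1 // => j _; rewrite mderivC /mev meval0 mulr0.
Qed.

Lemma has_mderiv_var i : has_mderiv (mpolyX R (mnm1 i)).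
Proof.
move=> c; have -> : mev (mpolyX R (mnm1 i)) = fun c => c i 0.
  by apply/funext => q; exact: mevalXU.
apply: (is_diff_eq (is_diff_entry i 0 (is_diff_ident c))); apply/funext => v.
rewrite (bigD1 i) //= mderivX mnm1E eqxx scale1r.
have -> : mnm_sub (mnm1 i) (mnm1 i) = mnm0 by apply/mnmP => j; rewrite !mnmE subnn.
rewrite mpolyX0 /mev meval1 mulr1 big1 ?addr0 // => j ji.
by rewrite mderivX mnm1E eq_sym (negbTE ji) scale0r meval0 mulr0.
Qed.

Lemma has_mderiv_add P Q : has_mderiv P -> has_mderiv Q -> has_mderiv (P + Q).
Proof.
move=> hP hQ c.
have -> : mev (P + Q) = fun c => mev P c + mev Q c by apply/funext => q; rewrite mevE.
apply: (is_diff_eq (is_diff_add (hP c) (hQ c))); apply/funext => v.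
by rewrite -big_split; apply: eq_bigr => j _; rewrite mderivD mevE mulrDr.
Qed.

Lemma has_mderiv_mul P Q : has_mderiv P -> has_mderiv Q -> has_mderiv (P * Q).
Proof.
move=> hP hQ c.
have -> : mev (P * Q) = fun c => mev P c * mev Q c by apply/funext => q; rewrite mevE.
apply: (is_diff_eq (is_diff_mul (hP c) (hQ c))); apply/funext => v.
rewrite mulr_suml mulr_sumr -big_split; apply: eq_bigr => j _.
by rewrite mderivM !mevE mulrDr !mulrA [mev P c * _]mulrC.
Qed.

Lemma mev_is_diff P : has_mderiv P.
Proof.
have h1 : has_mderiv 1 by rewrite -[1]/(mpolyC n 1); exact: has_mderiv_const.
elim/mpolyind: P => [|a m P _ _ IH].
  by rewrite -(mpolyC0 n R); exact: has_mderiv_const.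
apply: has_mderiv_add IH; rewrite -mul_mpolyC.
apply: has_mderiv_mul; first exact: has_mderiv_const.
rewrite mpolyXE_id; elim/big_ind: _ => [//|P1 P2|i _]; first exact: has_mderiv_mul.
elim: (m i) => [|k IHk]; first by rewrite expr0.
by rewrite exprS; apply: has_mderiv_mul IHk; exact: has_mderiv_var.
Qed.

Lemma derive_mev P v c : 'D_v (mev P) c = mev (\sum_j v j 0 *: mderiv j P) c.
Proof.
rewrite (is_diff_derive v (mev_is_diff P c)) /mev raddf_sum.
by apply: eq_bigr => j _; rewrite /= mevalZ.
Qed.

Lemma derive_mevE P j c : 'D_(delta_mx j 0) (mev P) c = mev (mderiv j P) c.
Proof.
rewrite derive_mev (bigD1 j) //= mxE !eqxx scale1r big1 ?addr0 // => i ij.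
by rewrite mxE (negbTE ij) scale0r.
Qed.

Lemma ssmooth_mev P : ssmooth (mev P).
Proof.
apply: (ssmooth_coind (F := [set f | exists P, f = mev P])); last by exists P.
move=> f [Q ->]; split=> [p|v]; first by have [] := mev_is_diff Q p.
exists (\sum_j v j 0 *: mderiv j Q); apply/funext => p; exact: derive_mev.
Qed.

Lemma mev_at0 P : mev P 0 = mcoeff mnm0 P.
Proof.
elim/mpolyind: P => [|a m P _ _ IH]; first by rewrite /mev meval0 mcoeff0.
rewrite mevE IH mcoeffD; congr (_ + _).
rewrite /mev mevalZ mcoeffZ mcoeffX mevalX; congr (_ * _).
have [->|] := eqVneq m mnm0.
  by rewrite big1 // => i _; rewrite mnm0E expr0.
move=> m0; have [i mi] : exists i, m i != 0%N.
  apply/existsP; apply: contraNT m0; rewrite negb_exists => /forallP m0.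
  by apply/eqP/mnmP => i; rewrite mnm0E; apply/eqP; move: (m0 i); rewrite negbK.
by rewrite (bigD1 i) //= mxE expr0n (negbTE mi) mul0r.
Qed.

Lemma mnm_split m : m != mnm0 -> exists m' i, m = mnm_add m' (mnm1 i).
Proof.
move=> m0; have [i mi] : exists i, m i != 0%N.
  apply/existsP; apply: contraNT m0; rewrite negb_exists => /forallP m0.
  by apply/eqP/mnmP => i; rewrite mnm0E; apply/eqP; move: (m0 i); rewrite negbK.
exists (mnm_sub m (mnm1 i)), i; apply/mnmP => j; rewrite !mnmE.
by case: eqP => [<-|_]; [rewrite subnK // lt0n|rewrite subn0 addn0].
Qed.

Lemma mcoeff_of_mderiv P m i : mcoeff m (mderiv i P) = 0 -> mcoeff (mnm_add m (mnm1 i)) P = 0.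
Proof. by rewrite mcoeff_mderiv => /eqP; rewrite mulrn_eq0 /= => /eqP. Qed.

(** The partial derivatives of the zero function vanish, and every coefficient is, up to a nonzero
    integer factor, an iterated derivative at the origin. *)
Lemma mev_inj0 P : (forall c, mev P c = 0) -> P = 0.
Proof.
move=> P0; apply/mpolyP => m; rewrite mcoeff0.
have [d] := ubnP (mdeg m); elim: d m P P0 => // d IH m P P0 md.
have [->|/mnm_split[m' [i E]]] := eqVneq m mnm0; first by rewrite -mev_at0.
rewrite E; apply: mcoeff_of_mderiv; apply: IH; last first.
  by move: md; rewrite E mdegD mdeg1 addn1.
move=> c; rewrite -derive_mevE (_ : mev P = fun=> 0); last by apply/funext.
exact: is_diff_derive _ (is_diff_const 0 c).
Qed.

Lemma mev_inj P Q : (forall c, mev P c = mev Q c) -> P = Q.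
Proof.
move=> PQ; apply/eqP; rewrite -subr_eq0; apply/eqP/mev_inj0 => c.
by rewrite /mev mevalB -/(mev P c) PQ subrr.
Qed.

Local Notation vpol := (pvfield R n).
Implicit Types u w : vpol.

Lemma pevalE u c i : peval u c i 0 = mev (u i) c.
Proof. by rewrite mxE. Qed.

Lemma peval_inj u w : (forall c, peval u c = peval w c) -> u = w.
Proof.
by move=> uw; apply/ffunP => i; apply: mev_inj => c; rewrite -!pevalE uw.
Qed.

Lemma smooth_peval u : smooth (peval u).
Proof.
apply/smoothP => i; under eq_fun do rewrite pevalE; exact: ssmooth_mev.
Qed.

Definition dirD v u : vpol := [ffun i => \sum_j v j 0 *: mderiv j (u i)].

Lemma derive_peval u v c : 'D_v (peval u) c = peval (dirD v u) c.
Proof.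
apply/colP => i; rewrite -derive_entry; last exact/smooth_differentiable/smooth_peval.
under eq_fun do rewrite pevalE.
by rewrite derive_mev pevalE ffunE.
Qed.

Lemma peval_addZ a u w c : peval (a *: u + w) c = a *: peval u c + peval w c.
Proof. by apply/colP => i; rewrite !mxE !ffunE mevalD mevalZ. Qed.

Lemma peval_pbracket u w c :
  peval (pbracket u w) c = 'D_(peval u c) (peval w) c - 'D_(peval w c) (peval u) c.
Proof.
apply/colP => i; rewrite !derive_peval !mxE !ffunE /mev.
rewrite [LHS]raddf_sum [X in _ = X - _]raddf_sum [X in _ - X]raddf_sum -sumrB.
apply: eq_bigr => j _ /=.
by rewrite mevalB !mevalM !mevalZ !mxE.
Qed.

Lemma iterD_peval_coeff (M : nat) u :
  (forall vs, size vs = M -> iterD vs (peval u) = fun=> 0) ->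
  forall i m, (M <= mdeg m)%N -> mcoeff m (u i) = 0.
Proof.
elim: M u => [|M IH] u uM i m Mm.
  have -> : u i = 0; last by rewrite mcoeff0.
  by apply: mev_inj0 => c; rewrite -pevalE -[peval u]/(iterD [::] (peval u)) uM // mxE.
have /mnm_split[m' [j E]] : m != mnm0 by rewrite -mdeg_eq0 -lt0n (leq_trans _ Mm).
rewrite E; apply: mcoeff_of_mderiv.
have -> : mderiv j (u i) = dirD (delta_mx j 0) u i.
  rewrite ffunE (bigD1 j) //= mxE !eqxx scale1r big1 ?addr0 // => k kj.
  by rewrite mxE (negbTE kj) scale0r.
apply: IH; last by move: Mm; rewrite E mdegD mdeg1 addn1.
move=> vs vsM; rewrite -(uM (delta_mx j 0 :: vs)) /= ?vsM //.
by congr (iterD vs _); apply/funext => c; rewrite derive_peval.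
Qed.

(* Integrates along the rays through the origin: [c j * \int_0^1 P (t c) dt]. *)
Definition ray_integral j P : mpol :=
  \sum_(m <- msupp P) (mcoeff m P / (mdeg m).+1%:R) *: mpolyX R (mnm_add m (mnm1 j)).

Lemma mev_ray (t : R) c m : mev (mpolyX R m) (t *: c) = t ^+ mdeg m * mev (mpolyX R m) c.
Proof.
rewrite /mev !mevalX mdegE -prodrXr -big_split; apply: eq_bigr => i _.
by rewrite mxE exprMn.
Qed.

Lemma mpoly_sum_msupp P c : mev P c = \sum_(m <- msupp P) mcoeff m P * mev (mpolyX R m) c.
Proof.
rewrite {1}[P]mpolyE /mev raddf_sum; apply: eq_bigr => m _; exact: mevalZ.
Qed.

Lemma ray_integral_derive j P c (t : R) :
  is_diff t (fun s : R => mev (ray_integral j P) (s *: c))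
    (fun h : R => h * (c j 0 * mev P (t *: c))).
Proof.
have -> : (fun s : R => mev (ray_integral j P) (s *: c)) = (fun s : R =>
    \sum_(m <- msupp P) (mcoeff m P / (mdeg m).+1%:R * (mev (mpolyX R m) c * c j 0)) *
      s ^+ (mdeg m).+1).
  apply/funext => s; rewrite /ray_integral /mev raddf_sum; apply: eq_bigr => m _.
  rewrite /= mevalZ -/(mev _ _) mev_ray mdegD mdeg1 addn1 mpolyXD mevE.
  by rewrite [mev (mpolyX R (mnm1 j)) c]mevalXU -mulrA [X in _ * X]mulrC mulrA.
have hm (a : R) k : is_diff t (fun s : R => a * s ^+ k.+1) (fun h : R => h * (a * (k.+1%:R * t ^+ k))).
  have h1 : is_diff t (fun s : R => a) (fun h : R => 0) by exact: is_diff_const.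
  apply: (is_diff_eq (is_diff_mul h1 (is_diff_exprS t k))); apply/funext => x.
  by rewrite mul0r add0r; ring.
apply: (is_diff_eq (is_diff_sum _ (fun m => hm _ _))); apply/funext => h.
rewrite mpoly_sum_msupp !mulr_sumr; apply: eq_bigr => m _.
rewrite mev_ray.
by field; rewrite nat1r pnatr_eq0.
Qed.

End PolynomialFunctions.

(** * The prolongation as the solutions of a linear system with constant coefficients *)

Section Prolongation.
Variables (R : realType) (n : nat).
Local Notation V := 'cV[R]_n.
Local Notation mpol := (mpoly n R).
Local Notation vpol := (pvfield R n).
Implicit Types (P Q : mpol) (c v : V) (m : multinom n) (u w : vpol).

(** By induction the partial derivatives are polynomials [w j]. Along every ray from the origin, [f]
    and the sum of f(0) with the ray integrals of the [w j] have the same derivative, and they agree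
    at the origin. *)
Lemma iterD_smooth_poly (M : nat) (f : V -> V) : smooth f ->
  (forall vs, size vs = M -> iterD vs f = fun=> 0) -> exists u, f = peval u.
Proof.
elim: M f => [|M IH] f fs fM.
  exists 0; rewrite (fM [::] erefl : f = fun=> 0); apply/funext => c.
  by apply/colP => i; rewrite !mxE ffunE meval0.
have /choice[w wE] (j : 'I_n) : exists u : vpol, (fun c => 'D_(delta_mx j 0) f c) = peval u.
  apply: IH; first exact: smooth_derive.
  by move=> vs vsM; apply: (fM (delta_mx j 0 :: vs)); rewrite /= vsM.
pose Q : vpol := [ffun i => \sum_j ray_integral j (w j i)].
pose f0 : vpol := [ffun i => mpolyC n (f 0 i 0)].
exists (f0 + Q); apply/funext => c; apply/colP => i.
have Qt (t : R) : is_diff t (fun s : R => mev (Q i) (s *: c))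
    (fun h : R => h * \sum_j c j 0 * mev (w j i) (t *: c)).
  have -> : (fun s : R => mev (Q i) (s *: c)) =
      fun s : R => \sum_j mev (ray_integral j (w j i)) (s *: c).
    by apply/funext => s; rewrite ffunE [LHS]raddf_sum.
  apply: (is_diff_eq (is_diff_sum _ (fun j => ray_integral_derive j (w j i) c t))).
  by apply/funext => h; rewrite mulr_sumr.
have fis : ssmooth (fun p => f p i 0) by move/smoothP: fs; apply.
have ft (t : R) : is_derive t (1 : R) (fun s : R => f (0 + s *: c) i 0)
    (\sum_j c j 0 * mev (w j i) (t *: c)).
  have := ssmooth_line 0 c t fis.
  rewrite derive_entry; last exact: smooth_differentiable.
  rewrite derive_basis; last exact: smooth_differentiable.
  rewrite summxE add0r => h; apply: (is_derive_eq h); apply: eq_bigr => j _.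
  by rewrite mxE -pevalE -wE.
have g0 (t : R) : is_derive t (1 : R)
    ((fun s : R => f (0 + s *: c) i 0) - (fun s : R => mev (Q i) (s *: c))) 0.
  have := is_deriveB (ft t) (is_diff_realD (Qt t)).
  by rewrite mul1r subrr.
have /eqP := is_derive_0_is_cst 1 0 g0.
rewrite !fctE /= !scale1r !scale0r !add0r subr_eq addrAC.
(* Every monomial of a ray integral has positive degree. *)
have -> : mev (Q i) 0 = 0.
  rewrite mev_at0 ffunE raddf_sum big1 // => j _ /=.
  rewrite /ray_integral raddf_sum big1_seq // => m _ /=.
  rewrite mcoeffZ mcoeffX.
  by rewrite -mdeg_eq0 mdegD mdeg1 addn1 mulr0.
rewrite subr0 => /eqP ->.
rewrite pevalE [(f0 + Q) i]ffunE mevE; congr (_ + _).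
by rewrite /mev ffunE mevalC.
Qed.

Variable a : set 'M[R]_n.
Variable Lam : set 'M[R]_n.
Hypothesis aP : a = [set A | forall L, Lam L -> \sum_i \sum_j L i j * A i j = 0].

(** The linear form [L] applied to the Jacobian matrix of [u]. When the forms in [Lam] cut out [a],
    their vanishing is a first-order system with constant coefficients, which says that all
    differentials of [u] lie in [a]. *)
Definition Jlin (L : 'M[R]_n) u : mpol := \sum_i \sum_j L i j *: mderiv j (u i).

Definition prolongs u := forall L, Lam L -> Jlin L u = 0.

Definition jac u c : 'M[R]_n := \matrix_(i, j) mev (mderiv j (u i)) c.

Lemma derive_peval_jac u v c : 'D_v (peval u) c = jac u c *m v.
Proof.
rewrite derive_peval; apply/colP => i; rewrite pevalE ffunE mxE [LHS]raddf_sum.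
by apply: eq_bigr => j _; rewrite /= mevalZ mxE mulrC.
Qed.

Lemma mev_Jlin L u c : mev (Jlin L u) c = \sum_i \sum_j L i j * jac u c i j.
Proof.
rewrite [LHS]raddf_sum; apply: eq_bigr => i _; rewrite [LHS]raddf_sum.
by apply: eq_bigr => j _; rewrite /= mevalZ mxE.
Qed.

Lemma prolongsP u : prolongs u <-> forall c, a (jac u c).
Proof.
rewrite aP; split=> [pu c L LL|au L LL]; last first.
  by apply: mev_inj0 => c; rewrite mev_Jlin; exact: au.
by rewrite -mev_Jlin pu // /mev meval0.
Qed.

Lemma mcoeff_Jlin L u m :
  mcoeff m (Jlin L u) = \sum_i \sum_j L i j * mcoeff (mnm_add m (mnm1 j)) (u i) *+ (m j).+1.
Proof.
rewrite raddf_sum; apply: eq_bigr => i _; rewrite raddf_sum; apply: eq_bigr => j _.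
by rewrite /= mcoeffZ mcoeff_mderiv mulrnAr.
Qed.

Lemma mderiv_Jlin L u k :
  mderiv k (Jlin L u) = Jlin L ([ffun i => mderiv k (u i)] : vpol).
Proof.
rewrite raddf_sum; apply: eq_bigr => i _; rewrite raddf_sum; apply: eq_bigr => j _.
by rewrite /= mderivZ mderiv_comm ffunE.
Qed.

Lemma phomogP d u : phomog d u <-> forall i m, mdeg m != d -> mcoeff m (u i) = 0.
Proof.
split=> [hu i m md|hu i]; first exact: dhomog_nemf_coeff (hu i) md.
apply/dhomogP => m mu; apply/eqP/negP => /negP md.
by move: mu; rewrite mcoeff_msupp (hu i m md) eqxx.
Qed.

Lemma pbracket_const u (v : vpol) : phomog 0 v ->
  pbracket u v = - \sum_k mcoeff mnm0 (v k) *: ([ffun i => mderiv k (u i)] : vpol).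
Proof.
move=> /phomogP hv.
have vE k : v k = mpolyC n (mcoeff mnm0 (v k)).
  apply/mpolyP => m; rewrite mcoeffC.
  have [->|m0] := eqVneq m mnm0; first by rewrite mulr1.
  by rewrite mulr0; apply: hv; rewrite mdeg_eq0.
apply/ffunP => i; rewrite !ffunE sum_ffunE -sumrN; apply: eq_bigr => k _.
rewrite !ffunE [v i]vE mderivC mulr0 sub0r {1}[v k]vE mul_mpolyC //.
Qed.

Lemma JlinN L u : Jlin L (- u) = - Jlin L u.
Proof.
rewrite /Jlin -sumrN; apply: eq_bigr => i _; rewrite -sumrN; apply: eq_bigr => j _.
by rewrite ffunE mderivN scalerN.
Qed.

Lemma Jlin_addZ L b u w : Jlin L (b *: u + w) = b *: Jlin L u + Jlin L w.
Proof.
rewrite /Jlin scaler_sumr -big_split; apply: eq_bigr => i _.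
rewrite scaler_sumr -big_split; apply: eq_bigr => j _ /=.
by rewrite !ffunE mderivD mderivZ scalerDr !scalerA [b * _]mulrC.
Qed.

Lemma Jlin0 L : Jlin L 0 = 0.
Proof.
by rewrite /Jlin big1 // => i _; rewrite big1 // => j _; rewrite ffunE mderiv0 scaler0.
Qed.

Lemma Jlin_sum L I (r : seq I) (b : I -> R) (f : I -> vpol) :
  Jlin L (\sum_(k <- r) b k *: f k) = \sum_(k <- r) b k *: Jlin L (f k).
Proof.
elim: r => [|k r IH]; first by rewrite !big_nil Jlin0.
by rewrite !big_cons Jlin_addZ IH.
Qed.

Lemma lin_pvfield_jac (A : 'M[R]_n) c : jac (lin_pvfield A) c = A.
Proof.
apply/matrixP => i j; rewrite mxE ffunE raddf_sum (bigD1 j) //= big1 => [|k kj].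
  rewrite addr0 mderivZ mderivX mnm1E eqxx scale1r.
  have -> : mnm_sub (mnm1 j) (mnm1 j) = mnm0 by apply/mnmP => k; rewrite !mnmE subnn.
  by rewrite mpolyX0 /mev mevalZ meval1 mulr1.
by rewrite mderivZ mderivX mnm1E (negbTE kj) scale0r scaler0.
Qed.

Lemma phomog_lin (A : 'M[R]_n) : phomog 1 (lin_pvfield A).
Proof.
move=> i; rewrite ffunE; apply: rpred_sum => j _; apply: rpredZ.
by rewrite dhomogX; apply/eqP; exact: mdeg1.
Qed.

Lemma phomog1_lin u : phomog 1 u -> u = lin_pvfield (jac u 0).
Proof.
move=> /phomogP hu; apply/ffunP => i; apply/mpolyP => m.
rewrite ffunE raddf_sum /=.
have [/eqP/mdeg1P[j /eqP ->]|m1] := eqVneq (mdeg m) 1%N; last first.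
  rewrite hu // big1 // => j _; rewrite mcoeffZ mcoeffX.
  by case: eqP => [E|]; [rewrite -E mdeg1 in m1|rewrite mulr0].
rewrite (bigD1 j) //= mcoeffZ mcoeffX eqxx mulr1 big1 ?addr0 => [|k kj].
  by rewrite mxE mev_at0 mcoeff_mderiv mnm0E mulr1n; congr mcoeff; apply/mnmP => k; rewrite mnmDE mnm0E.
by rewrite mcoeffZ mcoeffX eq_mnm1 (negbTE kj) mulr0.
Qed.

(** Brackets with constant fields are combinations of partial derivatives. From degree 2 on,
    [Jlin L u] has no constant term, so it vanishes as soon as its partial derivatives do, and these
    are the [Jlin L] of the partial derivatives of [u]. Constant fields have zero Jacobian; in
    degree 1 the Jacobian is the matrix itself. *)
Lemma prolongP d u : prolong a d u <-> phomog d u /\ prolongs u.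
Proof.
case: d u => [|d] u /=.
  split=> [hu|[]//]; split=> // L _.
  apply/mpolyP => m; rewrite mcoeff0 mcoeff_Jlin big1 // => i _; rewrite big1 // => j _.
  move/phomogP: hu => ->; first by rewrite mulr0 mul0rn.
  by rewrite mdegD mdeg1 addn1.
elim: d u => [|d IH] u.
  split=> [[A aA <-]|[hu pu]].
    split; first exact: phomog_lin.
    by apply/prolongsP => c; rewrite lin_pvfield_jac.
  by exists (jac u 0); [move/prolongsP: pu; apply|rewrite -phomog1_lin].
rewrite -/(prolong a d.+1) in IH *.
split=> -[hu pu]; split=> //.
  move=> L LL; apply/mpolyP => m; rewrite mcoeff0.
  (* The constant coefficient of [Jlin L u] only sees the linear part of [u], which is zero because
     the degree is d + 2. *)
  have [m0|/mnm_split[m' [k E]]] := eqVneq m mnm0.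
    rewrite mcoeff_Jlin big1 // => i _; rewrite big1 // => j _.
    move/phomogP: hu => ->; first by rewrite mulr0 mul0rn.
    by rewrite m0 mdegD mdeg0 mdeg1.
  rewrite E; apply: mcoeff_of_mderiv; rewrite mderiv_Jlin.
  (* The sign compensates the one in [pbracket_const], so that the bracket is the k-th derivative of
     [u]. *)
  pose v : vpol := [ffun i => mpolyC n (- (i == k)%:R)].
  have hv : phomog 0 v.
    apply/phomogP => i m0 m00; rewrite ffunE mcoeffC -mdeg_eq0 (negbTE m00).
    by rewrite mulr0.
  have /IH[_ /(_ L LL)] := pu v hv.
  rewrite pbracket_const // JlinN Jlin_sum (bigD1 k) //= big1 => [|j jk].
    rewrite addr0 ffunE mcoeffC eqxx eqxx mulr1 scaleN1r opprK => ->.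
    by rewrite mcoeff0.
  by rewrite ffunE mcoeffC (negbTE jk) oppr0 mul0r scale0r.
move=> v hv; apply/IH; rewrite pbracket_const //; split.
  apply/phomogP => i m md; rewrite ffunE sum_ffunE raddfN raddf_sum big1 ?oppr0 // => k _ /=.
  rewrite !ffunE mcoeffZ mcoeff_mderiv.
  move/phomogP: hu => ->; first by rewrite mul0rn mulr0.
  by rewrite mdegD mdeg1 addn1.
move=> L LL; rewrite JlinN Jlin_sum big1 ?oppr0 // => k _.
by rewrite -mderiv_Jlin pu // mderiv0 scaler0.
Qed.

Lemma mcoeff_pihomog d P m : mcoeff m (pihomog mdeg d P) = if mdeg m == d then mcoeff m P else 0.
Proof.
rewrite [in RHS](mpolyE P) pihomogE !raddf_sum /=.
case: ifP => md.
  rewrite big_mkcond; apply: eq_bigr => m' _ /=.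
  case: ifP => // m'd; rewrite mcoeffZ mcoeffX; case: eqP => [E|]; last by rewrite mulr0.
  by rewrite E md in m'd.
rewrite big1 // => m' /eqP m'd; rewrite mcoeffZ mcoeffX; case: eqP => [E|]; last by rewrite mulr0.
by rewrite -E m'd eqxx in md.
Qed.

Lemma prolongs_sum I (r : seq I) (f : I -> vpol) :
  (forall i, prolongs (f i)) -> prolongs (\sum_(i <- r) f i).
Proof.
move=> pf L LL; under eq_bigr do rewrite -[f _]scale1r.
by rewrite Jlin_sum big1 // => i _; rewrite pf // scaler0.
Qed.

(** [Jlin L] lowers degrees by one, so the homogeneous components of a solution are again
    solutions. *)
Lemma sternbergP u : sternberg_prolongation a u <-> prolongs u.
Proof.
split=> [[N [w [wP ->]]]|pu].
  by apply: prolongs_sum => d; have /prolongP[] := wP d.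
pose w d : vpol := [ffun i => pihomog mdeg d (u i)].
pose N := \max_i msize (u i).
exists N, w; split=> [d|].
  apply/prolongP; split=> [i|L LL]; first by rewrite ffunE; exact: pihomogP.
  apply/mpolyP => m; rewrite mcoeff0 mcoeff_Jlin.
  have := congr1 (mcoeff m) (pu L LL); rewrite mcoeff0 mcoeff_Jlin => E.
  have [md|md] := eqVneq (mdeg m).+1 d.
    rewrite -[RHS]E; apply: eq_bigr => i _; apply: eq_bigr => j _.
    by rewrite ffunE mcoeff_pihomog mdegD mdeg1 addn1 md eqxx.
  rewrite big1 // => i _; rewrite big1 // => j _.
  by rewrite ffunE mcoeff_pihomog mdegD mdeg1 addn1 (negbTE md) mulr0 mul0rn.
apply/ffunP => i; rewrite sum_ffunE.
rewrite {1}(pihomog_partitionE (k := N) (mf := mdeg) (p := u i)).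
  by apply: eq_bigr => d _; rewrite ffunE.
exact: (leq_bigmax i).
Qed.

End Prolongation.

(** * A criterion for finite dimension *)

Section FiniteDimension.
Variables (R : realType) (W : lmodType R) (g : set W).

(** Among the finite families in [g] one is chosen whose image spans a subspace of maximal
    dimension. Adding any [u] of [g] does not enlarge this span, so [f u] is a combination of the
    images, and injectivity on [g] lifts the relation to [u]. *)
Lemma finite_dimensional_inj N (f : {linear W -> 'rV[R]_N}) :
  g 0 -> (forall (a : R) u v, g u -> g v -> g (a *: u + v)) ->
  (forall u, g u -> f u = 0 -> u = 0) -> finite_dimensional g.
Proof.
move=> g0 gl finj.
have gsum I (r : seq I) (c : I -> R) (h : I -> W) : (forall i, g (h i)) ->
    g (\sum_(i <- r) c i *: h i).
  by move=> gh; elim: r => [|i r IH]; rewrite ?big_nil ?big_cons //; exact: gl.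
pose Q (r : nat) := exists b : seq W, (forall w, w \in b -> g w) /\
  r = \dim <<map f b>>%VS.
have Q0 : Q 0%N by exists [::]; split=> //; rewrite span_nil dimv0.
have QN r : Q r -> (r <= \dim {:'rV[R]_N})%N by move=> [b [_ ->]]; exact: dimvS (subvf _).
pose r := [arg max_(i > (ord0 : 'I_(\dim {:'rV[R]_N}).+1) | `[< Q i >]) (i : nat)].
have [[b [gb rb]] rmax] : Q r /\ forall r', Q r' -> (r' <= r)%N.
  rewrite /r; case: arg_maxnP => [|i /asboolP Qi imax]; first exact/asboolP.
  split=> // r' Qr'; have := QN _ Qr'; rewrite -ltnS => r'N.
  exact: (imax (Ordinal r'N) (introT (asboolP _) Qr')).
exists (size b), (fun i => tnth (in_tuple b) i).
have gt i : g (tnth (in_tuple b) i) by apply: gb; exact: mem_tnth.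
apply/seteqP; split=> [u gu|_ [c ->]] /=; last exact: gsum.
have fub : f u \in <<map f b>>%VS.
  have sub : (<<map f b>> <= <<map f (u :: b)>>)%VS by rewrite /= span_cons addvSr.
  have /eqP -> : (<<map f b>> == <<map f (u :: b)>>)%VS.
    rewrite eqEdim sub -rb; apply: rmax; exists (u :: b); split=> // w.
    by rewrite inE => /orP[/eqP -> //|/gb].
  by rewrite /= span_cons; apply: (subvP (addvSl _ _)); exact: memv_line.
have E := coord_span (X := map_tuple f (in_tuple b)) fub.
exists (fun i => coord (map_tuple f (in_tuple b)) i (f u)).
apply/eqP; rewrite -subr_eq0; apply/eqP; apply: finj.
  by rewrite -[_ - _]addrC -scaleN1r; apply: gl => //; exact: gsum.
rewrite linearB linear_sum /= {1}E; apply/eqP; rewrite subr_eq0; apply/eqP.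
apply: eq_bigr => i _; rewrite linearZ /=; congr (_ *: _).
by rewrite (nth_map 0) //= (tnth_nth 0).
Qed.

End FiniteDimension.

(** * Symmetries of the equation and their push-forward *)

Section ExtendedSpace.
Variables (R : realType) (k l : nat).
Local Notation n := (k + l)%N.
Local Notation V := 'cV[R]_n.
Local Notation EE := 'cV[R]_(1 + n).
Local Notation X := (Xmx R k l).
Local Notation E s := (expmx (s *: X)).
Implicit Types (p h : EE) (c v w : V).

Definition xc p : R := p (ix k l) 0.

Lemma calXE p : calX R k l p = col_mx 1%:M (X *m dsubmx p).
Proof.
have dE (q m : nat) (N : nat) (P : rel nat) (f : 'I_m -> R) (g : 'I_q -> 'I_N) r :
    (\sum_(i < q) \sum_(j < m | P i j) f j *: delta_mx (g i) 0 : 'cV[R]_N) r 0 =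
    \sum_(i < q | r == g i) \sum_(j < m | P i j) f j.
  rewrite summxE [RHS]big_mkcond; apply: eq_bigr => i _; rewrite summxE.
  case: eqP => [->|ne]; first by apply: eq_bigr => j _; rewrite !mxE !eqxx mulr1.
  by rewrite big1 // => j _; rewrite !mxE; case: eqP => // _; rewrite mulr0.
rewrite /calX /ddx /ddy /ddz; apply/colP => r.
rewrite [LHS]mxE [X in X + _]mxE (dE _ _ _ (fun i j => j == i.+1)) (dE _ _ _ (fun i j => j == i.+1)).
case: (split_ordP r) => [i ->|i ->].
  rewrite col_mxEu !mxE !ord1 !eqxx !big1 ?addr0 // => j; rewrite /iy /iz /ix;
    by rewrite eq_lrshift.
rewrite col_mxEd !mxE /ix eq_rlshift add0r.
case: (split_ordP i) => [a ->|a ->].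
- rewrite (big_pred1 a) => [|j]; last by rewrite /iy eq_rshift eq_lshift eq_sym.
  rewrite [X in _ + X]big_pred0 => [|j]; last by rewrite /iz eq_rshift eq_lrshift.
  rewrite addr0 big_split_ord /= [X in _ = _ + X]big1 => [|j _]; last first.
    by rewrite block_mxEur mxE mul0r.
  rewrite addr0 big_mkcond; apply: eq_bigr => j _.
  rewrite block_mxEul !mxE /iy; case: eqP => _; by rewrite ?mul1r ?mul0r.
- rewrite [X in X + _]big_pred0 => [|j]; last by rewrite /iy eq_rshift eq_rlshift.
  rewrite (big_pred1 a) => [|j]; last by rewrite /iz !eq_rshift eq_sym.
  rewrite add0r big_split_ord /= [X in _ = X + _]big1 => [|j _]; last first.
    by rewrite block_mxEdl mxE mul0r.
  rewrite add0r big_mkcond; apply: eq_bigr => j _.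
  rewrite block_mxEdr !mxE /iz; case: eqP => _; by rewrite ?mul1r ?mul0r.
Qed.

End ExtendedSpace.

Section MatrixSmooth.
Variables (R : realType) (N : nat).
Local Notation V := 'cV[R]_N.

Definition msmooth a b (F : V -> 'M[R]_(a, b)) := forall i j, ssmooth (fun p => F p i j).

Lemma msmooth_mul a b c (F : V -> 'M[R]_(a, b)) (G : V -> 'M[R]_(b, c)) :
  msmooth F -> msmooth G -> msmooth (fun p => F p *m G p).
Proof.
move=> Fs Gs i j; under eq_fun do rewrite mxE.
by apply: ssmooth_sum => m; apply: ssmooth_mul.
Qed.

Lemma msmooth_cst a b (A : 'M[R]_(a, b)) : msmooth (fun=> A).
Proof. by move=> i j; exact: ssmooth_cst. Qed.

Lemma msmooth_smooth a (F : V -> 'cV[R]_a) : msmooth F <-> smooth F.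
Proof.
split=> [Fs|Fs]; first by apply/smoothP => i; exact: Fs.
by move=> i j; rewrite ord1; move/smoothP: Fs; apply.
Qed.

Lemma ssmooth_exp (t : V -> R) m : ssmooth t -> ssmooth (fun p => t p ^+ m).
Proof.
move=> ts; elim: m => [|m IH]; first exact: ssmooth_cst.
by under eq_fun do rewrite exprS; exact: ssmooth_mul.
Qed.

Lemma ssmooth_mev_comp n (P : mpoly n R) (g : V -> 'cV[R]_n) : smooth g ->
  ssmooth (fun p => mev P (g p)).
Proof.
move=> /smoothP gs; under eq_fun do rewrite mpoly_sum_msupp.
apply: ssmooth_sum => m; apply: ssmooth_mul; first exact: ssmooth_cst.
under eq_fun do rewrite /mev mevalX.
elim: (index_enum _) => [|i r IH].
  by under eq_fun do rewrite big_nil; exact: ssmooth_cst.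
by under eq_fun do rewrite big_cons; apply: ssmooth_mul => //; exact: ssmooth_exp.
Qed.

Lemma smooth_comp_mulmx n m (A : 'M[R]_(N, n)) (f : V -> 'cV[R]_m) :
  smooth f -> smooth (fun c : 'cV[R]_n => f (A *m c)).
Proof.
move=> fs; apply/smoothP => i.
pose F : set ('cV[R]_n -> R) := [set h | exists2 g : V -> R, ssmooth g & h = fun c => g (A *m c)].
apply: (ssmooth_coind (F := F)); last first.
  by exists (fun p => f p i 0) => //; move/smoothP: fs; apply.
move=> h [g gs ->].
have hd c := is_diff_chain (is_diff_mulmxr A (is_diff_ident c)) (ssmooth_diff (A *m c) gs).
split=> [c|v]; first by have [] := hd c.
exists (fun p => 'D_(A *m v) g p); first exact: ssmooth_derive.
by apply/funext => c; exact: is_diff_derive v (hd c).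
Qed.

End MatrixSmooth.

(** * Descent of vector fields to the space of solutions *)

Section Pushforward.
Variables (R : realType) (k l : nat).
Local Notation n := (k + l)%N.
Local Notation V := 'cV[R]_n.
Local Notation EE := 'cV[R]_(1 + n).
Local Notation X := (Xmx R k l).
Local Notation E s := (expmx (s *: X)).
Local Notation sol := (@solution_of R k l).
Implicit Types (p h : EE) (c v w : V) (S T : vfield R (1 + n)).

Variables (N : nat) (P : nat -> 'M[R]_n).
Hypothesis expP : forall s, E s = \sum_(i < N) s ^+ i *: P i.

(* [h] modulo [calX R k l p], identified with a vector of [V]. *)
Definition sg p h : V := dsubmx h - xc h *: (X *m dsubmx p).

Definition dmx : 'M[R]_(n, 1 + n) := row_mx 0 1%:M.

Lemma dsubE p : dsubmx p = dmx *m p.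
Proof. by rewrite -[p in RHS]vsubmxK mul_row_col mul0mx mul1mx add0r. Qed.

Lemma xc_linear (a : R) h h' : xc (a *: h + h') = a * xc h + xc h'.
Proof. by rewrite /xc !mxE. Qed.

Lemma xcB h h' : xc (h - h') = xc h - xc h'.
Proof. by rewrite /xc !mxE. Qed.

Lemma sg_linear p (a : R) h h' : sg p (a *: h + h') = a *: sg p h + sg p h'.
Proof.
rewrite /sg xc_linear !dsubE mulmxDr -scalemxAr scalerBr scalerA.
by rewrite scalerDl opprD addrACA.
Qed.

Lemma sgB p h h' : sg p (h - h') = sg p h - sg p h'.
Proof. by rewrite -[h - h']addrC -scaleN1r sg_linear scaleN1r addrC. Qed.

Lemma xc_calX p : xc (calX R k l p) = 1.
Proof. by rewrite calXE /xc /ix col_mxEu mxE. Qed.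

Lemma sg_calX p : sg p (calX R k l p) = 0.
Proof. by rewrite /sg xc_calX calXE col_mxKd scale1r subrr. Qed.

Lemma EN_K s w : E (- s) *m (E s *m w) = w.
Proof. by rewrite mulmxA expmxNK mul1mx. Qed.

Lemma EKN s w : E s *m (E (- s) *m w) = w.
Proof. by rewrite mulmxA expmxKN mul1mx. Qed.

Lemma is_diff_xc p : is_diff p (fun q : EE => xc q) (fun h => xc h).
Proof. exact: (is_diff_entry _ _ (is_diff_ident p)). Qed.

Lemma is_diff_dsub p : is_diff p (fun q : EE => dsubmx q : V) (fun h => dsubmx h).
Proof.
have -> : (fun q : EE => dsubmx q : V) = fun q => dmx *m q by apply/funext => q; exact: dsubE.
apply: (is_diff_eq (is_diff_mulmxr dmx (is_diff_ident p))).
by [].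
Qed.

Lemma is_diff_sol p : is_diff p sol (fun h => E (- xc p) *m sg p h).
Proof.
have h1 := is_diff_chain (is_diff_xc p) (is_diff_expmxN X (xc p)).
apply: (is_diff_eq (is_diff_mulmx h1 (is_diff_dsub p))); apply/funext => h.
rewrite /sg mulmxBr -scalemxAr -scalemxAl scaleNr addrC.
by rewrite -mulmxA.
Qed.

Lemma derive_sol p h : 'D_h sol p = E (- xc p) *m sg p h.
Proof. exact: is_diff_derive h (is_diff_sol p). Qed.

Lemma ssmooth_xc : ssmooth (fun p => xc p).
Proof. exact: ssmooth_coord. Qed.

Lemma smooth_dsub : smooth (fun p : EE => dsubmx p : V).
Proof.
under eq_fun do rewrite dsubE.
apply: smooth_mulmx; exact: smooth_id.
Qed.

Lemma msmooth_E (t : EE -> R) : ssmooth t -> msmooth (fun p => E (t p)).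
Proof.
move=> ts i j; under eq_fun do rewrite expP summxE.
apply: ssmooth_sum => m; under eq_fun do rewrite mxE.
by apply: ssmooth_mul; [exact: ssmooth_exp|exact: ssmooth_cst].
Qed.

Lemma smooth_sol : smooth sol.
Proof.
apply/msmooth_smooth; apply: msmooth_mul; last exact/msmooth_smooth/smooth_dsub.
by apply: msmooth_E; apply: ssmooth_opp; exact: ssmooth_xc.
Qed.

Lemma derive_sg T p h : smooth T ->
  is_diff p (fun q => sg q (T q)) (fun h => dsubmx ('D_h T p) -
    (xc ('D_h T p) *: (X *m dsubmx p) + xc (T p) *: (X *m dsubmx h))).
Proof.
move=> Ts; have dT := smooth_is_diff p Ts.
have h1 : is_diff p (fun q => dsubmx (T q) : V) (fun h => dsubmx ('D_h T p)).
  exact: (is_diff_chain dT (is_diff_dsub (T p))).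
have h2 : is_diff p (fun q => xc (T q)) (fun h => xc ('D_h T p)).
  exact: (is_diff_chain dT (is_diff_xc (T p))).
exact: (is_diff_sub h1 (is_diff_scale h2 (is_diff_mulmxr X (is_diff_dsub p)))).
Qed.

(* Modulo calX, [S] is the pull-back of [U] under [solution_of]. *)
Definition related S (U : V -> V) := forall p, sg p (S p) = E (xc p) *m U (sol p).

Lemma related_derive S U p h : smooth S -> smooth U -> related S U ->
  dsubmx ('D_h S p) - (xc ('D_h S p) *: (X *m dsubmx p) + xc (S p) *: (X *m dsubmx h)) =
  xc h *: (X *m sg p (S p)) + E (xc p) *m 'D_(E (- xc p) *m sg p h) U (sol p).
Proof.
move=> Ss Us SU.
have h1 := is_diff_chain (is_diff_xc p) (is_diff_expmx X (xc p)).
have h2 := is_diff_chain (is_diff_sol p) (smooth_is_diff (sol p) Us).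
have h3 := is_diff_derive h (is_diff_mulmx h1 h2).
apply: (etrans (esym (is_diff_derive h (derive_sg p h Ss)))).
have -> : (fun q => sg q (S q)) = (fun q => E (xc q) *m U (sol q)).
  by apply/funext => q; exact: SU.
apply: (etrans h3); congr (_ + _).
by rewrite SU -scalemxAl mulmxA.
Qed.

(** The derivative of [S] along [T] is eliminated by differentiating the relation between [S] and
    [U]. Besides the derivative of the class of [T] along [S], there remain a multiple of X, given
    by the x-component of [S], and the differential of [U]: comparing these two yields the symmetry
    condition. *)
Lemma sg_vbracket S T U p : smooth S -> smooth T -> smooth U -> related S U ->
  sg p (vbracket S T p) = 'D_(S p) (fun q => sg q (T q)) p
    - xc (S p) *: (X *m sg p (T p))
    - E (xc p) *m 'D_(E (- xc p) *m sg p (T p)) U (sol p).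
Proof.
move=> Ss Ts Us SU.
have H1 := related_derive p (T p) Ss Us SU.
have H2 := is_diff_derive (S p) (derive_sg p (S p) Ts).
rewrite H2 /vbracket sgB.
move: H1; move: (E (xc p) *m _) => e H1.
have -> : e = dsubmx ('D_(T p) S p) - (xc ('D_(T p) S p) *: (X *m dsubmx p)
   + xc (S p) *: (X *m dsubmx (T p))) - xc (T p) *: (X *m sg p (S p)).
  by rewrite H1 addrAC subrr add0r.
rewrite /sg !mulmxBr -!scalemxAr.
move: ('D_(T p) S p) ('D_(S p) T p) => a b.
move: (X *m (X *m dsubmx p)) (X *m dsubmx p) (X *m dsubmx (S p)) (X *m dsubmx (T p)).
move: (xc a) (xc b) (xc (S p)) (xc (T p)) (dsubmx a) (dsubmx b).
by move=> xa xb xs xt da db c1 c2 c3 c4; apply/colP => i; rewrite !mxE; ring.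
Qed.

(** The integral curve of [calX] through the point of the slice x = 0 with (y, z)-coordinates [c].
    Together with [sol] it gives global coordinates (x, c) on E. *)
Definition flow (x : R) c : EE := col_mx x%:M (E x *m c).

Lemma xc_flow x c : xc (flow x c) = x.
Proof. by rewrite /xc /flow /ix col_mxEu mxE. Qed.

Lemma dsub_flow x c : dsubmx (flow x c) = E x *m c.
Proof. exact: col_mxKd. Qed.

Lemma sol_flow x c : sol (flow x c) = c.
Proof. by rewrite /solution_of -/(xc _) xc_flow dsub_flow EN_K. Qed.

Lemma flow_sol p : flow (xc p) (sol p) = p.
Proof.
rewrite /flow /solution_of EKN -[RHS]vsubmxK; congr col_mx.
by apply/colP => i; rewrite !mxE ord1 eqxx /xc mulr1n; congr (p _ _); apply/val_inj.
Qed.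

Lemma is_diff_flow x c :
  is_diff x (fun t : R => flow t c) (fun a : R => a *: calX R k l (flow x c)).
Proof.
apply: is_diff_mx => i j; rewrite ord1.
case: (split_ordP i) => [a ->|a ->].
  under eq_fun do rewrite col_mxEu mxE ord1 eqxx mulr1n.
  have h0 : is_diff x (fun s : R => s) (fun h : R => h) by exact: is_diff_ident.
  apply: (is_diff_eq h0); apply/funext => t.
  by rewrite mxE calXE col_mxEu mxE ord1 eqxx mulr1.
under eq_fun do rewrite col_mxEd.
have h0 : is_diff x (fun s : R => c) (fun h : R => 0) by exact: is_diff_const.
apply: (is_diff_eq (is_diff_entry a 0 (is_diff_mulmx (is_diff_expmx X x) h0))).
apply/funext => t; rewrite mulmx0 addr0 -scalemxAl [LHS]mxE [RHS]mxE calXE col_mxEd.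
by rewrite dsub_flow mulmxA.
Qed.

(** The slice x = 0 meets every solution once and [sol] is the identity on it, so the descended
    field can be read there. *)
Definition pushU S c : V := sg (flow 0 c) (S (flow 0 c)).

Lemma smooth_pushU S : smooth S -> smooth (pushU S).
Proof.
move=> Ss.
have fE c : flow 0 c = dmx^T *m c.
  rewrite /flow scale0r expmx0 mul1mx /dmx tr_row_mx mul_col_mx trmx0 trmx1 mul0mx mul1mx.
  by congr col_mx; apply/matrixP => i j; rewrite !mxE mul0rn.
have Sf : smooth (fun c => S (flow 0 c)).
  by under eq_fun do rewrite fE; exact: smooth_comp_mulmx.
have ff : smooth (fun c => flow 0 c).
  by under eq_fun do rewrite fE; apply: smooth_mulmx; exact: smooth_id.
apply: smooth_sub.
  by under eq_fun do rewrite dsubE; exact: smooth_mulmx.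
apply: smooth_scale; first by move/smoothP: Sf; apply.
by apply: smooth_mulmx; under eq_fun do rewrite dsubE; exact: smooth_mulmx.
Qed.

Lemma derive_calX p h : is_diff p (calX R k l) (fun h => col_mx 0 (X *m dsubmx h)).
Proof.
have -> : calX R k l = fun q => col_mx 1%:M (X *m dsubmx q).
  by apply/funext => q; exact: calXE.
apply: is_diff_mx => i j; rewrite ord1.
case: (split_ordP i) => [a ->|a ->].
  under eq_fun do rewrite col_mxEu.
  by apply: (is_diff_eq (is_diff_const _ p)); apply/funext => t; rewrite col_mxEu mxE.
under eq_fun do rewrite col_mxEd.
apply: (is_diff_eq (is_diff_entry a 0 (is_diff_mulmxr X (is_diff_dsub p)))).
by apply/funext => t; rewrite col_mxEd.
Qed.

Lemma related_pushU S : smooth S ->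
  (forall p, sg p (vbracket S (calX R k l) p) = 0) -> related S (pushU S).
Proof.
move=> Ss SX p; set c := sol p; rewrite -{1 2}(flow_sol p) -/c; move: (xc p) => x.
pose phi (t : R) := E (- t) *m sg (flow t c) (S (flow t c)).
suff phi0 (t : R) : is_diff t phi (fun=> 0).
  have := mx_zero_diff_const x 0 phi0.
  by rewrite /phi oppr0 scale0r expmx0 mul1mx -/(pushU S c) => <-; rewrite EKN.
have h1 := is_diff_chain (is_diff_flow t c) (derive_sg (flow t c) 0 Ss).
apply: (is_diff_eq (is_diff_mulmx (is_diff_expmxN X t) h1)); apply/funext => a.
have E1 : 'D_(a *: calX R k l (flow t c)) S (flow t c) = a *: 'D_(calX R k l (flow t c)) S (flow t c).
  by rewrite -[a *: calX _ _ _ _]addr0 derive_linear ?derive0 ?addr0 //; exact: smooth_differentiable.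
have := SX (flow t c); rewrite /vbracket.
rewrite (is_diff_derive _ (derive_calX (flow t c) 0)).
rewrite E1; move: ('D_(calX R k l (flow t c)) S (flow t c)) => d.
rewrite sgB => /eqP; rewrite subr_eq0 => /eqP.
rewrite {1}/sg col_mxKd.
have -> : xc (col_mx 0 (X *m dsubmx (S (flow t c)))) = 0 by rewrite /xc /ix col_mxEu mxE.
rewrite scale0r subr0 => E2.
have -> : dsubmx (a *: d) = a *: dsubmx d by rewrite !dsubE scalemxAr.
have -> : xc (a *: d) = a * xc d by rewrite /xc mxE.
have -> : dsubmx (a *: calX R k l (flow t c)) = a *: (X *m dsubmx (flow t c)).
  by rewrite [LHS]dsubE -scalemxAr -dsubE calXE col_mxKd.
rewrite -scalemxAl -mulmxA scalemxAr -mulmxDr.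
rewrite {1}/sg mulmxBr E2 /sg -!scalemxAr.
rewrite (_ : _ + _ = 0) ?mulmx0 //.
move: (dsubmx (flow t c)) => z; move: (dsubmx d) (xc d) (xc _) (X *m (X *m z)) (X *m z) => d1 d2 d3 d4 d5.
by apply/colP => i; rewrite !mxE; ring.
Qed.

End Pushforward.

(** * The isomorphism for a curve given by an arbitrary kernel *)

Section AbstractMain.
Variables (R : realType) (k l : nat).
Local Notation n := (k + l)%N.
Local Notation V := 'cV[R]_n.
Local Notation EE := 'cV[R]_(1 + n).
Local Notation X := (Xmx R k l).
Local Notation E s := (expmx (s *: X)).
Local Notation sol := (@solution_of R k l).
Implicit Types (p h : EE) (c v w : V) (S T : vfield R (1 + n)) (s : R).

Variables (K : 'M[R]_n) (w0 : V) (lam : 'rV[R]_n).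
Variables (N D : nat) (P : nat -> 'M[R]_n).
Local Notation inW := (@memW R n X K).
Local Notation alpha := (@alpha R n X w0 lam).
Local Notation infsym := (@infsym R n X K).
Local Notation infsym_field := (@infsym_field R n X K w0 lam).

Hypothesis lamK : forall w : V, K *m w = 0 -> lam *m w = 0.
Hypothesis Kw0 : K *m w0 = 0.
Hypothesis lamX : (lam *m (X *m w0)) 0 0 = 1.
Hypothesis rankX : forall w : V, K *m w = 0 -> exists2 w' : V, K *m w' = 0 &
  forall c : R, K *m (X *m w') <> c *: (K *m (X *m w)).
Hypothesis expP : forall s, E s = \sum_(i < N) s ^+ i *: P i.
Hypothesis spanW : forall S : seq R, uniq S -> (D <= size S)%N -> forall v : V,
  exists2 c : R -> V, (forall s, inW s (c s)) & v = \sum_(s <- S) c s.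
Hypothesis capW : forall S : seq R, uniq S -> (D <= size S)%N -> forall v : V,
  (forall s, s \in S -> inW s v) -> v = 0.

Lemma lam_unique s (B : V -> V) (a : R) :
  (forall w, K *m w = 0 -> K *m (E (- s) *m B (E s *m w)) = a *: (K *m (X *m w))) ->
  a = (lam *m (E (- s) *m B (E s *m w0))) 0 0.
Proof.
move=> /(_ w0 Kw0) H.
have /lamK : K *m (E (- s) *m B (E s *m w0) - a *: (X *m w0)) = 0.
  by rewrite mulmxBr H -scalemxAr subrr.
rewrite mulmxBr -scalemxAr => /eqP; rewrite subr_eq0 => /eqP ->.
by rewrite mxE lamX mulr1.
Qed.

Lemma infsymE (A : 'M[R]_n) : infsym A <-> forall s w, K *m w = 0 ->
  K *m (E (- s) *m (A *m (E s *m w))) =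
  (lam *m (E (- s) *m (A *m (E s *m w0)))) 0 0 *: (K *m (X *m w)).
Proof.
split=> [As s w Kw|As s]; last first.
  exists ((lam *m (E (- s) *m (A *m (E s *m w0)))) 0 0) => w Kw.
  by rewrite mulmxBr As // -scalemxAr subrr.
have [a Ha] := As s.
have H w' : K *m w' = 0 -> K *m (E (- s) *m (A *m (E s *m w'))) = a *: (K *m (X *m w')).
  move=> /Ha; rewrite mulmxBr -scalemxAr => /eqP; rewrite subr_eq0 => /eqP //.
by rewrite H // -(lam_unique (B := mulmx A) H).
Qed.

(** The entries of the equation in [infsymE] are linear forms in [A]. They present the symmetry
    algebra as the common zeros of a family of forms, as the description of the prolongation
    demands. *)
Definition sym_form s w (i : 'I_n) (A : 'M[R]_n) : R :=
  (K *m (E (- s) *m (A *m (E s *m w)))) i 0 -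
  (lam *m (E (- s) *m (A *m (E s *m w0)))) 0 0 * (K *m (X *m w)) i 0.

Lemma sym_form_linear s w i (a : R) (A B : 'M[R]_n) :
  sym_form s w i (a *: A + B) = a * sym_form s w i A + sym_form s w i B.
Proof.
rewrite /sym_form !mulmxDl !mulmxDr -!scalemxAl -!scalemxAr.
rewrite [X in X - _]mxE [X in _ - X * _]mxE [X in X + _ - _]mxE [X in _ - (X + _) * _]mxE.
by ring.
Qed.

Lemma sym_form_sum s w i (A : 'M[R]_n) :
  sym_form s w i A = \sum_a \sum_b sym_form s w i (delta_mx a b) * A a b.
Proof.
have f0 : sym_form s w i 0 = 0.
  have := sym_form_linear s w i (-1) 0 0; rewrite scaler0 addr0 mulN1r addNr //.
have fs I (r : seq I) (c : I -> R) (B : I -> 'M[R]_n) :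
    sym_form s w i (\sum_(j <- r) c j *: B j) = \sum_(j <- r) c j * sym_form s w i (B j).
  elim: r => [|j r IH]; first by rewrite !big_nil.
  by rewrite !big_cons sym_form_linear IH.
rewrite {1}[A]matrix_sum_delta.
under eq_bigr do rewrite -[\sum_j _]scale1r.
rewrite fs; apply: eq_bigr => a _; rewrite mul1r fs; apply: eq_bigr => b _.
by rewrite mulrC.
Qed.

Definition sym_forms : set 'M[R]_n := [set Lm | exists s w i, K *m w = 0 /\
  Lm = \matrix_(a, b) sym_form s w i (delta_mx a b)].

Lemma infsym_forms : [set A | infsym A] =
  [set A | forall Lm, sym_forms Lm -> \sum_i \sum_j Lm i j * A i j = 0].
Proof.
apply/seteqP; split=> A /=.
  move=> /infsymE As _ [s [w [i [Kw ->]]]].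
  under eq_bigr => a _ do under eq_bigr do rewrite mxE.
  by rewrite -sym_form_sum /sym_form As // mxE subrr.
move=> H; apply/infsymE => s w Kw; apply/colP => i.
have : sym_form s w i A = 0.
  rewrite sym_form_sum -[RHS](H (\matrix_(a, b) sym_form s w i (delta_mx a b))).
    by apply: eq_bigr => a _; apply: eq_bigr => b _; rewrite mxE.
  by exists s, w, i.
by move=> /eqP; rewrite /sym_form subr_eq0 => /eqP ->; rewrite [RHS]mxE.
Qed.

Variable a : set 'M[R]_n.
Hypothesis aE : a = [set A | infsym A].

Lemma aP : a = [set A | forall Lm, sym_forms Lm -> \sum_i \sum_j Lm i j * A i j = 0].
Proof. by rewrite aE infsym_forms. Qed.

Lemma alpha_peval (u : pvfield R n) c s : alpha (peval u) c s =
  (lam *m (E (- s) *m (jac u c *m (E s *m w0)))) 0 0.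
Proof.
have H := congr1 (fun z : V => (lam *m (E (- s) *m z)) 0 0)
  (derive_peval_jac u (E s *m w0) c).
exact H.
Qed.

Lemma infsym_field_peval (u : pvfield R n) : infsym_field (peval u) <-> forall c, a (jac u c).
Proof.
have D1 v c s := congr1 (fun z : V => K *m (E (- s) *m z)) (derive_peval_jac u v c).
rewrite aE; split=> [[us ua] c|ua].
  apply/infsymE => s w Kw.
  apply: (etrans (esym (D1 (E s *m w) c s))).
  apply: (etrans (ua c s (E s *m w) (memW_exp X s Kw))).
  rewrite (alpha_peval u c s); congr (_ *: (K *m (X *m _))); exact: EN_K.
split=> [|c s v vW]; first exact: smooth_peval.
apply: (etrans (D1 v c s)); rewrite (alpha_peval u c s).
have H := (infsymE (jac u c)).1 (ua c) s (E (- s) *m v) vW.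
by apply: etrans H; congr (K *m (_ *m (_ *m _))); exact: esym (EKN s v).
Qed.

Lemma sternberg_infsym (u : pvfield R n) :
  sternberg_prolongation a u <-> infsym_field (peval u).
Proof.
split=> [/(sternbergP aP)/(prolongsP aP)/infsym_field_peval //|].
by move=> /infsym_field_peval/(prolongsP aP)/(sternbergP aP).
Qed.

Lemma infsym_field_poly (U : V -> V) : infsym_field U -> exists u : pvfield R n, U = peval u.
Proof.
move=> Ui; apply: (@iterD_smooth_poly _ _ (N + N + D) U); first exact: Ui.1.
by move=> vs vsE; exact: (iterD_infsym0 rankX expP spanW capW Ui vsE).
Qed.

Lemma sternberg_linear (b : R) (u v : pvfield R n) : sternberg_prolongation a u ->
  sternberg_prolongation a v -> sternberg_prolongation a (b *: u + v).
Proof.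
move=> /(sternbergP aP) pu /(sternbergP aP) pv; apply/(sternbergP aP) => Lm LL.
by rewrite Jlin_addZ pu // pv // scaler0 addr0.
Qed.

Lemma sternberg0 : sternberg_prolongation a 0.
Proof. by apply/(sternbergP aP) => Lm _; exact: Jlin0. Qed.

Lemma sternberg_finite_dimensional : finite_dimensional (sternberg_prolongation a).
Proof.
pose M := (N + N + D)%N.
pose T : finType := ('I_n * bmultinom n M)%type.
pose f (u : pvfield R n) : 'rV[R]_#|T| :=
  \row_i mcoeff (val (enum_val i).2) (u (enum_val i).1).
have flin : linear f.
  by move=> b u v; apply/rowP => i; rewrite !mxE !ffunE mcoeffD mcoeffZ.
pose fL := GRing.isLinear.Build _ _ _ _ f flin.
pose F : {linear pvfield R n -> 'rV[R]_#|T|} := HB.pack f fL.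
apply: (finite_dimensional_inj (f := F)).
- exact: sternberg0.
- by move=> b u v; exact: sternberg_linear.
move=> u /sternberg_infsym ui /rowP fu.
have uM : forall i m, (M <= mdeg m)%N -> mcoeff m (u i) = 0.
  apply: iterD_peval_coeff => vs vsE.
  exact: (iterD_infsym0 rankX expP spanW capW ui vsE).
apply/ffunP => i; apply/mpolyP => m; rewrite ffunE mcoeff0.
have [|mM] := leqP M (mdeg m); first exact: uM.
have := fu (enum_rank ((i, BMultinom mM) : T)).
by rewrite !mxE enum_rankK.
Qed.

(** [flag] separates the two kinds: true for D, which contains [calX], and false for F_1, whose
    vectors have no x-component. *)
Variables (L : seq (vfield R (1 + n))) (flag : bool).
Hypothesis spanL : forall p h,
  h \in span_at L p <-> K *m sg p h = 0 /\ (flag \/ xc h = 0).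

Let g : set (vfield R (1 + n)) :=
  [set S | [/\ smooth S, preserves S (distX R k l) & preserves S L]].

Lemma spanX p h : h \in span_at (distX R k l) p <-> sg p h = 0.
Proof.
rewrite /span_at /= span_seq1; split=> [/vlineP[b ->]|h0].
  by rewrite -[b *: _]addr0 sg_linear sg_calX scaler0 add0r /sg /xc !mxE scale0r subr0 linear0.
apply/vlineP; exists (xc h); rewrite calXE scale_col_mx -[LHS]vsubmxK; congr col_mx.
  by apply/colP => i; rewrite !mxE ord1 eqxx mulr1 /xc; congr (h _ _); apply/val_inj.
by move: h0; rewrite /sg => /eqP; rewrite subr_eq0 => /eqP.
Qed.

Lemma preserves_linear (Ls : seq (vfield R (1 + n))) (b : R) S T :
  smooth S -> smooth T -> preserves S Ls -> preserves T Ls ->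
  preserves (b *: S + T : vfield R (1 + n)) Ls.
Proof.
move=> Ss Ts pS pT Y Ys YL p; rewrite vbracket_linear //.
by apply: memvD; [apply: memvZ; exact: pS|exact: pT].
Qed.

Lemma preserves_vbracket (Ls : seq (vfield R (1 + n))) S T :
  smooth S -> smooth T -> preserves S Ls -> preserves T Ls -> preserves (vbracket S T) Ls.
Proof.
move=> Ss Ts pS pT Y Ys YL p; rewrite vbracket_jacobi //.
apply: memvB.
  by apply: pS => [|q]; [exact: smooth_vbracket|exact: pT].
by apply: pT => [|q]; [exact: smooth_vbracket|exact: pS].
Qed.

Lemma smooth_addZ (b : R) S T : smooth S -> smooth T -> smooth (b *: S + T : vfield R (1 + n)).
Proof.
by move=> Ss Ts; apply: smooth_add => //; apply: smooth_scale => //; exact: ssmooth_cst.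
Qed.

Lemma preserves0 (Ls : seq (vfield R (1 + n))) : preserves (0 : vfield R (1 + n)) Ls.
Proof.
move=> Y Ys YL p; rewrite /vbracket derive0 sub0r.
rewrite (_ : 'D_(Y p) _ p = 0) ?oppr0 ?mem0v //.
exact: is_diff_derive _ (is_diff_const 0 p).
Qed.

Lemma symmetry_subalgebra : lie_subalgebra (@vbracket R (1 + n)) g.
Proof.
split=> [|b S T [Ss SX SL] [Ts TX TL]|S T [Ss SX SL] [Ts TX TL]].
- by split; [exact: smooth_cst|exact: preserves0|exact: preserves0].
- by split; [exact: smooth_addZ|exact: preserves_linear|exact: preserves_linear].
- by split; [exact: smooth_vbracket|exact: preserves_vbracket|exact: preserves_vbracket].
Qed.

Lemma smooth_calX : smooth (calX R k l).
Proof.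
have -> : calX R k l = fun q => col_mx 1%:M (X *m dsubmx q).
  by apply/funext => q; exact: calXE.
apply/smoothP => i; case: (split_ordP i) => [j ->|j ->].
  by under eq_fun do rewrite col_mxEu; exact: ssmooth_cst.
under eq_fun do rewrite col_mxEd.
have : smooth (fun q : EE => X *m dsubmx q) by apply: smooth_mulmx; exact: smooth_dsub.
by move/smoothP; apply.
Qed.

Lemma symmetry_related S : g S -> related S (pushU S).
Proof.
move=> [Ss SX _]; apply: related_pushU => // p; apply/spanX; apply: SX.
  exact: smooth_calX.
by move=> q; apply/spanX; exact: sg_calX.
Qed.

Lemma xc_col0 w : xc (col_mx 0 w) = 0.
Proof. by rewrite /xc /ix col_mxEu mxE. Qed.

Lemma sg_col0 p w : sg p (col_mx 0 w) = w.
Proof. by rewrite /sg xc_col0 scale0r subr0 col_mxKd. Qed.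

Lemma symmetry_pushU_derive S p w : g S -> K *m w = 0 ->
  K *m (E (xc p) *m 'D_(E (- xc p) *m w) (pushU S) (sol p)) = - xc (S p) *: (K *m (X *m w)).
Proof.
move=> gS Kw; have [Ss _ SL] := gS.
have Us := smooth_pushU Ss.
(* A constant field without x-component and with class in ker K is a section of [L] for either value
   of [flag]. *)
pose T : vfield R (1 + n) := fun=> col_mx 0 w.
have Ts : smooth T by exact: smooth_cst.
have TL q : T q \in span_at L q.
  by apply/spanL; rewrite sg_col0 xc_col0; split=> //; right.
have /spanL[] := SL T Ts TL p.
rewrite (sg_vbracket p Ss Ts Us (symmetry_related gS)) => H _.
have D0 : 'D_(S p) (fun q => sg q (T q)) p = 0.
  have -> : (fun q => sg q (T q)) = fun=> w by apply/funext => q; exact: sg_col0.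
  exact: is_diff_derive _ (is_diff_const w p).
move: H; rewrite D0 sg_col0 sub0r.
rewrite mulmxBr mulmxN -scalemxAr => /eqP; rewrite subr_eq0 => /eqP <-.
by rewrite scaleNr.
Qed.

(** The point [flow (- s) c] lies over [c] and its fibre corresponds to W_s, so
    [symmetry_pushU_derive] covers all s and c. Evaluated at w0 it identifies the x-component. *)
Lemma symmetry_pushU S : g S -> infsym_field (pushU S) /\
  forall p, xc (S p) = - alpha (pushU S) (sol p) (- xc p).
Proof.
move=> gS; have [Ss _ _] := gS; have Us := smooth_pushU Ss.
have H c s w : K *m w = 0 -> K *m (E (- s) *m 'D_(E s *m w) (pushU S) c) =
    - xc (S (flow (- s) c)) *: (K *m (X *m w)).
  move=> Kw; have := symmetry_pushU_derive (flow (- s) c) gS Kw.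
  by rewrite xc_flow sol_flow opprK.
have A c s : - xc (S (flow (- s) c)) = alpha (pushU S) c s.
  exact: (lam_unique (B := fun v => 'D_v (pushU S) c) (H c s)).
split=> [|p]; last by rewrite -A opprK opprK flow_sol.
split=> // c s v vW.
have := H c s (E (- s) *m v) vW; rewrite A.
by have -> : E s *m (E (- s) *m v) = v by exact: EKN.
Qed.

(** The inverse of the push-forward: the x-component [xi] is forced by [symmetry_pushU], the other
    components by the relation with [peval u]. *)
Definition lift (u : pvfield R n) : vfield R (1 + n) := fun p =>
  let xi := - alpha (peval u) (sol p) (- xc p) in
  col_mx xi%:M (E (xc p) *m peval u (sol p) + xi *: (X *m dsubmx p)).

Lemma xc_lift u p : xc (lift u p) = - alpha (peval u) (sol p) (- xc p).
Proof. by rewrite /xc /ix /lift col_mxEu mxE. Qed.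

Lemma related_lift u : related (lift u) (peval u).
Proof. by move=> p; rewrite /sg xc_lift /lift col_mxKd addrK. Qed.

Lemma ssmooth_xc_lift u : ssmooth (fun p => xc (lift u p)).
Proof.
under eq_fun do rewrite xc_lift.
apply: ssmooth_opp.
have -> : (fun p => alpha (peval u) (sol p) (- xc p)) = (fun p =>
    (lam *m (E (xc p) *m (jac u (sol p) *m (E (- xc p) *m w0)))) 0 0).
  by apply/funext => p; rewrite (alpha_peval u (sol p) (- xc p)) opprK.
have h : msmooth (fun p => lam *m (E (xc p) *m (jac u (sol p) *m (E (- xc p) *m w0)))).
  apply: msmooth_mul; first exact: msmooth_cst.
  apply: msmooth_mul; first by apply: (msmooth_E expP); exact: ssmooth_xc.
  apply: msmooth_mul.
    move=> i j; under eq_fun do rewrite mxE; apply: ssmooth_mev_comp; exact: (smooth_sol expP).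
  apply: msmooth_mul; last exact: msmooth_cst.
  by apply: (msmooth_E expP); apply: ssmooth_opp; exact: ssmooth_xc.
exact: h.
Qed.

Lemma smooth_lift u : smooth (lift u).
Proof.
have -> : lift u = fun p => col_mx (xc (lift u p))%:M
    (E (xc p) *m peval u (sol p) + xc (lift u p) *: (X *m dsubmx p)).
  by apply/funext => p; rewrite xc_lift.
apply/smoothP => i; case: (split_ordP i) => [j ->|j ->].
  rewrite (_ : (fun p => _) = fun p => xc (lift u p)); first exact: ssmooth_xc_lift.
  by apply/funext => p; rewrite col_mxEu [j]ord1 mxE eqxx mulr1n.
under eq_fun do rewrite col_mxEd.
have : smooth (fun p => E (xc p) *m peval u (sol p) + xc (lift u p) *: (X *m dsubmx p)).
  apply: smooth_add.
    apply/msmooth_smooth/msmooth_mul; first by apply: (msmooth_E expP); exact: ssmooth_xc.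
    apply/msmooth_smooth/smoothP => i'; under eq_fun do rewrite pevalE.
    by apply: ssmooth_mev_comp; exact: (smooth_sol expP).
  apply: smooth_scale; first exact: ssmooth_xc_lift.
  by apply: smooth_mulmx; exact: smooth_dsub.
by move/smoothP; apply.
Qed.

(** A directional derivative depends only on the values along one line. This turns a derivative on E
    in a direction that fixes x into a derivative on V. *)
Lemma derive_along (V1 V2 W : normedModType R) (F : V1 -> W) (G : V2 -> W) (x h : V1) (y v : V2) :
  (forall t : R, F (t *: h + x) = G (t *: v + y)) -> 'D_h F x = 'D_v G y.
Proof.
move=> FG; rewrite /derive.
have FG0 : F x = G y by have := FG 0; rewrite !scale0r !add0r.
have -> : (fun t : R => t^-1 *: ((F \o shift x) (t *: h) - F x)) =
    (fun t : R => t^-1 *: ((G \o shift y) (t *: v) - G y)); last by [].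
by apply/funext => t; rewrite /= /shift FG FG0.
Qed.

Lemma K_cancel (d e y : V) (al x : R) :
  K *m d = 0 -> K *m e = al *: (K *m (X *m y)) -> x = - al ->
  K *m (d - x *: (X *m y) - e) = 0.
Proof.
move=> Kd Ke ->; rewrite !mulmxBr Kd Ke sub0r scaleNr mulmxN opprK.
by rewrite -scalemxAr subrr.
Qed.

Lemma K_vbracket_lift u T p : infsym_field (peval u) -> smooth T ->
  (forall q, K *m sg q (T q) = 0) -> K *m sg p (vbracket (lift u) T p) = 0.
Proof.
move=> ui Ts KT.
rewrite (sg_vbracket p (smooth_lift u) Ts ui.1 (@related_lift u)).
have D0 : K *m 'D_(lift u p) (fun q => sg q (T q)) p = 0.
  have h := derive_sg p (lift u p) Ts.
  rewrite (is_diff_derive _ h) -(is_diff_derive (lift u p) (is_diff_mulmxr K h)).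
  have -> : (fun q => K *m sg q (T q)) = fun=> 0 by apply/funext => q; exact: KT.
  exact: is_diff_derive _ (is_diff_const 0 p).
have H : K *m (E (xc p) *m 'D_(E (- xc p) *m sg p (T p)) (peval u) (sol p)) =
    alpha (peval u) (sol p) (- xc p) *: (K *m (X *m sg p (T p))).
  have W : inW (- xc p) (E (- xc p) *m sg p (T p)).
    by rewrite /memW opprK EKN.
  have := ui.2 (sol p) (- xc p) _ W.
  by rewrite (opprK (xc p)) EKN.
exact: K_cancel D0 H (xc_lift u p).
Qed.

Lemma sg_vbracket_lift0 u T p : infsym_field (peval u) -> smooth T ->
  (forall q, sg q (T q) = 0) -> sg p (vbracket (lift u) T p) = 0.
Proof.
move=> ui Ts T0.
rewrite (sg_vbracket p (smooth_lift u) Ts ui.1 (@related_lift u)) T0 !mulmx0 scaler0 derive0 mulmx0 !subr0.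
have -> : (fun q => sg q (T q)) = fun=> 0 by apply/funext => q; exact: T0.
exact: is_diff_derive _ (is_diff_const 0 p).
Qed.

Lemma xc_derive (F : EE -> EE) p h : smooth F -> xc ('D_h F p) = 'D_h (fun q => xc (F q)) p.
Proof.
move=> Fs; exact: esym (is_diff_derive h (is_diff_entry _ _ (smooth_is_diff p Fs))).
Qed.

Lemma alpha_differentiable (U : V -> V) c s : smooth U ->
  differentiable (fun c => alpha U c s) c.
Proof.
move=> us; have us0 := smooth_derive (E s *m w0) us.
have h2 := is_diff_entry 0 0 (is_diff_mulmxr lam (is_diff_mulmxr (E (- s)) (smooth_is_diff c us0))).
by have [] := h2.
Qed.

(** F_1, unlike D, leaves no room for a multiple of [calX]. The x-component of the bracket is, up to
    sign, the derivative of alpha along a vector of W_s at the fixed value s = -x, and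
    [alpha_derive_memW] makes it vanish. *)
Lemma xc_vbracket_lift u T p : infsym_field (peval u) -> smooth T ->
  (forall q, K *m sg q (T q) = 0) -> (forall q, xc (T q) = 0) ->
  xc (vbracket (lift u) T p) = 0.
Proof.
move=> ui Ts KT xT; rewrite /vbracket xcB (xc_derive p _ Ts) (xc_derive p _ (smooth_lift u)).
have -> : (fun q => xc (T q)) = fun=> 0 by apply/funext => q; exact: xT.
rewrite (is_diff_derive _ (is_diff_const (0 : R) p)) sub0r; apply/eqP; rewrite oppr_eq0; apply/eqP.
set h := T p; pose v := E (- xc p) *m dsubmx h.
have sgh : sg p h = dsubmx h by rewrite /sg xT scale0r subr0.
have vW : inW (- xc p) v by rewrite /memW opprK EKN -sgh KT.
pose G c := - alpha (peval u) c (- xc p).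
have FG (t : R) : xc (lift u (t *: h + p)) = G (t *: v + sol p).
  have xh : xc (t *: h + p) = xc p by rewrite xc_linear xT mulr0 add0r.
  have solE : sol (t *: h + p) = t *: v + sol p.
    rewrite /solution_of -/(xc _) xh -/(xc p) /v.
    have -> : dsubmx (t *: h + p) = t *: dsubmx h + dsubmx p :> V.
      by rewrite [LHS]dsubE mulmxDr -scalemxAr -!dsubE.
    by rewrite mulmxDr -scalemxAr.
  by apply: (etrans (xc_lift u _)); rewrite xh solE.
rewrite (derive_along FG).
have us := ui.1.
have da : is_diff (sol p) (fun c => alpha (peval u) c (- xc p))
    (fun v => alpha (fun c => 'D_v (peval u) c) (sol p) (- xc p)).
  split; last by apply/funext => v'; rewrite -deriveE ?derive_alpha //; exact: alpha_differentiable.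
  exact: alpha_differentiable.
rewrite (is_diff_derive v (is_diff_opp da)).
by rewrite (alpha_derive_memW rankX ui vW) oppr0.
Qed.

Lemma lift_symmetry u : infsym_field (peval u) -> g (lift u).
Proof.
move=> ui; split; first exact: smooth_lift.
  move=> T Ts TX p; apply/spanX/sg_vbracket_lift0 => // q; exact/spanX.
move=> T Ts TL p; apply/spanL; split.
  by apply: K_vbracket_lift => // q; have /spanL[] := TL q.
have [fl|fl] := boolP flag; first by left.
right; apply: xc_vbracket_lift => // q; have /spanL[] := TL q => // _ [fl'|//].
by rewrite fl' in fl.
Qed.

Lemma pushU_lift u : pushU (lift u) = peval u.
Proof.
apply/funext => c; rewrite /pushU (related_lift u) xc_flow sol_flow.
by rewrite scale0r expmx0 mul1mx.
Qed.

(** For a symmetry the polynomial exists by [infsym_field_poly] and is unique by [peval_inj]; 0 is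
    the default when there is none. *)
Definition pushforward S : pvfield R n := xget 0 [set u | pushU S = peval u].

Lemma pushforwardE S : g S -> peval (pushforward S) = pushU S.
Proof.
move=> gS; have [Ui _] := symmetry_pushU gS.
by have [u uE] := infsym_field_poly Ui; rewrite /pushforward; case: xgetP => [v _ ->|/(_ u)].
Qed.

Lemma pushforward_sternberg S : g S -> sternberg_prolongation a (pushforward S).
Proof.
by move=> gS; apply/sternberg_infsym; rewrite pushforwardE //; case: (symmetry_pushU gS).
Qed.

Lemma derive_sol_symmetry S p : g S -> 'D_(S p) sol p = pushU S (sol p).
Proof. by move=> gS; rewrite derive_sol (symmetry_related gS) EN_K. Qed.

Lemma pushforward_unique S u : g S -> (forall c, pushU S c = peval u c) -> pushforward S = u.
Proof. by move=> gS uE; apply: peval_inj => c; rewrite pushforwardE. Qed.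

Lemma lift_pushforward S : g S -> lift (pushforward S) = S.
Proof.
move=> gS; apply/funext => p; have [_ xS] := symmetry_pushU gS.
have e1 : xc (lift (pushforward S) p) = xc (S p) by rewrite xc_lift pushforwardE // xS.
have e2 : sg p (lift (pushforward S) p) = sg p (S p).
  by rewrite related_lift pushforwardE // (symmetry_related gS).
rewrite -[LHS]vsubmxK -[RHS]vsubmxK; congr col_mx.
  apply/colP => i; rewrite [LHS]mxE [RHS]mxE ord1.
  by have -> : lshift n (0 : 'I_1) = ix k l by apply/val_inj.
by move: e2; rewrite /sg e1 => /addIr.
Qed.

Lemma pushforward_lift u : sternberg_prolongation a u -> pushforward (lift u) = u.
Proof.
move=> /sternberg_infsym ui; apply: pushforward_unique; first exact: lift_symmetry.
by move=> c; rewrite pushU_lift.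
Qed.

Lemma pushU_linear (b : R) S T c : pushU (b *: S + T : vfield R (1 + n)) c = b *: pushU S c + pushU T c.
Proof. by rewrite /pushU -sg_linear. Qed.

(** The derivative of [sol] along a symmetry is the descended field composed with [sol], so
    [lie_vbracket] applied to [sol] turns the bracket on E into the one on V. *)
Lemma pushU_vbracket S T c : g S -> g T ->
  pushU (vbracket S T) c = 'D_(pushU S c) (pushU T) c - 'D_(pushU T c) (pushU S) c.
Proof.
move=> gS gT; have [Ss _ _] := gS; have [Ts _ _] := gT.
have [_ _ gST] := symmetry_subalgebra.
have lieE S' T' : g S' -> g T' ->
    lie S' (lie T' sol) (flow 0 c) = 'D_(pushU S' c) (pushU T') c.
  move=> gS' gT'; have [Ts' _ _] := gT'.
  have -> : lie T' sol = fun q => pushU T' (sol q).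
    by apply/funext => q'; exact: derive_sol_symmetry.
  have h := is_diff_chain (is_diff_sol (flow 0 c))
    (smooth_is_diff (sol (flow 0 c)) (smooth_pushU Ts')).
  apply: (etrans (is_diff_derive (S' (flow 0 c)) h)).
  by rewrite -derive_sol (derive_sol_symmetry (flow 0 c) gS') sol_flow.
have E0 : pushU (vbracket S T) c = lie (vbracket S T) sol (flow 0 c).
  rewrite -[c in LHS](sol_flow 0 c).
  exact: esym (derive_sol_symmetry (flow 0 c) (gST S T gS gT)).
have E1 := lie_vbracket (flow 0 c) Ss Ts (smooth_sol expP).
have A := lieE S T gS gT.
have B := lieE T S gT gS.
apply: (etrans E0); apply: (etrans E1).
rewrite A.
by rewrite B.
Qed.

Lemma pushforward_vbracket S T : g S -> g T ->
  pushforward (vbracket S T) = pbracket (pushforward S) (pushforward T).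
Proof.
move=> gS gT; have [_ _ gST] := symmetry_subalgebra.
apply: pushforward_unique; first exact: gST.
by move=> c; rewrite peval_pbracket !pushforwardE // pushU_vbracket.
Qed.

Lemma pushforward_isomorphism :
  lie_isomorphism (@vbracket R (1 + n)) (@pbracket R n) g (sternberg_prolongation a) pushforward.
Proof.
have [g0 gl gb] := symmetry_subalgebra.
split=> //.
- split=> [|b u v|u v ua va]; [exact: sternberg0|exact: sternberg_linear|].
  (* Stability of the prolongation under the bracket is transported from the symmetries, [u] and [v]
     being the push-forwards of their lifts. *)
  have gu : g (lift u) by apply/lift_symmetry/sternberg_infsym.
  have gv : g (lift v) by apply/lift_symmetry/sternberg_infsym.
  rewrite -(pushforward_lift ua) -(pushforward_lift va) -pushforward_vbracket //.
  by apply: pushforward_sternberg; exact: gb.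
- split=> [S gS|S T|u ua]; first exact: pushforward_sternberg.
    move=> /set_mem gS /set_mem gT /(congr1 lift).
    by rewrite (lift_pushforward gS) (lift_pushforward gT).
  by exists (lift u); [apply/lift_symmetry/sternberg_infsym|exact: pushforward_lift].
- move=> b S T gS gT; apply: pushforward_unique; first exact: gl.
  by move=> c; rewrite pushU_linear peval_addZ !pushforwardE.
- exact: pushforward_vbracket.
Qed.

Theorem sternberg_symmetry_isomorphism :
  finite_dimensional (sternberg_prolongation a) /\
  exists phi : vfield R (1 + n) -> pvfield R n,
    lie_isomorphism (@vbracket R (1 + n)) (@pbracket R n) g (sternberg_prolongation a) phi /\
    pushes_forward g phi.
Proof.
split; first exact: sternberg_finite_dimensional.
exists pushforward; split; first exact: pushforward_isomorphism.
by move=> S gS p; rewrite derive_sol_symmetry // pushforwardE.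
Qed.

End AbstractMain.

(** * The curves W_s for the operator X *)

Section JordanBlocks.
Variables (R : realType) (k l : nat).
Local Notation n := (k + l)%N.
Local Notation V := 'cV[R]_n.
Local Notation X := (Xmx R k l).
Local Notation E s := (expmx (s *: X)).
Implicit Types (i j : 'I_n) (s t : R).

(** In the global numbering f_0 has index k, so the condition on [j] excludes the entry that would
    link the two blocks. *)
Lemma XmxE i j : X i j = ((j == i.+1 :> nat) && (j != k :> nat))%:R.
Proof.
rewrite /Xmx; case: (split_ordP i) => [a ->|a ->]; case: (split_ordP j) => [b ->|b ->].
- rewrite block_mxEul mxE /=; congr (nat_of_bool _)%:R.
  by have := ltn_ord b; case: (nat_of_ord b =P k) => [->|_]; rewrite ?ltnn ?andbT.
- rewrite block_mxEur mxE /=; case: eqP => //= E1; case: eqP => //= E2.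
  by have := ltn_ord a; lia.
- rewrite block_mxEdl mxE /=; case: eqP => //= E1.
  by have := ltn_ord b; lia.
- rewrite block_mxEdr mxE /= -addnS eqn_add2l; congr (nat_of_bool _)%:R.
  case: eqP => //= ->; apply/eqP; lia.
Qed.

Definition same_block (i j : nat) := (i < k)%N == (j < k)%N.

Definition expXmx t : 'M[R]_n :=
  \matrix_(i, j) if (i <= j)%N && same_block i j then t ^+ (j - i) / (j - i)`!%:R else 0.

Lemma expXmx0 : expXmx 0 = 1%:M.
Proof.
apply/matrixP => i j; rewrite !mxE.
have [->|ij] := eqVneq i j; first by rewrite leqnn /same_block eqxx subnn expr0 fact0 divr1.
case: ifP => // /andP[lij _]; rewrite expr0n subn_eq0 leqNgt.
have -> : (i < j)%N by rewrite ltn_neqAle lij andbT; apply: contra ij => /eqP/val_inj ->.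
by rewrite mul0r.
Qed.

Lemma is_diff_expXmx t : is_diff t expXmx (fun h : R => h *: (X *m expXmx t)).
Proof.
apply: is_diff_mx => i j.
have h0 (a : R) : is_diff t (fun s : R => a) (fun h : R => 0) by exact: is_diff_const.
have XE : (X *m expXmx t) i j =
    if (i < j)%N && same_block i j then t ^+ (j - i.+1) / (j - i.+1)`!%:R else 0.
  rewrite mxE; have [i1|i1] := ltnP i.+1 n; last first.
    rewrite big1 => [|r _]; last first.
      rewrite XmxE; case: eqP => [E1|]; last by rewrite mul0r.
      by have := ltn_ord r; lia.
    by case: ifP => // /andP[ij _]; have := ltn_ord j; lia.
  rewrite (bigD1 (Ordinal i1)) //= big1 => [|r ri]; last first.
    rewrite XmxE; case: eqP => [E1|]; last by rewrite mul0r.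
    by case/eqP: ri; apply/val_inj.
  rewrite XmxE mxE /= eqxx addr0 /=.
  have [ik|ik] := eqVneq i.+1 k.
    rewrite mul0r; case: ifP => //; rewrite /same_block => /andP[ij /eqP sb].
    have jk : (j < k)%N by rewrite -sb; lia.
    lia.
  rewrite mul1r /same_block; have -> : (i.+1 < k)%N = (i < k)%N by lia.
  by [].
under eq_fun do rewrite mxE.
have [ij|ij|ij] := ltngtP i j.
- case: (boolP (same_block i j)) => sb /=.
  + have -> : (j - i = (j - i.+1).+1)%N by lia.
    set d := (j - i.+1)%N.
    apply: (is_diff_eq (is_diff_mul (is_diff_exprS t d) (h0 (d.+1`!%:R)^-1))).
    apply/funext => h; rewrite mxE XE ij sb /= -/d mulr0 addr0 factS natrM.
    by field; rewrite nat1r !pnatr_eq0 -lt0n fact_gt0.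
  + apply: (is_diff_eq (h0 0)); apply/funext => h.
    by rewrite mxE XE (negbTE sb) andbF mulr0.
- apply: (is_diff_eq (h0 0)); apply/funext => h.
  by rewrite mxE XE ltnNge (ltnW ij) /= mulr0.
- have -> : (fun x : R => if same_block i j then x ^+ (j - i) / (j - i)`!%:R else 0) =
      fun=> if same_block i j then 1 else 0.
    by apply/funext => x; rewrite ij subnn expr0 fact0 divr1.
  apply: (is_diff_eq (h0 _)); apply/funext => h.
  by rewrite mxE XE ij ltnn /= mulr0.
Qed.

Lemma expmx_X t : E t = expXmx t.
Proof.
have := mx_linear_ode_unique is_diff_expXmx t.
by rewrite expXmx0 mulmx1.
Qed.

Lemma expmx_XE t i j : E t i j =
  if (i <= j)%N && same_block i j then t ^+ (j - i) / (j - i)`!%:R else 0.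
Proof. by rewrite expmx_X mxE. Qed.

Lemma expmx_X_poly t : E t = \sum_(d < n) t ^+ d *:
  \matrix_(i, j) (if [&& (i <= j)%N, same_block i j & d == j - i :> nat]%N then (d`!%:R)^-1 else 0).
Proof.
apply/matrixP => i j; rewrite expmx_XE summxE.
have dn : (j - i < n)%N by exact: leq_ltn_trans (leq_subr _ _) (ltn_ord j).
rewrite (bigD1 (Ordinal dn)) //= big1 ?addr0 => [|d dne].
  rewrite !mxE /= eqxx andbT; case: ifP => _; by rewrite ?mulr0.
rewrite !mxE; case: eqP => [E1|]; last by rewrite !andbF mulr0.
by case/eqP: dne; apply/val_inj.
Qed.

Definition projmx (q : pred 'I_n) : 'M[R]_n := \matrix_(i, j) ((i == j) && q i)%:R.

Lemma projmx_entry q m (v : 'M[R]_(n, m)) i (j : 'I_m) : (projmx q *m v) i j = if q i then v i j else 0.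
Proof.
rewrite mxE (bigD1 i) //= big1 ?addr0 => [|r ri].
  by rewrite mxE eqxx; case: ifP => _; rewrite ?mul1r ?mul0r.
by rewrite mxE eq_sym (negbTE ri) mul0r.
Qed.

Lemma projmx_ker q (v : V) : projmx q *m v = 0 <-> forall i, q i -> v i 0 = 0.
Proof.
split=> [H i qi|H]; first by have := projmx_entry q v i 0; rewrite H qi mxE => <-.
by apply/colP => i; rewrite projmx_entry mxE; case: ifP => // /H.
Qed.

Lemma projmx_idem q : projmx q *m projmx q = projmx q.
Proof.
by apply/matrixP => i j; rewrite projmx_entry !mxE; case: (q i) => //; rewrite andbF.
Qed.

Lemma projmxC q : 1%:M - projmx q = projmx (predC q).
Proof.
apply/matrixP => i j; rewrite !mxE /=; case: (i == j); last by rewrite subrr.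
by case: (q i); rewrite ?subrr ?subr0.
Qed.

Lemma projmx_tr q : (projmx q)^T = projmx q.
Proof.
apply/matrixP => i j; rewrite !mxE eq_sym; case: eqP => // ->//.
Qed.

Definition bottom (i : 'I_n) : bool := (i == 0 :> nat) || (i == k :> nat).
Definition top (i : 'I_n) : bool := (i.+1 == k :> nat) || (i.+1 == n :> nat).

(** Reversal of each block. The second block has the indices from k to n - 1, whence the constant k
    + (n - 1). *)
Definition rvn (i : nat) : nat := if (i < k)%N then (k.-1 - i)%N else (k + n.-1 - i)%N.

Lemma rvn_lt (i : 'I_n) : (rvn i < n)%N.
Proof. by have := ltn_ord i; rewrite /rvn; case: ifP => ik; lia. Qed.

Definition rv (i : 'I_n) : 'I_n := Ordinal (rvn_lt i).

Lemma rvK : involutive rv.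
Proof.
move=> i; apply/val_inj => /=; have := ltn_ord i; rewrite /rvn.
by case: (ltnP i k) => ik; case: ifP => ik'; lia.
Qed.

(** The Gram matrix of a symmetric pairing for which X is self-adjoint ([revmx_X]). *)
Definition revmx : 'M[R]_n := \matrix_(i, j) (j == rv i)%:R.

Lemma revmx_entry m (v : 'M[R]_(n, m)) i (j : 'I_m) : (revmx *m v) i j = v (rv i) j.
Proof.
rewrite mxE (bigD1 (rv i)) //= big1 ?addr0 => [|r ri]; first by rewrite mxE eqxx mul1r.
by rewrite mxE (negbTE ri) mul0r.
Qed.

Lemma revmx_tr : revmx^T = revmx.
Proof. by apply/matrixP => i j; rewrite !mxE eq_sym; rewrite -(inj_eq (inv_inj rvK)) rvK. Qed.

Lemma mulmx_revmx m (v : 'M[R]_(m, n)) (i : 'I_m) j : (v *m revmx) i j = v i (rv j).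
Proof. by rewrite -[v *m revmx]trmxK trmx_mul revmx_tr mxE revmx_entry mxE. Qed.

Lemma revmxK : revmx *m revmx = 1%:M.
Proof. by apply/matrixP => i j; rewrite revmx_entry !mxE rvK eq_sym. Qed.

Lemma revmx_X : revmx *m X *m revmx = X^T.
Proof.
apply/matrixP => i j; rewrite mulmx_revmx revmx_entry [RHS]mxE !XmxE /= /rvn.
congr (nat_of_bool _)%:R; have := ltn_ord i; have := ltn_ord j.
by case: (ltnP i k) => ik; case: (ltnP j k) => jk; lia.
Qed.

Lemma revmx_E s : revmx *m E s *m revmx = (E s)^T.
Proof.
apply/matrixP => i j; rewrite mulmx_revmx revmx_entry [RHS]mxE !expmx_XE /= /rvn /same_block.
have := ltn_ord i; have := ltn_ord j.
case: (ltnP i k) => ik; case: (ltnP j k) => jk jn ilt.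
- have -> : (k.-1 - i <= k.-1 - j)%N = (j <= i)%N by lia.
  have -> : (k.-1 - j - (k.-1 - i) = i - j)%N by lia.
  have -> : (k.-1 - i < k)%N by lia.
  by have -> : (k.-1 - j < k)%N by lia.
- have -> : (k.-1 - i < k)%N by lia.
  have -> : (k + n.-1 - j < k)%N = false by lia.
  by rewrite !andbF.
- have -> : (k.-1 - j < k)%N by lia.
  have -> : (k + n.-1 - i < k)%N = false by lia.
  by rewrite !andbF.
- have -> : (k + n.-1 - i <= k + n.-1 - j)%N = (j <= i)%N by lia.
  have -> : (k + n.-1 - j - (k + n.-1 - i) = i - j)%N by lia.
  have -> : (k + n.-1 - i < k)%N = false by lia.
  by have -> : (k + n.-1 - j < k)%N = false by lia.
Qed.

Hypotheses (hk : (2 <= k)%N) (hl : (2 <= l)%N).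

Lemma bottom_rv i : bottom (rv i) = top i.
Proof.
rewrite /bottom /top /= /rvn; have := ltn_ord i; case: ifP => ik ilt; lia.
Qed.

Lemma top_rv i : top (rv i) = bottom i.
Proof. by rewrite -bottom_rv rvK. Qed.

(** The kernels of [K1] and [K2] are the base subspaces of the first and of the second kind
    ([mem_baseI], [mem_baseII]). *)
Definition K1 := projmx bottom.
Definition K2 := projmx (predC top).

Lemma revmx_K1 : revmx *m K1 = (1%:M - K2) *m revmx.
Proof.
apply/matrixP => i j; rewrite revmx_entry mulmx_revmx projmxC !mxE /= negbK bottom_rv.
by rewrite -(inj_eq (inv_inj rvK)) rvK.
Qed.

Lemma revmx_K2 : revmx *m K2 = (1%:M - K1) *m revmx.
Proof.
apply/matrixP => i j; rewrite revmx_entry mulmx_revmx projmxC !mxE /= top_rv.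
by rewrite -(inj_eq (inv_inj rvK)) rvK.
Qed.

Lemma top_bound i (t : 'I_n) : top t -> same_block i t -> (i <= t)%N.
Proof.
rewrite /top /same_block => /orP[] /eqP tk /eqP sb; have := ltn_ord i; last by lia.
have ik : (i < k)%N by rewrite sb; lia.
lia.
Qed.

Lemma top_unique (t t' : 'I_n) : top t -> top t' -> same_block t t' -> t = t'.
Proof.
move=> tt tt' sb; apply/val_inj; apply/eqP; rewrite eqn_leq top_bound //=.
by apply: top_bound; rewrite // /same_block eq_sym.
Qed.

Lemma expmx_top s (w : V) i (t : 'I_n) : K2 *m w = 0 -> top t -> same_block i t ->
  (E s *m w) i 0 = s ^+ (t - i) / (t - i)`!%:R * w t 0.
Proof.
move=> /projmx_ker w0 tt sb; rewrite mxE (bigD1 t) //= big1 ?addr0 => [|j jt].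
  by rewrite expmx_XE sb (top_bound tt sb).
rewrite expmx_XE; case: ifP => [/andP[_ sbj]|]; last by rewrite mul0r.
have jnt : ~~ top j.
  apply: contra jt => jt; apply/eqP/top_unique => //.
  by move: sb sbj; rewrite /same_block => /eqP -> /eqP ->.
by rewrite w0 ?mulr0.
Qed.

Lemma top_exists i : exists2 t : 'I_n, top t & same_block i t.
Proof.
have [ik|ik] := ltnP i k.
  have tn : (k.-1 < n)%N by lia.
  by exists (Ordinal tn); rewrite /top /same_block /= ?ik; lia.
have tn : (n.-1 < n)%N by lia.
by exists (Ordinal tn); rewrite /top /same_block /=; lia.
Qed.

Lemma top_pred (t : 'I_n) : top t -> exists2 i : 'I_n, i.+1 = t :> nat & same_block i t.
Proof.
rewrite /top /same_block => tt; have tn := ltn_ord t.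
have pn : (t.-1 < n)%N by lia.
by exists (Ordinal pn) => /=; move: tt => /orP[] /eqP ?; lia.
Qed.

(** If t is the last index of a block, a vector v of W_s satisfies v_{t-1} = s v_t. Two values of s
    force v_t = 0, and v_t determines the coordinates of the block. *)
Lemma capW2 (S : seq R) : uniq S -> (n <= size S)%N -> forall v : V,
  (forall s, s \in S -> memW X K2 s v) -> v = 0.
Proof.
move=> uS sS v vW.
have [s [s' [s0 s0' ss']]] : exists s s', [/\ s \in S, s' \in S & s != s'].
  case: S uS sS {vW} => [|s [|s' S]] /=; [lia|lia|].
  rewrite inE negb_or => /andP[/andP[ss' _] _] _.
  by exists s, s'; rewrite !inE eqxx eqxx orbT.
have vE r : r \in S -> v = E r *m (E (- r) *m v).
  by move=> _; rewrite mulmxA expmxKN mul1mx.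
have vt r i (t : 'I_n) : r \in S -> top t -> same_block i t ->
    v i 0 = r ^+ (t - i) / (t - i)`!%:R * (E (- r) *m v) t 0.
  by move=> rS tt sb; rewrite {1}(vE r rS) (expmx_top _ (vW r rS) tt sb).
have vtop (t : 'I_n) : top t -> v t 0 = 0.
  move=> tt; have [i it sb] := top_pred tt.
  have h r : r \in S -> v i 0 = r * v t 0.
    move=> rS; rewrite (vt r i t) // (vt r t t) // ?/same_block //.
    by rewrite subnn -it subSnn expr1 expr0 !fact0 !divr1 mul1r.
  have := h s s0; rewrite (h s' s0') => /eqP; rewrite -subr_eq0 -mulrBl mulf_eq0.
  by rewrite subr_eq0 eq_sym (negbTE ss') => /eqP.
apply/colP => i; rewrite mxE; have [t tt sb] := top_exists i.
rewrite (vt s i t) //.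
have := vt s t t s0 tt; rewrite /same_block eqxx subnn expr0 fact0 divr1 mul1r => <- //.
by rewrite vtop ?mulr0.
Qed.

Lemma bottom_exists i : exists b : 'I_n, [/\ bottom b, same_block b i & (b <= i)%N].
Proof.
have [ik|ik] := ltnP i k.
  have tn : (0 < n)%N by lia.
  by exists (Ordinal tn); rewrite /bottom /same_block /= ?ik; split=> //; lia.
have tn : (k < n)%N by lia.
by exists (Ordinal tn); rewrite /bottom /same_block /=; split=> //; lia.
Qed.

(** In each block, with first index b, the b-th coordinate of exp(-sX) v is a polynomial in -s with
    coefficients v_j / (j - b)!. Its degree is below n and it has n distinct roots. *)
Lemma capW1 (S : seq R) : uniq S -> (n <= size S)%N -> forall v : V,
  (forall s, s \in S -> memW X K1 s v) -> v = 0.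
Proof.
move=> uS sS v vW; apply/colP => i; rewrite mxE.
have [b [bb sb bi]] := bottom_exists i.
pose q (j : 'I_n) := (b <= j)%N && same_block b j.
pose p : {poly R} := \sum_(j | q j) (v j 0 / (j - b)`!%:R) *: 'X^(j - b).
have p0 : p = 0.
  apply: (@roots_geq_poly_eq0 _ p (map -%R S)).
  - apply/allP => _ /mapP[s sS' ->]; rewrite /root.
    have := vW s sS'; rewrite /memW => /projmx_ker/(_ b bb).
    rewrite mxE => H; rewrite -[X in _ == X]H horner_sum big_mkcond; apply/eqP.
    apply: eq_bigr => j _; rewrite expmx_XE -/(q j).
    case: ifP => _; last by rewrite mul0r.
    by rewrite hornerZ hornerXn; ring.
  - by rewrite map_inj_uniq //; exact: oppr_inj.
  - rewrite size_map; apply: leq_trans sS; apply: (leq_trans (size_sum _ _ _)).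
    apply/bigmax_leqP => j _; apply: (leq_trans (size_scale_leq _ _)).
    by rewrite size_polyXn; have := ltn_ord j; lia.
have := congr1 (fun r : {poly R} => r`_(i - b)) p0.
rewrite coef0 coef_sum (bigD1 i) /=; last by rewrite /q bi.
rewrite coefZ coefXn eqxx mulr1 big1 ?addr0 => [/eqP|j /andP[/andP[bj _] ji]].
  by rewrite mulf_eq0 invr_eq0 pnatr_eq0 -leqn0 leqNgt fact_gt0 orbF => /eqP.
rewrite coefZ coefXn; case: eqP => [E1|]; last by rewrite mulr0.
by case/eqP: ji; apply/val_inj => /=; lia.
Qed.

(** A proper sum of the W_s would be annihilated by a nonzero covector, found among the columns of
    the cokernel of [M], whose row space is that sum. *)
Lemma spanW_of_annihilator (K : 'M[R]_n) (S : seq R) : K *m K = K -> uniq S ->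
  (forall xi : V, (forall s, s \in S -> (E s *m (1%:M - K))^T *m xi = 0) -> xi = 0) ->
  forall v : V, exists2 c : R -> V, (forall s, memW X K s (c s)) & v = \sum_(s <- S) c s.
Proof.
move=> KK uS Sann v.
pose B (i : 'I_(size S)) := (E (tnth (in_tuple S) i) *m (1%:M - K))^T.
pose M := (\sum_i <<B i>>)%MS.
have Mfull : row_full M.
  rewrite -cokermx_eq0; apply/eqP/matrixP => i j.
  have : col j (cokermx M) = 0.
    apply: Sann => s sS.
    have iS : (index s S < size S)%N by rewrite index_mem.
    have BE : B (Ordinal iS) = (E s *m (1%:M - K))^T.
      by rewrite /B (tnth_nth 0) /= nth_index.
    have : (B (Ordinal iS) <= M)%MS.
      by rewrite -(genmxE (B _)); exact: (sumsmx_sup (Ordinal iS)).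
    rewrite submxE BE => /eqP H.
    by rewrite colE mulmxA H mul0mx.
  by move/matrixP/(_ i 0); rewrite !mxE.
have /sub_sumsmxP[u uE] : (v^T <= M)%MS by exact: submx_full.
have /choice[z zE] (i : 'I_(size S)) : exists y : 'rV[R]_n, u i *m <<B i>>%MS = y *m B i.
  by have /submxP[y ->] : (u i *m <<B i>> <= B i)%MS; [rewrite -(genmxE (B i)) submxMl|exists y].
(* Re-indexing by the position in [S]; values of s outside [S] get position [size S] and the default
   0. *)
pose z' (m : nat) := if insub m is Some i then z i else 0.
exists (fun s => E s *m ((1%:M - K) *m (z' (index s S))^T)) => [s|].
  by rewrite /memW [E (- s) *m _]mulmxA expmxNK mul1mx mulmxA mulmxBr KK mulmx1 subrr mul0mx.
apply: trmx_inj; rewrite uE (big_nth 0) big_mkord raddf_sum; apply: eq_bigr => i _.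
rewrite zE /B (tnth_nth 0) /= index_uniq // /z' insubT //= => iS.
have -> : Sub (val i) iS = i by apply/val_inj.
by rewrite !trmx_mul !trmxK mulmxA.
Qed.

(** As J X J is the transpose of X, the reversal carries the annihilator of W_s for [K] into W_{-s}
    for [K']. Sums for one curve are therefore full when intersections for the other are zero. *)
Lemma spanW_of_capW (K K' : 'M[R]_n) : K *m K = K -> revmx *m K' = (1%:M - K) *m revmx -> K^T = K ->
  (forall S : seq R, uniq S -> (n <= size S)%N -> forall v : V,
    (forall s, s \in S -> memW X K' s v) -> v = 0) ->
  forall S : seq R, uniq S -> (n <= size S)%N -> forall v : V,
    exists2 c : R -> V, (forall s, memW X K s (c s)) & v = \sum_(s <- S) c s.
Proof.
move=> KK JK Ktr cap S uS sS; apply: spanW_of_annihilator => // xi xi0.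
have H : revmx *m xi = 0.
  apply: (cap (map -%R S)); [by rewrite map_inj_uniq //; exact: oppr_inj|by rewrite size_map|].
  move=> _ /mapP[s sin ->]; rewrite /memW opprK.
  have H2 := xi0 s sin.
  have : revmx *m (revmx *m (K' *m (E s *m (revmx *m xi)))) = 0.
    rewrite [revmx *m (K' *m _)]mulmxA JK -mulmxA.
    have -> : revmx *m (E s *m (revmx *m xi)) = (E s)^T *m xi by rewrite -revmx_E !mulmxA.
    move: H2; rewrite trmx_mul linearB /= trmx1 Ktr -mulmxA => ->.
    by rewrite mulmx0.
  by rewrite mulmxA revmxK mul1mx.
by rewrite -[xi]mul1mx -revmxK -mulmxA H mulmx0.
Qed.

Lemma spanW1 (S : seq R) : uniq S -> (n <= size S)%N -> forall v : V,
  exists2 c : R -> V, (forall s, memW X K1 s (c s)) & v = \sum_(s <- S) c s.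
Proof.
apply: (spanW_of_capW (projmx_idem _) revmx_K2 (projmx_tr _)); exact: capW2.
Qed.

Lemma spanW2 (S : seq R) : uniq S -> (n <= size S)%N -> forall v : V,
  exists2 c : R -> V, (forall s, memW X K2 s (c s)) & v = \sum_(s <- S) c s.
Proof.
apply: (spanW_of_capW (projmx_idem _) revmx_K1 (projmx_tr _)); exact: capW1.
Qed.

End JordanBlocks.

(** * Topology of the Grassmannians *)

Section GrassmannTopology.
Variable R : realType.

Lemma Gr_openE n m (U : set (Gr R n m)) : open U = Gr_open U.
Proof. by []. Qed.

(** A relation that pulls open sets back to open sets behaves like the graph of a continuous map. It
    is used for the action of an invertible matrix and for orthogonality. *)
Lemma closure_transfer n m n' m' (rho : Gr R n m -> Gr R n' m' -> Prop) (S : set (Gr R n m))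
    (W : Gr R n m) (W' : Gr R n' m') :
  (forall U, Gr_open U -> Gr_open [set V | exists2 V', U V' & rho V V']) ->
  closure S W -> rho W W' -> closure [set V' | exists2 V, S V & rho V V'] W'.
Proof.
move=> rhoO clW rWW' B; rewrite nbhsE => -[U [Uo UW'] UB].
have oU' : open [set V | exists2 V', U V' & rho V V'] by exact: rhoO.
have nU' : nbhs W [set V | exists2 V', U V' & rho V V'].
  by apply: open_nbhs_nbhs; split=> //; exists W'.
have [V [SV [V' UV' rVV']]] := clW _ nU'.
by exists V'; split; [exists V|exact: UB].
Qed.

Lemma mem_colspan n m (B : 'M[R]_(n, m)) x : x \in colspan B <-> exists c, x = B *m c.
Proof.
split=> [/memv_imgP[c _ ->]|[c ->]]; first by exists c; rewrite lfunE.
by have := memv_img (linfun (mulmx B : 'cV[R]_m -> 'cV[R]_n)) (memvf c); rewrite lfunE.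
Qed.

Lemma mem_mximg n (g : 'M[R]_n) W x : x \in mximg g W <-> exists2 y, y \in W & x = g *m y.
Proof.
split=> [/memv_imgP[y yW ->]|[y yW ->]]; first by exists y; rewrite ?lfunE.
by have := memv_img (linfun (mulmx g : 'cV[R]_n -> 'cV[R]_n)) yW; rewrite lfunE.
Qed.

Lemma mximg_colspan n m (g : 'M[R]_n) (B : 'M[R]_(n, m)) : mximg g (colspan B) = colspan (g *m B).
Proof.
apply/vspaceP => x; apply/idP/idP.
  by move=> /mem_mximg[y /mem_colspan[c ->] ->]; apply/mem_colspan; exists c; rewrite mulmxA.
move=> /mem_colspan[c ->]; apply/mem_mximg; exists (B *m c); last by rewrite mulmxA.
by apply/mem_colspan; exists c.
Qed.

Lemma left_inverse_rank n m (B : 'M[R]_(n, m)) (L : 'M[R]_(m, n)) :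
  L *m B \in unitmx -> \rank B = m.
Proof.
move=> LB; apply/eqP; rewrite eqn_leq rank_leq_col /=.
by rewrite -{1}(mxrank_unit LB); exact: mxrankM_maxr.
Qed.

Lemma left_inverse_exists n m (B : 'M[R]_(n, m)) : \rank B = m ->
  exists L : 'M[R]_(m, n), L *m B = 1%:M.
Proof.
move=> rB; have : row_full B by rewrite /row_full rB.
by move=> /row_fullP[L LB]; exists L.
Qed.

Lemma vspace_frame n (U : {vspace 'cV[R]_n}) :
  exists2 B : 'M[R]_(n, \dim U), \rank B = \dim U & U = colspan B.
Proof.
pose B : 'M[R]_(n, \dim U) := \matrix_(i, j) (vbasis U)`_j i 0.
have BE c : B *m c = \sum_j c j 0 *: (vbasis U)`_j.
  apply/colP => i; rewrite mxE summxE; apply: eq_bigr => j _.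
  by rewrite !mxE mulrC.
exists B.
  rewrite -mxrank_tr; apply/eqP/inj_row_free => v vB.
  have /(congr1 trmx) := vB; rewrite trmx_mul trmxK trmx0 BE => v0.
  have /freeP/(_ _ v0) vz := basis_free (vbasisP U).
  by apply/rowP => j; have := vz j; rewrite !mxE.
apply/vspaceP => x; apply/idP/idP => [xU|].
  apply/mem_colspan; exists (\col_j coord (vbasis U) j x).
  rewrite BE {1}(coord_vbasis xU); apply: eq_bigr => j _.
  by rewrite mxE.
move=> /mem_colspan[c ->]; rewrite BE; apply: memv_suml => j _; apply: memvZ.
by apply: vbasis_mem; apply: mem_nth; rewrite size_tuple.
Qed.

Lemma frame_exists n m (W : Gr R n m) : exists2 B : 'M[R]_(n, m), \rank B = m & val W = colspan B.
Proof. by case: W => U /= /eqP dU; subst m; exact: vspace_frame. Qed.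

Definition mkGr n m (B : 'M[R]_(n, m)) (rB : \rank B = m) : Gr R n m :=
  exist _ (colspan B) (introT eqP (dim_colspan rB)).

Lemma Gr_dim n m (W : Gr R n m) : \dim (val W) = m.
Proof. exact/eqP/(valP W). Qed.

Lemma Gr_sub_eq n m (W W' : Gr R n m) : (forall x, x \in val W -> x \in val W') -> W = W'.
Proof.
move=> WW'; apply/val_inj/eqP; rewrite eqEdim !Gr_dim leqnn andbT.
by apply/subvP.
Qed.

Lemma mulmx_continuous (T : topologicalType) a b c (F : T -> 'M[R]_(a, b)) (G : T -> 'M[R]_(b, c)) :
  continuous F -> continuous G -> continuous (fun x => F x *m G x).
Proof.
move=> Fc Gc; apply: continuous_mx => i j x.
rewrite (_ : (fun x => _) = fun x => \sum_k F x i k * G x k j); last first.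
  by apply/funext => y; rewrite mxE.
apply: (cvg_bigsum (F := nbhs x)) => r.
by apply: cvgM; apply: cvg_mx_entry; [exact: Fc|exact: Gc].
Qed.

Lemma det_continuous (T : topologicalType) a (F : T -> 'M[R]_a) :
  continuous F -> continuous (fun x => \det (F x)).
Proof.
move=> Fc x; rewrite /continuous_at /determinant.
apply: (cvg_bigsum (F := nbhs x)) => s; apply: cvgM; first exact: cvg_cst.
elim: (index_enum _) => [|i r IH].
  by rewrite big_nil; under eq_fun do rewrite big_nil; exact: cvg_cst.
rewrite big_cons; under eq_fun do rewrite big_cons.
by apply: cvgM IH; apply: cvg_mx_entry; exact: Fc.
Qed.

Lemma adj_continuous (T : topologicalType) a (F : T -> 'M[R]_a) :
  continuous F -> continuous (fun x => \adj (F x)).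
Proof.
move=> Fc; apply: continuous_mx => i j.
rewrite (_ : (fun x => _) = fun x => cofactor (F x) j i); last first.
  by apply/funext => x; rewrite mxE.
move=> x; rewrite /cofactor; apply: cvgM; first exact: cvg_cst.
apply: (det_continuous (F := fun x => row' j (col' i (F x)))).
apply: continuous_mx => i' j' y; rewrite /continuous_at !mxE; under eq_fun do rewrite !mxE.
by apply: cvg_mx_entry; exact: Fc.
Qed.

Lemma mulmxl_continuous a b c (A : 'M[R]_(a, b)) : continuous (fun B : 'M[R]_(b, c) => A *m B).
Proof.
have cA : continuous (fun _ : 'M[R]_(b, c) => A) by exact: cst_continuous.
have cB : continuous (fun B : 'M[R]_(b, c) => B) by move=> B; exact: cvg_id.
exact: (mulmx_continuous cA cB).
Qed.

Lemma mulmxr_continuous a b c (A : 'M[R]_(b, c)) : continuous (fun B : 'M[R]_(a, b) => B *m A).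
Proof.
have cA : continuous (fun _ : 'M[R]_(a, b) => A) by exact: cst_continuous.
have cB : continuous (fun B : 'M[R]_(a, b) => B) by move=> B; exact: cvg_id.
exact: (mulmx_continuous cB cA).
Qed.

(** Containing two vectors on which the form is nonzero is an open condition, as is seen on frames
    with the coefficient vectors held fixed. *)
Lemma closure_bilinear n m (S : set (Gr R n m)) (M : 'M[R]_n) :
  (forall W, S W -> forall x y, x \in val W -> y \in val W -> x^T *m M *m y = 0) ->
  forall W, closure S W -> forall x y, x \in val W -> y \in val W -> x^T *m M *m y = 0.
Proof.
move=> SM W clW x y xW yW; apply/eqP/negP => /negP xMy.
pose U := [set W : Gr R n m | exists x y, [/\ x \in val W, y \in val W & x^T *m M *m y != 0]].
have oU : open U.
  rewrite Gr_openE.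
  exists (\bigcup_(cd in [set: 'cV[R]_m * 'cV[R]_m])
    [set B | (B *m cd.1)^T *m M *m (B *m cd.2) != 0]).
    apply: bigcup_open => -[c d] _ /=.
    (* The determinant reads a 1 x 1 matrix as a scalar. *)
    pose f (B : 'M[R]_(n, m)) := \det ((B *m c)^T *m M *m (B *m d)).
    have fc : continuous f.
      apply: det_continuous; apply: mulmx_continuous; last exact: mulmxr_continuous.
      apply: mulmx_continuous; last exact: cst_continuous.
      apply: continuous_mx => i j B; rewrite /continuous_at mxE; under eq_fun do rewrite mxE.
      by apply: cvg_mx_entry; exact: mulmxr_continuous.
    rewrite (_ : [set B | _] = f @^-1` [set z | z != 0]).
      apply: open_comp; first by move=> B _; exact: fc.
      exact: open_neq.
    apply/seteqP; split=> B /=; rewrite /f det_mx11; apply: contra => /eqP z0.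
      by apply/eqP/matrixP => i j; rewrite !ord1 z0 mxE.
    by rewrite z0 mxE.
  move=> B rB; split.
    move=> [[c d] _ /= Bcd]; exists (mkGr rB) => //.
    exists (B *m c), (B *m d); split=> //; apply/mem_colspan; [by exists c|by exists d].
  move=> [V [x' [y' [xV yV xy]]] VB].
  move: xV yV; rewrite VB => /mem_colspan[c cE] /mem_colspan[d dE].
  by exists (c, d) => //=; rewrite -cE -dE.
have nU : nbhs W U by apply: open_nbhs_nbhs; split=> //; exists x, y.
have [V [SV [x' [y' [xV yV /eqP]]]]] := clW _ nU.
by apply; exact: SM SV _ _ xV yV.
Qed.

Lemma Gr_open_action n m (g : 'M[R]_n) : g \in unitmx -> forall U : set (Gr R n m), Gr_open U ->
  Gr_open [set V : Gr R n m | exists2 V', U V' & val V' = mximg g (val V)].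
Proof.
move=> gu U [Q oO OU]; exists ((fun B => g *m B) @^-1` Q).
  by apply: open_comp => // B _; exact: mulmxl_continuous.
move=> B rB; have rgB : \rank (g *m B) = m.
  by rewrite -mxrank_tr trmx_mul mxrankMfree ?row_free_unit ?unitmx_tr // mxrank_tr.
split=> [OB|[V [V' UV' V'E] VB]].
  have /(OU _ rgB)[V' UV' V'E] := OB.
  by exists (mkGr rB) => //; exists V' => //; rewrite V'E mximg_colspan.
by apply/(OU _ rgB); exists V' => //; rewrite V'E VB mximg_colspan.
Qed.

Lemma closure_action n m (g : 'M[R]_n) (S : set (Gr R n m)) (W W' : Gr R n m) :
  g \in unitmx -> closure S W -> val W' = mximg g (val W) ->
  closure [set V' : Gr R n m | exists2 V, S V & val V' = mximg g (val V)] W'.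
Proof.
move=> gu; apply: (closure_transfer (rho := fun V V' : Gr R n m => val V' = mximg g (val V))).
exact: Gr_open_action.
Qed.

Lemma bilinear_entry a b (M : 'M[R]_(a, b)) i j :
  M i j = ((delta_mx i 0 : 'cV[R]_a)^T *m M *m (delta_mx j 0 : 'cV[R]_b)) 0 0.
Proof. by rewrite trmx_delta -rowE -colE !mxE. Qed.

(** * Orthogonality as a continuous correspondence between Grassmannians *)

Section Duality.
Variables (n m m' : nat) (J : 'M[R]_n).
Hypotheses (mm' : (m + m' = n)%N) (JJ : J *m J = 1%:M).

(** Only orthogonality is asked; for complementary dimensions W' is then the whole orthogonal of W
    ([dual_mem]). *)
Definition dual_to a b (W : Gr R n a) (W' : Gr R n b) :=
  forall x y, x \in val W -> y \in val W' -> x^T *m J *m y = 0.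

Lemma dual_to_sym a b (W : Gr R n a) (W' : Gr R n b) : J^T = J -> dual_to W W' -> dual_to W' W.
Proof.
move=> Jtr WW' x y xW' yW; apply: trmx_inj; rewrite !trmx_mul trmxK Jtr trmx0 mulmxA.
exact: WW'.
Qed.

Definition pairing (B : 'M[R]_(n, m)) : 'Hom('cV[R]_n, 'cV[R]_m) := linfun (mulmx (B^T *m J)).

Lemma mem_lker_pairing (B : 'M[R]_(n, m)) y : y \in lker (pairing B) <-> B^T *m J *m y = 0.
Proof. by rewrite memv_ker lfunE; split=> [/eqP|/= ->]. Qed.

Lemma dim_lker_pairing (B : 'M[R]_(n, m)) : \rank B = m -> \dim (lker (pairing B)) = m'.
Proof.
move=> rB; have img : (limg (pairing B) = fullv)%VS.
  apply/vspaceP => z; rewrite memvf; have [L LB] := left_inverse_exists rB.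
  have -> : z = pairing B (J *m L^T *m z).
    by rewrite lfunE /= !mulmxA -[B^T *m J *m J]mulmxA JJ mulmx1 -trmx_mul LB trmx1 mul1mx.
  exact: memv_img (memvf _).
have := limg_ker_dim (pairing B) fullv.
rewrite img capfv [\dim {:'cV[R]_n}]dimvf [\dim {:'cV[R]_m}]dimvf.
by rewrite /dim /= !muln1; move: (\dim (lker _)) mm' => d; lia.
Qed.

Lemma colspan_orthogonal (B : 'M[R]_(n, m)) (y : 'cV[R]_n) :
  (forall x, x \in colspan B -> x^T *m J *m y = 0) <-> B^T *m J *m y = 0.
Proof.
split=> [H|H x /mem_colspan[c ->]]; last first.
  by rewrite trmx_mul -!mulmxA [B^T *m _]mulmxA H mulmx0.
apply/colP => i; pose di : 'cV[R]_m := delta_mx i 0.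
have H0 : (B *m di)^T *m J *m y = 0 by apply: H; apply/mem_colspan; exists di.
have -> : (B^T *m J *m y) i 0 = ((B *m di)^T *m J *m y) 0 0.
  have -> : (B *m di)^T *m J *m y = di^T *m (B^T *m J *m y) by rewrite trmx_mul !mulmxA.
  by rewrite trmx_delta -rowE [RHS]mxE.
by rewrite H0 !mxE.
Qed.

Lemma dual_exists (W : Gr R n m) : exists W' : Gr R n m', dual_to W W'.
Proof.
have [B rB WB] := frame_exists W.
exists (exist _ (lker (pairing B)) (introT eqP (dim_lker_pairing rB))) => x y; rewrite WB => xB /=.
by move=> /mem_lker_pairing/colspan_orthogonal; apply.
Qed.

Lemma dual_mem (W : Gr R n m) (V : Gr R n m') y : dual_to W V ->
  y \in val V <-> forall x, x \in val W -> x^T *m J *m y = 0.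
Proof.
move=> WV; split=> [yV x xW|]; first exact: WV.
have [B rB WB] := frame_exists W; rewrite WB => /colspan_orthogonal/mem_lker_pairing.
have sub : (val V <= lker (pairing B))%VS.
  apply/subvP => z zV; apply/mem_lker_pairing/colspan_orthogonal => x.
  by rewrite -WB => xW; exact: WV.
by have /eqP <- : val V == lker (pairing B) by rewrite eqEdim sub Gr_dim dim_lker_pairing ?leqnn.
Qed.

Lemma dual_unique (W : Gr R n m) (V V' : Gr R n m') : dual_to W V -> dual_to W V' -> V = V'.
Proof.
by move=> WV WV'; apply: Gr_sub_eq => y /(dual_mem y WV) yW; exact/(dual_mem y WV').
Qed.

(* With [L] a left inverse of a frame [B0], the columns of this matrix are
   orthogonal to [B]; it is the identity on the orthogonal of [B0] for [B = B0]. *)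
Definition orthmx (L : 'M[R]_(m, n)) (B : 'M[R]_(n, m)) : 'M[R]_n :=
  \det (L *m B) *: 1%:M - L^T *m (\adj (L *m B))^T *m B^T.

Lemma orthmxP L B : B^T *m orthmx L B = 0.
Proof.
rewrite /orthmx mulmxBr -scalemxAr mulmx1 !mulmxA -trmx_mul -trmx_mul mul_adj_mx.
by rewrite tr_scalar_mx mul_scalar_mx subrr.
Qed.

Lemma orthmx_continuous L : continuous (orthmx L).
Proof.
have LBc : continuous (fun B : 'M[R]_(n, m) => L *m B) by exact: mulmxl_continuous.
have trc a b : continuous (fun B : 'M[R]_(a, b) => B^T).
  apply: continuous_mx => i j B; rewrite /continuous_at mxE; under eq_fun do rewrite mxE.
  exact: coord_continuous.
have adjc : continuous (fun B => \adj (L *m B)) by exact: adj_continuous.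
have detc : continuous (fun B => \det (L *m B)) by exact: det_continuous.
have F2 : continuous (fun B => L^T *m (\adj (L *m B))^T *m B^T).
  apply: mulmx_continuous; last exact: trc.
  apply: mulmx_continuous; first exact: cst_continuous.
  by move=> B'; exact: (cvg_comp _ _ (adjc B') (trc _ _ _)).
apply: continuous_mx => i j B; rewrite /continuous_at /orthmx.
have F2B := cvg_mx_entry (i := i) (j := j) (F2 B).
have H := cvgB (cvgM (detc B) (cvg_cst ((1%:M : 'M[R]_n) i j))) F2B.
have E1 B' : (\det (L *m B') *: 1%:M - L^T *m (\adj (L *m B'))^T *m B'^T) i j =
    \det (L *m B') * (1%:M : 'M[R]_n) i j - (L^T *m (\adj (L *m B'))^T *m B'^T) i j.
  by rewrite [LHS]mxE [X in X + _]mxE [X in _ + X]mxE.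
by rewrite E1; under eq_fun do rewrite E1; exact: H.
Qed.

(** Wherever [F L C B] has full rank, it is a frame of the orthogonal of the span of [B], and it is
    continuous in [B]. Given a frame B' of the orthogonal at one point, the choice C = J B' makes it
    equal to B' there. The union over all [L], [C] and [L2] collects these neighbourhoods, the
    determinant with [L2] certifying the rank by an open condition. *)
Lemma Gr_open_dual (U : set (Gr R n m')) : Gr_open U ->
  Gr_open [set V : Gr R n m | exists2 V', U V' & dual_to V V'].
Proof.
move=> [Q oO OU].
pose F L (C : 'M[R]_(n, m')) (B : 'M[R]_(n, m)) := J *m orthmx L B *m C.
exists (\bigcup_(x in [set: 'M[R]_(m, n) * 'M[R]_(n, m') * 'M[R]_(m', n)])
  [set B | Q (F x.1.1 x.1.2 B) /\ \det (x.2 *m F x.1.1 x.1.2 B) != 0]).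
  apply: bigcup_open => -[[L C] L2] _ /=.
  have Fc : continuous (F L C).
    apply: (mulmx_continuous (F := fun B => J *m orthmx L B)); last exact: cst_continuous.
    apply: (mulmx_continuous (F := fun=> J)); first exact: cst_continuous.
    exact: orthmx_continuous.
  apply: (@openI _ (F L C @^-1` Q) ((fun B => \det (L2 *m F L C B)) @^-1` [set z | z != 0])).
    by apply: open_comp => // B _; exact: Fc.
  apply: open_comp; last exact: open_neq.
  move=> B _; apply: det_continuous; apply: mulmx_continuous => //.
  exact: cst_continuous.
move=> B rB; split.
  move=> [[[L C] L2] _ /= [OF dF]].
  have rF : \rank (F L C B) = m'.
    by apply: (@left_inverse_rank _ _ _ L2); rewrite unitmxE unitfE.
  have [V' UV' V'E] := (OU _ rF).1 OF.
  exists (mkGr rB) => //; exists V' => // x y /mem_colspan[c ->].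
  rewrite V'E => /mem_colspan[d ->]; rewrite trmx_mul /F -!mulmxA.
  rewrite [J *m (J *m _)]mulmxA JJ mul1mx [B^T *m _]mulmxA orthmxP.
  by rewrite mul0mx mulmx0.
move=> [V [V' UV' VV'] VB].
have [B' rB' V'E] := frame_exists V'.
have [L LB] := left_inverse_exists rB.
have [L2 LB'] := left_inverse_exists rB'.
have BB' : B^T *m (J *m B') = 0.
  apply/matrixP => i j; pose di : 'cV[R]_m := delta_mx i 0; pose dj : 'cV[R]_m' := delta_mx j 0.
  have H : (B *m di)^T *m J *m (B' *m dj) = 0.
    by apply: VV'; rewrite ?VB ?V'E; apply/mem_colspan; eexists.
  have -> : (B^T *m (J *m B')) i j = ((B *m di)^T *m J *m (B' *m dj)) 0 0.
    have -> : (B *m di)^T *m J *m (B' *m dj) = di^T *m (B^T *m (J *m B')) *m dj.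
      by rewrite trmx_mul !mulmxA.
    exact: bilinear_entry.
  by rewrite H !mxE.
have FB : F L (J *m B') B = B'.
  rewrite /F /orthmx LB det1 scale1r adj1 trmx1 mulmx1.
  rewrite -mulmxA mulmxBl mul1mx -[L^T *m B^T *m _]mulmxA BB' mulmx0 subr0.
  by rewrite mulmxA JJ mul1mx.
exists ((L, J *m B'), L2) => //=; rewrite FB; split.
  by apply/(OU _ rB'); exists V'.
by rewrite LB' det1 oner_neq0.
Qed.

Lemma closure_dual (S : set (Gr R n m)) (W : Gr R n m) (W' : Gr R n m') :
  closure S W -> dual_to W W' -> closure [set V' : Gr R n m' | exists2 V, S V & dual_to V V'] W'.
Proof. exact: (closure_transfer (rho := @dual_to m m') Gr_open_dual). Qed.

End Duality.

End GrassmannTopology.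

(** * The orbit closure in Gr(2, V) *)

Lemma mem_span_delta (R : realType) n (s : seq 'I_n) (w : 'cV[R]_n) :
  w \in <<[seq (delta_mx i 0 : 'cV[R]_n)%R | i <- s]>>%VS <-> forall i, i \notin s -> w i 0 = 0.
Proof.
elim: s w => [|j s IH] w /=.
  rewrite span_nil memv0; split=> [/eqP -> i _|w0]; first by rewrite mxE.
  by apply/eqP/colP => i; rewrite w0 // mxE.
rewrite span_cons; split.
  move=> /memv_addP[_ /vlineP[c ->]] [v /IH v0 ->] i; rewrite inE negb_or => /andP[ij /v0 vi].
  by rewrite [LHS]mxE vi [X in X + _]mxE mxE (negbTE ij) mulr0 addr0.
move=> w0; apply/memv_addP; exists (w j 0 *: delta_mx j 0).
  by apply/vlineP; exists (w j 0).
exists (w - w j 0 *: delta_mx j 0); last by rewrite addrC subrK.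
apply/IH => i iNs; rewrite [LHS]mxE [X in _ + X]mxE [X in _ - X]mxE mxE eqxx andbT.
have [->|ij] := eqVneq i j; first by rewrite mulr1 subrr.
by rewrite mulr0 subr0 w0 // inE negb_or ij.
Qed.

Lemma mximg_Gr (R : realType) n m (g : 'M[R]_n) (W : Gr R n m) : g \in unitmx ->
  exists W' : Gr R n m, val W' = mximg g (val W).
Proof.
move=> gu; have [B rB WB] := frame_exists W.
have rgB : \rank (g *m B) = m.
  by rewrite -mxrank_tr trmx_mul mxrankMfree ?row_free_unit ?unitmx_tr // mxrank_tr.
by exists (mkGr rgB); rewrite WB mximg_colspan.
Qed.

Lemma mximg_mul (R : realType) n (g h : 'M[R]_n) W : mximg g (mximg h W) = mximg (g *m h) W.
Proof.
apply/vspaceP => x; apply/idP/idP.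
  by move=> /mem_mximg[_ /mem_mximg[z zW ->] ->]; apply/mem_mximg; exists z => //; rewrite mulmxA.
move=> /mem_mximg[z zW ->]; apply/mem_mximg; exists (h *m z); last by rewrite mulmxA.
by apply/mem_mximg; exists z.
Qed.

Section Curves.
Variables (R : realType) (k l : nat).
Hypotheses (hk : (2 <= k)%N) (hl : (2 <= l)%N).
Local Notation n := (k + l)%N.
Local Notation V := 'cV[R]_n.
Local Notation X := (Xmx R k l).
Local Notation E s := (expmx (s *: X)).
Local Notation K1 := (K1 R k l).
Local Notation K2 := (K2 R k l).
Local Notation J := (revmx R k l).
Implicit Types (i j a b t : 'I_n) (s r : R) (x y w : V).

Lemma mem_block_delta (p : pred 'I_k) (q : pred 'I_l) (w : V) :
  w \in <<[seq basis_e R l c | c <- enum 'I_k & p c] ++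
          [seq basis_f R k d | d <- enum 'I_l & q d]>>%VS <->
  (forall c, ~~ p c -> w (lshift l c) 0 = 0) /\ (forall d, ~~ q d -> w (rshift k d) 0 = 0).
Proof.
pose s := [seq lshift l c | c <- enum 'I_k & p c] ++ [seq rshift k d | d <- enum 'I_l & q d].
have -> : [seq basis_e R l c | c <- enum 'I_k & p c] ++ [seq basis_f R k d | d <- enum 'I_l & q d]
    = [seq (delta_mx c 0 : V) | c <- s] by rewrite map_cat -!map_comp.
have ls c : (lshift l c \in s) = p c.
  rewrite mem_cat mem_map; last exact: lshift_inj.
  rewrite mem_filter mem_enum andbT orbC; case: mapP => //= -[d _ /eqP].
  by rewrite eq_lrshift.
have rs d : (rshift k d \in s) = q d.
  rewrite mem_cat orbC mem_map; last exact: rshift_inj.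
  rewrite mem_filter mem_enum andbT orbC; case: mapP => //= -[c _ /eqP].
  by rewrite eq_rlshift.
rewrite mem_span_delta; split=> [H|[H1 H2] a].
  by split=> c pi; apply: H; rewrite ?ls ?rs.
by case: (split_ordP a) => d ->; rewrite ?ls ?rs; [exact: H1|exact: H2].
Qed.

Lemma mem_baseI w : w \in baseI R k l <-> K1 *m w = 0.
Proof.
rewrite mem_block_delta projmx_ker /bottom; split=> [[H1 H2] i|H].
  case: (split_ordP i) => j -> /=; rewrite ?addnS => jj.
    by apply: H1; have := ltn_ord j; move: jj; lia.
  by apply: H2; move: jj; lia.
split=> j jj; apply: H => /=; lia.
Qed.

Lemma mem_baseII w : w \in baseII R k l <-> K2 *m w = 0.
Proof.
rewrite mem_block_delta projmx_ker /= /top; split=> [[H1 H2] i|H].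
  case: (split_ordP i) => j -> /= jj.
    by apply: H1; move: jj; lia.
  by apply: H2; move: jj; lia.
split=> j jj; apply: H => /=; have := ltn_ord j; lia.
Qed.

Lemma mem_orbit (K : 'M[R]_n) (W0 : {vspace V}) s x : (forall w, w \in W0 <-> K *m w = 0) ->
  x \in mximg (E s) W0 <-> memW X K s x.
Proof.
move=> W0K; rewrite mem_mximg /memW; split=> [[y /W0K yW ->]|H].
  by rewrite [E (- s) *m _]mulmxA expmxNK mul1mx.
by exists (E (- s) *m x); [exact/W0K|rewrite mulmxA expmxKN mul1mx].
Qed.

Definition next i j := (j == i.+1 :> nat) && (j != k :> nat).

(* Coordinates in which the line of W_s in each block is spanned by the
   geometric progression of ratio s. *)
Definition hgt i : nat := if (i < k)%N then (k.-1 - i)%N else (n.-1 - i)%N.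
Definition ch x i : R := (hgt i)`!%:R * x i 0.

Lemma hgt_top i t : top t -> same_block k i t -> hgt i = (t - i)%N.
Proof.
rewrite /top /same_block /hgt => tt sb; have := ltn_ord t; have := ltn_ord i.
by move: tt sb; case: (ltnP i k) => ik; case: (ltnP t k) => tk //; lia.
Qed.

Lemma hgt_next a b : next a b -> hgt a = (hgt b).+1.
Proof.
rewrite /next /hgt => /andP[/eqP ba bk]; have := ltn_ord b.
by case: (ltnP a k) => ak; case: (ltnP b k) => bk'; lia.
Qed.

Lemma next_top a : ~~ top a -> exists b, next a b.
Proof.
rewrite /top /next negb_or => /andP[ak an].
have an1 : (a.+1 < n)%N by have := ltn_ord a; lia.
by exists (Ordinal an1); rewrite /= eqxx.
Qed.

Lemma next_bottom b : ~~ bottom b -> exists a, next a b.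
Proof.
rewrite /bottom /next negb_or => /andP[b0 bk].
have bn : (b.-1 < n)%N by have := ltn_ord b; lia.
by exists (Ordinal bn) => /=; lia.
Qed.

Lemma next_ntop a b : next a b -> ~~ top a.
Proof. by rewrite /top /next; have := ltn_ord b; lia. Qed.

Lemma next_same a b : next a b -> same_block k a b.
Proof. by rewrite /same_block /next; lia. Qed.

Lemma fact_neq0 (m : nat) : (m`!%:R : R) != 0.
Proof. by rewrite pnatr_eq0 -lt0n fact_gt0. Qed.

(** A vector of W_s is exp(sX) applied to a vector with top coordinates only, so within a block its
    coordinate at height h is s^h / h! times the top one; [ch] absorbs the factorial. *)
Lemma memW2P s x : memW X K2 s x <-> forall a b, next a b -> ch x a = s * ch x b.
Proof.
split=> [H a b ab|H].
  have [t tt sb] := top_exists hk hl b.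
  have sa : same_block k a t by move: (next_same ab) sb; rewrite /same_block => /eqP ->.
  have xE i : same_block k i t -> ch x i = s ^+ (hgt i) * (E (- s) *m x) t 0.
    move=> si; rewrite /ch; have -> : x = E s *m (E (- s) *m x) by rewrite mulmxA expmxKN mul1mx.
    rewrite (expmx_top hk hl s H tt si) -(hgt_top tt si).
    rewrite [E (- s) *m (E s *m _)]mulmxA expmxNK mul1mx.
    by field; exact: fact_neq0.
  by rewrite !xE // (hgt_next ab) exprS mulrA.
pose w := (1%:M - K2) *m x.
have Kw : K2 *m w = 0 by rewrite mulmxA mulmxBr mulmx1 projmx_idem subrr mul0mx.
have wt t : top t -> w t 0 = x t 0.
  by move=> tt; rewrite /w projmxC projmx_entry /= negbK tt.
suff -> : x = E s *m w by rewrite /memW [E (- s) *m _]mulmxA expmxNK mul1mx.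
apply/colP => i; have [t tt sb] := top_exists hk hl i.
rewrite (expmx_top hk hl s Kw tt sb) wt // -(hgt_top tt sb).
have chE m : forall j, same_block k j t -> hgt j = m -> ch x j = s ^+ m * x t 0.
  elim: m => [|m IH] j sj hj.
    have jt : j = t.
      apply/val_inj/eqP; rewrite eqn_leq (top_bound hk hl tt sj) /=.
      by have := hgt_top tt sj; rewrite hj; lia.
    by rewrite /ch hj jt fact0 expr0.
  have jnt : ~~ top j.
    apply/negP => /hgt_top/(_ (eqxx _)); rewrite hj; lia.
  have [b jb] := next_top jnt.
  rewrite (H _ _ jb) (IH b) ?exprS ?mulrA //; last by move: (hgt_next jb); rewrite hj => -[].
  by move: (next_same jb) sj; rewrite /same_block => /eqP ->.
have := chE _ i sb erefl; rewrite /ch => H1.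
by rewrite mulrAC -H1 mulrAC mulfV ?mul1r // fact_neq0.
Qed.

Definition pos i : nat := if (i < k)%N then nat_of_ord i else (i - k)%N.

Lemma pos_next a b : next a b -> pos b = (pos a).+1.
Proof.
rewrite /next /pos => /andP[/eqP ba bk].
by case: (ltnP a k) => ak; case: (ltnP b k) => bk'; lia.
Qed.

Definition blk i : 'I_2 := if (i < k)%N then 0 else 1.

(* A frame of W_(1/r) for r != 0, which extends continuously to r = 0. *)
Definition bframe r : 'M[R]_(n, 2) :=
  \matrix_(i, j) if j == blk i then r ^+ pos i / (hgt i)`!%:R else 0.

Lemma bframe_mul r (c : 'cV[R]_2) i : ch (bframe r *m c) i = r ^+ pos i * c (blk i) 0.
Proof.
rewrite /ch mxE (bigD1 (blk i)) //= big1 ?addr0 => [|j /negbTE ji].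
  by rewrite mxE eqxx; field; exact: fact_neq0.
by rewrite mxE ji mul0r.
Qed.

Lemma k0_lt : (0 < n)%N. Proof. lia. Qed.
Lemma kk_lt : (k < n)%N. Proof. lia. Qed.
Definition bot (j : 'I_2) : 'I_n := if j == 0 then Ordinal k0_lt else Ordinal kk_lt.

Lemma pos_bot (j : 'I_2) : pos (bot j) = 0%N.
Proof. by rewrite /pos /bot; case: (j == 0) => /=; rewrite ?ltnn ?subnn //; case: ifP. Qed.

Lemma blk_bot (j : 'I_2) : blk (bot j) = j.
Proof.
have k0 : (0 < k)%N by lia.
by case: j => -[|[|m]] jm //; rewrite /blk /bot /eq_op /= ?k0 ?ltnn; exact: val_inj.
Qed.

Lemma bframe_rank r : \rank (bframe r) = 2%N.
Proof.
pose L : 'M[R]_(2, n) := \matrix_(j, i) ((i == bot j)%:R * (hgt i)`!%:R).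
apply: (@left_inverse_rank _ _ _ _ L); suff -> : L *m bframe r = 1%:M by exact: unitmx1.
apply/matrixP => j m.
have -> : (L *m bframe r) j m = ch (bframe r *m delta_mx m 0) (bot j).
  rewrite mxE (bigD1 (bot j)) //= big1 ?addr0 => [|i ij]; last first.
    by rewrite [L _ _]mxE (negbTE ij) !mul0r.
  by rewrite [L _ _]mxE eqxx mul1r /ch -colE [in RHS]mxE.
by rewrite bframe_mul pos_bot expr0 mul1r blk_bot !mxE eqxx andbT.
Qed.

Lemma ch_inj x y : ch x =1 ch y -> x = y.
Proof. by move=> xy; apply/colP => i; apply: (mulfI (fact_neq0 (hgt i))); exact: xy. Qed.

Lemma bframe_span r x :
  (forall a b, next a b -> ch x b = r * ch x a) -> x \in colspan (bframe r).
Proof.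
move=> H; apply/mem_colspan; exists (\col_j ch x (bot j)); apply: ch_inj => i.
rewrite bframe_mul mxE.
have [m] := ubnP (i : nat); elim: m i => // m IH i im.
have [bi|/next_bottom[a ai]] := boolP (bottom i).
  have -> : bot (blk i) = i.
    move: bi; rewrite /bot /blk /bottom.
    by case: (ltnP i k) => ik bi; rewrite /eq_op /=; apply/val_inj; move: bi => /=; lia.
  have -> : pos i = 0%N.
    by move: bi; rewrite /bottom /pos; case: ifP => ik /=; lia.
  by rewrite expr0 mul1r.
have am : (a < m)%N by move: ai; rewrite /next; lia.
have <- : blk a = blk i by move: (next_same ai); rewrite /same_block /blk => /eqP ->.
by rewrite (H _ _ ai) (IH _ am) (pos_next ai) exprS mulrA.
Qed.

Lemma bframe_orbit r : r != 0 -> colspan (bframe r) = mximg (E r^-1) (baseII R k l).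
Proof.
move=> r0; apply/vspaceP => x; apply/idP/idP.
  move=> /mem_colspan[c ->]; apply/(mem_orbit _ _ mem_baseII)/memW2P => a b ab.
  rewrite !bframe_mul (pos_next ab) exprS !mulrA mulVf // mul1r.
  by move: (next_same ab); rewrite /same_block /blk => /eqP ->.
move=> /(mem_orbit _ _ mem_baseII)/memW2P H; apply: bframe_span => a b ab.
by rewrite (H _ _ ab) mulrA mulfV // mul1r.
Qed.

(** The frames [bframe] miss s = 0, so every point of the orbit is obtained by translating the one
    with s = 1. *)
Lemma orbitII_exists s : exists W : Gr R n 2, val W = mximg (E s) (baseII R k l).
Proof.
have [W WE] := mximg_Gr (mkGr (bframe_rank 1)) (expmx_unit ((s - 1) *: X)).
exists W; rewrite WE /= bframe_orbit ?oner_neq0 // invr1 mximg_mul -expmxD.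
by congr (mximg (expmx (_ *: X))); rewrite subrK.
Qed.

Lemma bframe_continuous : continuous bframe.
Proof.
apply: continuous_mx => i j r; rewrite /continuous_at mxE; under eq_fun do rewrite mxE.
case: ifP => _; last exact: cvg_cst.
by apply: cvgM; [exact: exprn_continuous|exact: cvg_cst].
Qed.

(** Since 0^0 = 1, at r = 0 exactly the entries at e_0 and f_0 survive: this plane is the limit as s
    = 1/r tends to infinity. *)
Lemma limit_gammaII : gammaII R k l (mkGr (bframe_rank 0)).
Proof.
move=> U; rewrite nbhsE => -[G [Go G0] GU].
have [Q oQ GQ] := Go.
have Q0 : Q (bframe 0) by apply/(GQ _ (bframe_rank 0)); exists (mkGr (bframe_rank 0)).
have oP : open (bframe @^-1` Q) by apply: open_comp => // r _; exact: bframe_continuous.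
have /nbhs_ballP[e e0 eP] : nbhs (0 : R) (bframe @^-1` Q) by apply: open_nbhs_nbhs.
have r0 : e / 2 != 0 by rewrite mulf_neq0 ?invr_eq0 ?pnatr_eq0 ?gt_eqF.
have /(GQ _ (bframe_rank (e / 2)))[W GW WE] : Q (bframe (e / 2)).
  apply: eP; rewrite /ball /= sub0r normrN gtr0_norm ?divr_gt0 //.
  by rewrite ltr_pdivrMr // ltr_pMr // ltr1n.
by exists W; split; [exists (e / 2)^-1; rewrite WE bframe_orbit|exact: GU].
Qed.

(* These bilinear forms vanish on every W_s, and cut out the closure of the curve in Gr(2, V). *)
Definition beta a a' b b' x y := ch x a * ch y b' - ch x a' * ch y b.

(** If some vector of W has a nonzero coordinate away from e_0 and f_0, its ratio with the preceding
    coordinate is the parameter s, and the forms impose this ratio on all of W. Otherwise W is the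
    limit plane. *)
Lemma gammaII_of_beta (W : Gr R n 2) :
  (forall a a' b b' x y, next a a' -> next b b' -> x \in val W -> y \in val W ->
     beta a a' b b' x y = 0) -> gammaII R k l W.
Proof.
move=> Wb.
have [[y [b [b' [yW bb' yb']]]]|H] := pselect (exists y b b',
    [/\ y \in val W, next b b' & ch y b' != 0]).
  have [W' W'E] := orbitII_exists (ch y b / ch y b').
  suff -> : W = W' by apply: subset_closure; exists (ch y b / ch y b').
  apply: Gr_sub_eq => x xW; rewrite W'E; apply/(mem_orbit _ _ mem_baseII)/memW2P => a a' aa'.
  have /eqP := Wb a a' b b' x y aa' bb' xW yW; rewrite subr_eq0 => /eqP xy.
  by apply: (mulIf yb'); rewrite xy; field.
suff -> : W = mkGr (bframe_rank 0) by exact: limit_gammaII.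
apply: Gr_sub_eq => x xW; apply: bframe_span => a b ab; rewrite mul0r.
by apply/eqP/negP => /negP xb; apply: H; exists x, a, b.
Qed.

End Curves.

(** * Symmetry algebras of the curves *)

Section CongruenceFlow.
Variables (R : realType) (n : nat) (A : 'M[R]_n).

(** The derivative at t = 0 of the bilinear form [M] pulled back by exp(tA). *)
Definition congruence_deriv : {linear 'M[R]_n -> 'M[R]_n} := mulmx A^T \+ mulmxr A.

Lemma is_diff_mxvec_tr (F dF : R -> 'M[R]_n) (t : R) :
  is_diff t F dF -> is_diff t (fun s => (mxvec (F s))^T) (fun h => (mxvec (dF h))^T).
Proof.
move=> FD; apply: is_diff_mx => i j; case/mxvec_indexP: i => a b.
have mE (Z : 'M[R]_n) : (mxvec Z)^T (mxvec_index a b) j = Z a b.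
  by rewrite -[RHS]mxvecE [LHS]mxE ord1.
under eq_fun do rewrite mE.
by apply: (is_diff_eq (is_diff_entry a b FD)); apply/funext => h; rewrite mE.
Qed.

Lemma is_diff_congruence (M : 'M[R]_n) (t : R) :
  is_diff t (fun s : R => (expmx (s *: A))^T *m M *m expmx (s *: A))
    (fun h => h *: congruence_deriv ((expmx (t *: A))^T *m M *m expmx (t *: A))).
Proof.
have dE : is_diff t (fun s => expmx (s *: A)) (fun h => h *: (expmx (t *: A) *m A)).
  apply: (is_diff_eq (is_diff_expmx A t)); apply/funext => h; congr (_ *: _).
  exact: expmxZ_comm.
have dT := is_diff_trmx dE.
have := is_diff_mulmx (is_diff_mulmx dT (is_diff_const M t)) dE.
move=> H; apply: (is_diff_eq H); apply/funext => h /=.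
rewrite linearZ /= trmx_mul mulmx0 addr0 -!scalemxAl -!scalemxAr -scalerDr.
by rewrite !mulmxA.
Qed.

Lemma congruence_form (g M : 'M[R]_n) (x y : 'cV[R]_n) :
  x^T *m (g^T *m M *m g) *m y = (g *m x)^T *m M *m (g *m y).
Proof. by rewrite trmx_mul !mulmxA. Qed.

(** The pulled-back form solves a linear differential equation in the space of matrices, flattened
    to columns. It is thus an exponential series in the iterated derivatives of [M], to which
    [expmx_limit_pred] applies. *)
Lemma congruence_flow (M : 'M[R]_n) (x y : 'cV[R]_n) :
  (forall r, x^T *m iter r congruence_deriv M *m y = 0) ->
  forall t, x^T *m ((expmx (t *: A))^T *m M *m expmx (t *: A)) *m y = 0.
Proof.
move=> Mr t.
pose Y s := (mxvec ((expmx (s *: A))^T *m M *m expmx (s *: A)))^T.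
pose G := (lin_mx congruence_deriv)^T.
have GE (Z : 'M[R]_n) : G *m (mxvec Z)^T = (mxvec (congruence_deriv Z))^T.
  by rewrite -trmx_mul mul_vec_lin.
have dY s : is_diff s Y (fun h => h *: (G *m Y s)).
  apply: (is_diff_eq (is_diff_mxvec_tr (is_diff_congruence M s))); apply/funext => h.
  by rewrite /Y GE !linearZ.
have Yt := mx_linear_ode_unique dY t.
have Y0 : Y 0 = (mxvec M)^T.
  by rewrite /Y scale0r expmx0 trmx1 mul1mx mulmx1.
have dotE Z : mxvec (x *m y^T) *m (mxvec Z)^T = x^T *m Z *m y.
  by have := mxvec_dotmul Z x^T y^T; rewrite !trmxK.
rewrite -dotE -/(Y t) Yt.
pose g : {linear 'M[R]_(n * n) -> 'M[R]_(1, 1)} := mulmx (mxvec (x *m y^T)) \o mulmxr (Y 0).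
apply: (expmx_limit_pred (g := g)) => r; rewrite /= Y0.
have -> : (t *: G) ^+ r *m (mxvec M)^T = t ^+ r *: (mxvec (iter r congruence_deriv M))^T.
  rewrite exprZmx -scalemxAl; congr (_ *: _).
  elim: r => [|r IH]; first by rewrite expr0 mul1mx.
  by rewrite exprS -mulmxE -mulmxA IH GE.
by rewrite -scalemxAr dotE Mr scaler0.
Qed.

End CongruenceFlow.

(** Inclusion for all t gives equality, since exp(-tA) is the inverse of exp(tA). *)
Lemma lie_stabilizerP (R : realType) n m (gamma : set (Gr R n m)) (A : 'M[R]_n) :
  lie_algebra_of (stabilizer gamma) A <-> forall (t : R) W, gamma W ->
    exists2 W', gamma W' & val W' = mximg (expmx (t *: A)) (val W).
Proof.
split=> [H t W gW|H t].
  have [_ Ht] := H t.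
  have : [set mximg (expmx (t *: A)) (val W) | W in gamma] (mximg (expmx (t *: A)) (val W)).
    by exists W.
  by rewrite Ht => -[W' gW' E]; exists W'.
split; first exact: expmx_unit.
apply/seteqP; split=> [_ [W gW <-]|_ [W gW <-]].
  by have [W' gW' <-] := H t W gW; exists W'.
have [W' gW' W'E] := H (- t) W gW; exists W' => //.
rewrite W'E mximg_mul expmxKN; apply/vspaceP => x; apply/idP/idP.
  by move=> /mem_mximg[y yW ->]; rewrite mul1mx.
by move=> xW; apply/mem_mximg; exists x; rewrite ?mul1mx.
Qed.

Lemma closure_sub_closure (T : topologicalType) (A B : set T) :
  A `<=` closure B -> closure A `<=` closure B.
Proof.
by move=> AB; rewrite [X in _ `<=` X](closure_id _).1; [exact: closureS|exact: closed_closure].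
Qed.

(** * The second kind: bilinear forms vanishing on the curve *)

Section SymmetryII.
Variables (R : realType) (k l : nat).
Hypotheses (hk : (2 <= k)%N) (hl : (2 <= l)%N).
Local Notation n := (k + l)%N.
Local Notation V := 'cV[R]_n.
Local Notation X := (Xmx R k l).
Local Notation E s := (expmx (s *: X)).
Local Notation K2 := (K2 R k l).
Local Notation inW := (@memW R n X K2).
Implicit Types (i j a b : 'I_n) (s t r : R) (x y w : V) (A M : 'M[R]_n).

Definition curve_form M := forall s x y, inW s x -> inW s y -> x^T *m M *m y = 0.

Definition beta_mx a a' b b' : 'M[R]_n :=
  ((hgt a)`!%:R * (hgt b')`!%:R) *: delta_mx a b' -
  ((hgt a')`!%:R * (hgt b)`!%:R) *: delta_mx a' b.

Lemma delta_form a b x y : x^T *m delta_mx a b *m y = (x a 0 * y b 0)%:M.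
Proof.
apply/matrixP => i j; rewrite !ord1 -(mul_delta_mx (0 : 'I_1)) mulmxA -mulmxA.
rewrite -colE -rowE [LHS]mxE big_ord1 !mxE eqxx.
by rewrite mulr1n.
Qed.

Lemma beta_mxE a a' b b' x y : x^T *m beta_mx a a' b b' *m y =
  (beta a a' b b' x y)%:M.
Proof.
rewrite /beta_mx mulmxBr mulmxBl -!scalemxAr -!scalemxAl !delta_form.
apply/matrixP => i j; rewrite !ord1 !mxE eqxx !mulr1n /beta /ch; ring.
Qed.

Lemma beta_curve_form a a' b b' : next a a' -> next b b' -> curve_form (beta_mx a a' b b').
Proof.
move=> aa' bb' s x y /memW2P Hx /memW2P Hy; rewrite beta_mxE /beta.
rewrite (Hx hk hl _ _ aa') (Hy hk hl _ _ bb').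
by rewrite (_ : _ - _ = 0) ?raddf0 //; ring.
Qed.

Lemma memW_shift s r x : inW s x -> inW (s + r) (E r *m x).
Proof.
rewrite /memW => H.
by have -> : E (- (s + r)) *m (E r *m x) = E (- s) *m x by rewrite mulmxA -expmxD opprD subrK.
Qed.

Lemma curve_form_shift M r : curve_form M -> curve_form ((E r)^T *m M *m E r).
Proof.
move=> MW s x y xW yW.
rewrite congruence_form.
by apply: (MW (s + r)); exact: memW_shift.
Qed.

Lemma curve_form_gammaII M (W : Gr R n 2) x y : curve_form M -> gammaII R k l W ->
  x \in val W -> y \in val W -> x^T *m M *m y = 0.
Proof.
move=> MW gW xW yW; apply: (closure_bilinear _ gW xW yW) => W' [s WE] x' y'; rewrite WE.
by move=> /(mem_orbit _ _ (mem_baseII hk hl)) x'W /(mem_orbit _ _ (mem_baseII hk hl)); exact: MW.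
Qed.

(** A space of forms stable under the derivation is stable under the flow by [congruence_flow]. The
    [beta_mx] are among the curve forms and detect the closed curve by [gammaII_of_beta], so the
    flow sends the orbit, and then its closure, into it. *)
Lemma gammaII_flow A (t : R) : (forall M, curve_form M -> curve_form (congruence_deriv A M)) ->
  forall W, gammaII R k l W ->
    exists2 W', gammaII R k l W' & val W' = mximg (expmx (t *: A)) (val W).
Proof.
move=> cf; pose g := expmx (t *: A).
have cfg M : curve_form M -> curve_form (g^T *m M *m g).
  move=> cM s x y xW yW; apply: congruence_flow => r.
  suff : curve_form (iter r (congruence_deriv A) M) by apply; [exact: xW|exact: yW].
  by elim: r => [|r IH] //=; exact: cf.
move=> W gW; have [W' W'E] := mximg_Gr W (expmx_unit (t *: A)); exists W' => //.
have := closure_action (expmx_unit (t *: A)) gW W'E.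
apply: closure_sub_closure => W1 [V [s VE] W1E].
apply: gammaII_of_beta => // a a' b b' x y aa' bb'; rewrite W1E VE.
move=> /mem_mximg[x' /(mem_orbit _ _ (mem_baseII hk hl)) xW ->].
move=> /mem_mximg[y' /(mem_orbit _ _ (mem_baseII hk hl)) yW ->].
have := cfg _ (beta_curve_form aa' bb') s x' y' xW yW.
rewrite congruence_form beta_mxE => /(congr1 (fun Z : 'M[R]_1 => Z 0 0)).
by rewrite !mxE eqxx mulr1n.
Qed.

Lemma form_deriv A M s w w' (B : 'M[R]_n) : B = E (- s) *m A *m E s ->
  (E s *m w)^T *m congruence_deriv A ((E (- s))^T *m M *m E (- s)) *m (E s *m w') =
  (B *m w)^T *m M *m w' + w^T *m M *m (B *m w').
Proof.
move=> ->; rewrite /congruence_deriv /= mulmxDr mulmxDl !trmx_mul !mulmxA.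
have EE : (E s)^T *m (E (- s))^T = 1%:M by rewrite -trmx_mul expmxNK trmx1.
congr (_ + _).
  by rewrite -!mulmxA [E (- s) *m (E s *m _)]mulmxA expmxNK mul1mx.
by rewrite -[w^T *m (E s)^T *m _]mulmxA EE mulmx1.
Qed.

Lemma K2_delta (t : 'I_n) : top t -> K2 *m (delta_mx t 0 : V) = 0.
Proof.
move=> tt; apply/projmx_ker => i /= it; rewrite mxE eqxx andbT.
by case: eqP it => // ->; rewrite tt.
Qed.

Lemma ch_ker w a : K2 *m w = 0 -> ~~ top a -> ch w a = 0.
Proof. by move=> /projmx_ker Kw ta; rewrite /ch Kw ?mulr0. Qed.

Lemma Xmul_next a b w : next a b -> (X *m w) a 0 = w b 0.
Proof.
rewrite /next => /andP[/eqP ab bk]; rewrite mxE (bigD1 b) //= big1 ?addr0 => [|i ib].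
  by rewrite XmxE ab eqxx -ab bk mul1r.
rewrite XmxE; case: eqP => [E1|]; last by rewrite mul0r.
by case/eqP: ib; apply/val_inj; rewrite /= E1 ab.
Qed.

(* Pairing with the last vector of the first block isolates the coefficient of X. *)
Lemma infsym_of_forms A : (forall s M w w', curve_form M -> K2 *m w = 0 -> K2 *m w' = 0 ->
    (E (- s) *m A *m E s *m w)^T *m M *m w' + w^T *m M *m (E (- s) *m A *m E s *m w') = 0) ->
  infsym X K2 A.
Proof.
move=> AM s; pose B := E (- s) *m A *m E s.
have t0n : (k.-1 < n)%N by lia.
have p0n : (k.-2 < n)%N by lia.
pose t0 : 'I_n := Ordinal t0n; pose p0 : 'I_n := Ordinal p0n.
have tt0 : top t0 by rewrite /top /=; lia.
have pt0 : next p0 t0 by rewrite /next /=; lia.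
have ht0 : hgt t0 = 0%N by rewrite /hgt /=; case: ifP; lia.
pose e : V := delta_mx t0 0; have Ke := K2_delta tt0.
have che : ch e t0 = 1 by rewrite /ch ht0 fact0 mul1r mxE !eqxx.
exists (ch (B *m e) p0) => w Kw.
have BE v : E (- s) *m (A *m (E s *m v)) = B *m v by rewrite !mulmxA.
rewrite BE; apply/projmx_ker => a /= ta; have [b ab] := next_top hk hl ta.
have := AM s _ w e (beta_curve_form ab pt0) Kw Ke.
rewrite -/B !beta_mxE => H0.
have {}H0 : beta a b p0 t0 (B *m w) e + beta a b p0 t0 w (B *m e) = 0.
  by have := congr1 (fun Z : 'M[R]_1 => Z 0 0) H0; rewrite !mxE eqxx !mulr1n.
move: H0; rewrite /beta che (ch_ker Kw ta) (ch_ker Ke (next_ntop hk hl pt0)).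
rewrite mulr1 mulr0 mul0r subr0 sub0r.
move=> /eqP; rewrite subr_eq0 => /eqP H.
have E1 : (B *m w) a 0 = ch (B *m e) p0 * w b 0.
  apply: (mulfI (fact_neq0 R (hgt a))); rewrite -/(ch (B *m w) a) H /ch.
  (* If [b] is a top index, the heights of [a] and [b] are 1 and 0 and all factorials are 1;
     otherwise both sides vanish. *)
  have [tb|tb] := boolP (top b).
    have hb : hgt b = 0%N by have := hgt_top hk hl tb (eqxx _); rewrite subnn.
    by rewrite (hgt_next hk hl ab) hb /= !fact0 !factS !fact0 muln1 !mul1r mulrC.
  by rewrite ((projmx_ker _ _).1 Kw b tb) !mulr0 mul0r.
have subE (u v : V) (c : R) : (u - c *: v) a 0 = u a 0 - c * v a 0 by rewrite !mxE.
by rewrite subE (Xmul_next w ab) E1 subrr.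
Qed.

Lemma is_diff_exp_vec (w : V) (r : R) :
  is_diff r (fun s : R => E s *m w) (fun h => h *: (X *m (E r *m w))).
Proof.
apply: (is_diff_eq (is_diff_mulmx (is_diff_expmx X r) (is_diff_const w r))).
by apply/funext => h; rewrite mulmx0 addr0 -scalemxAl mulmxA.
Qed.

(** The derivative in s of the vanishing of [M] on the pair exp(sX) w, exp(sX) w'. *)
Lemma curve_form_X M s x y : curve_form M -> inW s x -> inW s y ->
  (X *m x)^T *m M *m y + x^T *m M *m (X *m y) = 0.
Proof.
move=> MW xW yW; pose w := E (- s) *m x; pose w' := E (- s) *m y.
have xE : x = E s *m w by rewrite mulmxA expmxKN mul1mx.
have yE : y = E s *m w' by rewrite mulmxA expmxKN mul1mx.
have f0 : (fun r : R => (E r *m w)^T *m M *m (E r *m w')) = fun=> 0.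
  by apply/funext => r; apply: (MW r); exact: memW_exp.
have D1 := is_diff_mulmx (is_diff_mulmx (is_diff_trmx (is_diff_exp_vec w s)) (is_diff_const M s))
  (is_diff_exp_vec w' s).
have := is_diff_derive (1 : R) D1; rewrite f0 => H1.
have := esym H1; rewrite (is_diff_derive (1 : R) (is_diff_const (0 : 'M[R]_1) s)).
by rewrite !scale1r mulmx0 addr0 -xE -yE.
Qed.

(** On W_s the operator [A] is a multiple of X plus a map into W_s, where [M] vanishes; the multiple
    of X contributes nothing by [curve_form_X]. *)
Lemma infsym_curve_form A M : infsym X K2 A -> curve_form M -> curve_form (congruence_deriv A M).
Proof.
move=> AI MW s x y xW yW; have [a H] := AI s.
have AE z : inW s z -> exists2 z1, inW s z1 & A *m z = a *: (X *m z) + z1.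
  move=> zW; exists (A *m z - a *: (X *m z)); last by rewrite addrC subrK.
  have zE : z = E s *m (E (- s) *m z) by rewrite mulmxA expmxKN mul1mx.
  have := H (E (- s) *m z) zW; rewrite -zE /memW => <-; congr (_ *m _).
  rewrite mulmxBr -scalemxAr; congr (_ - _ *: _).
  by rewrite mulmxA expmxZ_comm -mulmxA.
have [x1 x1W xE] := AE x xW; have [y1 y1W yE] := AE y yW.
have -> : x^T *m congruence_deriv A M *m y = (A *m x)^T *m M *m y + x^T *m M *m (A *m y).
  by rewrite /congruence_deriv /= mulmxDr mulmxDl trmx_mul !mulmxA.
rewrite xE yE linearD linearZ /= mulmxDr -scalemxAr mulmxDl mulmxDl -!scalemxAl.
rewrite (MW s x1 y) // (MW s x y1) // !addr0 -scalerDr (curve_form_X MW xW yW).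
exact: scaler0.
Qed.

(** The shifted form [N] vanishes on exp(tA) W_s for every t, since this subspace stays in the
    closed curve; the claim is the derivative at t = 0. *)
Lemma symII_forms A s M w w' : symII R k l A -> curve_form M -> K2 *m w = 0 -> K2 *m w' = 0 ->
  (E (- s) *m A *m E s *m w)^T *m M *m w' + w^T *m M *m (E (- s) *m A *m E s *m w') = 0.
Proof.
move=> /lie_stabilizerP As MW Kw Kw'.
pose N := (E (- s))^T *m M *m E (- s).
have NW : curve_form N by exact: curve_form_shift.
pose x := E s *m w; pose y := E s *m w'.
have [W WE] := orbitII_exists hk hl s.
have gW : gammaII R k l W by apply: subset_closure; exists s.
have xW : x \in val W by rewrite WE; apply/(mem_orbit _ _ (mem_baseII hk hl)); exact: memW_exp.
have yW : y \in val W by rewrite WE; apply/(mem_orbit _ _ (mem_baseII hk hl)); exact: memW_exp.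
have f0 t : x^T *m ((expmx (t *: A))^T *m N *m expmx (t *: A)) *m y = 0.
  have [W' gW' W'E] := As t W gW.
  have -> : x^T *m ((expmx (t *: A))^T *m N *m expmx (t *: A)) *m y =
      (expmx (t *: A) *m x)^T *m N *m (expmx (t *: A) *m y) by exact: congruence_form.
  by apply: (curve_form_gammaII NW gW'); rewrite W'E; apply/mem_mximg; [exists x|exists y].
have D1 := is_diff_mulmx (is_diff_mulmx (is_diff_const x^T 0) (is_diff_congruence A N 0))
  (is_diff_const y 0).
have := is_diff_derive (1 : R) D1; under eq_fun do rewrite f0.
rewrite (is_diff_derive (1 : R) (is_diff_const (0 : 'M[R]_1) (0 : R))) mulmx0 addr0 mul0mx add0r.
rewrite scale1r scale0r expmx0 trmx1 mul1mx mulmx1 => H.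
rewrite -(form_deriv M w w' (erefl (E (- s) *m A *m E s))); exact: esym H.
Qed.

Theorem symII_infsym : symII R k l = [set A | infsym X K2 A].
Proof.
apply/seteqP; split=> A /= H.
  by apply: (@infsym_of_forms A) => s M w w' MW Kw Kw'; exact: symII_forms H MW Kw Kw'.
apply/lie_stabilizerP => t W gW.
by apply: (@gammaII_flow A t _ W gW) => M; exact: infsym_curve_form.
Qed.

End SymmetryII.

Lemma expmx_adjoint (R : realType) n (J A : 'M[R]_n) : J *m J = 1%:M -> forall t : R,
  expmx (t *: (- (J *m A^T *m J))) = J *m (expmx (- t *: A))^T *m J.
Proof.
move=> JJ t; pose Y (s : R) := J *m (expmx (- s *: A))^T *m J.
have dY s : is_diff s Y (fun h => h *: (- (J *m A^T *m J) *m Y s)).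
  have D1 := is_diff_mulmx (is_diff_mulmxr J (is_diff_trmx (is_diff_expmxN A s))) (is_diff_const J s).
  apply: (is_diff_eq D1); apply/funext => h.
  rewrite mulmx0 addr0 linearZ /= trmx_mul -scalemxAr -scalemxAl scaleNr -scalerN; congr (_ *: _).
  rewrite /Y mulNmx; congr (- _); rewrite !mulmxA; congr (_ *m _ *m _).
  by rewrite -!mulmxA JJ mulmx1.
rewrite -[RHS]/(Y t) (mx_linear_ode_unique dY t).
by rewrite /Y oppr0 scale0r expmx0 trmx1 mulmx1 JJ mulmx1.
Qed.

(** * The first kind, by duality *)

Section SymmetryI.
Variables (R : realType) (k l : nat).
Hypotheses (hk : (2 <= k)%N) (hl : (2 <= l)%N).
Local Notation n := (k + l)%N.
Local Notation V := 'cV[R]_n.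
Local Notation X := (Xmx R k l).
Local Notation E s := (expmx (s *: X)).
Local Notation K1 := (K1 R k l).
Local Notation K2 := (K2 R k l).
Local Notation J := (revmx R k l).
Implicit Types (s t r : R) (x y w : V) (A M : 'M[R]_n).

Let Jtr : J^T = J. Proof. exact: revmx_tr. Qed.
Let JJ : J *m J = 1%:M. Proof. exact: revmxK. Qed.

(** For the pairing [J] the operator exp(sX) is self-adjoint, so [y] is orthogonal to exp(sX)(ker K)
    when exp(sX) y is orthogonal to ker K; by the relations with [J], the orthogonal of ker K is ker
    K'. *)
Lemma annihilator_memW (K K' : 'M[R]_n) s y : K *m K = K -> K^T = K ->
  J *m K = (1%:M - K') *m J -> J *m K' = (1%:M - K) *m J ->
  (forall x, memW X K s x -> x^T *m J *m y = 0) <-> memW X K' (- s) y.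
Proof.
move=> KK Ktr JK JK'.
have xE x z : (E s *m x)^T *m J *m z = x^T *m J *m (E (- - s) *m z).
  rewrite trmx_mul -revmx_E opprK !mulmxA; congr (_ *m _).
  by rewrite -!mulmxA JJ mulmx1 !mulmxA.
rewrite /memW; split=> [H|H x xW].
  set z := E (- - s) *m y.
  suff : J *m (K' *m z) = 0.
    by move=> H0; rewrite -[K' *m z]mul1mx -JJ -mulmxA H0 mulmx0.
  rewrite mulmxA JK' -mulmxA; apply/matrixP => i j; rewrite ord1 [RHS]mxE.
  have := H (E s *m ((1%:M - K) *m delta_mx i 0)).
  rewrite xE -/z expmx_cancel mulmxA mulmxBr mulmx1 KK subrr mul0mx => /(_ erefl).
  rewrite trmx_mul linearB /= trmx1 Ktr trmx_delta -!mulmxA -rowE => /(congr1 (fun Z : 'M[R]_1 => Z 0 0)).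
  by rewrite [LHS]mxE [RHS]mxE.
have -> : x = E s *m (E (- s) *m x) by rewrite mulmxA expmxKN mul1mx.
rewrite xE; set z := E (- - s) *m y; set w := E (- s) *m x.
have Kw : w = (1%:M - K) *m w by rewrite mulmxBl mul1mx xW subr0.
rewrite Kw trmx_mul linearB /= trmx1 Ktr -!mulmxA [(1%:M - K) *m _]mulmxA -JK' -mulmxA H.
by rewrite !mulmx0.
Qed.

Let idem1 : K1 *m K1 = K1. Proof. exact: projmx_idem. Qed.
Let idem2 : K2 *m K2 = K2. Proof. exact: projmx_idem. Qed.
Let tr1 : K1^T = K1. Proof. exact: projmx_tr. Qed.
Let tr2 : K2^T = K2. Proof. exact: projmx_tr. Qed.

Let n2 : (2 + (n - 2) = n)%N. Proof. lia. Qed.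
Let n2' : (n - 2 + 2 = n)%N. Proof. lia. Qed.

(** Orthogonality exchanges the two orbits, reversing s, and respects closures by [closure_dual]. *)
Lemma gammaII_dual (W : Gr R n 2) (W' : Gr R n (n - 2)) :
  dual_to J W W' -> gammaII R k l W -> gammaI R k l W'.
Proof.
move=> WW' gW; have := closure_dual JJ gW WW'.
apply: closure_sub_closure => V' [V0 [s VE] VV']; apply: subset_closure; exists (- s).
apply/vspaceP => y; apply/idP/idP.
  move=> /(dual_mem n2 JJ _ VV') H; apply/(mem_orbit _ _ (mem_baseI hk hl)).
  apply/(annihilator_memW s y idem2 tr2 (revmx_K2 R hk hl) (revmx_K1 R hk hl)) => x xW.
  by apply: H; rewrite VE; apply/(mem_orbit _ _ (mem_baseII hk hl)).
move=> /(mem_orbit _ _ (mem_baseI hk hl)).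
move=> /(annihilator_memW s y idem2 tr2 (revmx_K2 R hk hl) (revmx_K1 R hk hl)) H.
apply/(dual_mem n2 JJ _ VV') => x; rewrite VE => /(mem_orbit _ _ (mem_baseII hk hl)); exact: H.
Qed.

Lemma gammaI_dual (W : Gr R n (n - 2)) (W' : Gr R n 2) :
  dual_to J W W' -> gammaI R k l W -> gammaII R k l W'.
Proof.
move=> WW' gW; have := closure_dual JJ gW WW'.
apply: closure_sub_closure => V' [V0 [s VE] VV']; apply: subset_closure; exists (- s).
apply/vspaceP => y; apply/idP/idP.
  move=> /(dual_mem n2' JJ _ VV') H; apply/(mem_orbit _ _ (mem_baseII hk hl)).
  apply/(annihilator_memW s y idem1 tr1 (revmx_K1 R hk hl) (revmx_K2 R hk hl)) => x xW.
  by apply: H; rewrite VE; apply/(mem_orbit _ _ (mem_baseI hk hl)).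
move=> /(mem_orbit _ _ (mem_baseII hk hl)).
move=> /(annihilator_memW s y idem1 tr1 (revmx_K1 R hk hl) (revmx_K2 R hk hl)) H.
apply/(dual_mem n2' JJ _ VV') => x; rewrite VE => /(mem_orbit _ _ (mem_baseI hk hl)); exact: H.
Qed.

(** Minus the adjoint for the pairing [J], that is, the contragredient operator. *)
Definition adjoint A := - (J *m A^T *m J).

Lemma adjointK A : adjoint (adjoint A) = A.
Proof.
rewrite /adjoint linearN /= mulmxN mulNmx opprK !trmx_mul trmxK Jtr !mulmxA JJ mul1mx.
by rewrite -mulmxA JJ mulmx1.
Qed.

(* The flow of [adjoint A] is contragredient to that of [A] for the pairing [J]. *)
Lemma dual_flow A t a b (W : Gr R n a) (W1 : Gr R n a) (V0 V1 : Gr R n b) : (a + b = n)%N ->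
  dual_to J W V0 -> dual_to J W1 V1 -> val W1 = mximg (expmx (t *: A)) (val W) ->
  val V1 = mximg (expmx (t *: adjoint A)) (val V0).
Proof.
move=> ab WV WV1 W1E; have [Z ZE] := mximg_Gr V0 (expmx_unit (t *: adjoint A)).
rewrite -ZE; congr val; apply: (dual_unique ab JJ WV1) => x y; rewrite W1E ZE.
move=> /mem_mximg[x' xW ->] /mem_mximg[y' yV ->].
rewrite expmx_adjoint // trmx_mul -!mulmxA [J *m (J *m _)]mulmxA JJ mul1mx.
rewrite [(expmx (t *: A))^T *m _]mulmxA -trmx_mul expmxNK trmx1 mul1mx mulmxA.
exact: WV.
Qed.

Lemma symI_adjoint A : symI R k l A <-> symII R k l (adjoint A).
Proof.
split=> /lie_stabilizerP H; apply/lie_stabilizerP => t W gW.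
  have [V0 WV] := dual_exists n2 JJ W.
  have gV := gammaII_dual WV gW.
  have [V1 gV1 V1E] := H t V0 gV.
  have [W1 VW1] := dual_exists n2' JJ V1.
  exists W1; first exact: gammaI_dual VW1 gV1.
  exact: dual_flow n2' (dual_to_sym Jtr WV) VW1 V1E.
have [V0 WV] := dual_exists n2' JJ W.
have gV := gammaI_dual WV gW.
have [V1 gV1 V1E] := H t V0 gV.
have [W1 VW1] := dual_exists n2 JJ V1.
exists W1; first exact: gammaII_dual VW1 gV1.
by rewrite -[A]adjointK; exact: dual_flow n2 (dual_to_sym Jtr WV) VW1 V1E.
Qed.

Lemma infsym_mx (K A : 'M[R]_n) : K *m K = K -> infsym X K A <->
  forall s, exists a : R, K *m (E (- s) *m A *m E s - a *: X) *m (1%:M - K) = 0.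
Proof.
move=> KK; split=> H s; have [a Ha] := H s; exists a.
  apply/matrixP => i j; have := Ha ((1%:M - K) *m delta_mx j 0).
  rewrite mulmxA mulmxBr mulmx1 KK subrr mul0mx => /(_ erefl) H0.
  have -> : (K *m (E (- s) *m A *m E s - a *: X) *m (1%:M - K)) i j =
     (K *m (E (- s) *m A *m E s - a *: X) *m (1%:M - K) *m (delta_mx j 0 : V)) i 0.
    by rewrite -colE [RHS]mxE.
  rewrite -mulmxA -mulmxA mulmxBl -scalemxAl.
  by rewrite -!mulmxA in H0 *; rewrite H0 !mxE.
move=> w Kw; have wE : w = (1%:M - K) *m w by rewrite mulmxBl mul1mx Kw subr0.
have -> : E (- s) *m (A *m (E s *m w)) - a *: (X *m w) = (E (- s) *m A *m E s - a *: X) *m w.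
  by rewrite mulmxBl -scalemxAl !mulmxA.
by rewrite wE mulmxA mulmxA Ha mul0mx.
Qed.

(** Transposing and conjugating by [J] exchanges source and quotient in the condition of
    [infsym_mx], fixes X and reverses s. The multiple alpha(s) becomes -alpha(-s). *)
Lemma infsym_adjoint (K K' A : 'M[R]_n) : K *m K = K -> K' *m K' = K' -> K^T = K -> K'^T = K' ->
  J *m K = (1%:M - K') *m J -> J *m K' = (1%:M - K) *m J ->
  infsym X K A -> infsym X K' (adjoint A).
Proof.
move=> KK KK' Ktr Ktr' JK JK' /(infsym_mx _ KK) H; apply/(infsym_mx _ KK') => s.
have [a Ha] := H (- s); exists (- a); rewrite opprK in Ha.
set B := E s *m A *m E (- s) - a *: X in Ha.
have BE : E (- s) *m adjoint A *m E s - - a *: X = - (J *m B^T *m J).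
  have -> : B^T = (E (- s))^T *m A^T *m (E s)^T - a *: X^T.
    by rewrite /B linearB /= !trmx_mul mulmxA; congr (_ - _); rewrite linearZ.
  rewrite -revmx_X -!revmx_E mulmxBr mulmxBl opprB -scalemxAr -scalemxAl.
  have -> : J *m (J *m X *m J) *m J = X by rewrite !mulmxA JJ mul1mx -mulmxA JJ mulmx1.
  rewrite [(- a) *: X]scaleNr opprK addrC; congr (_ + _).
  rewrite /adjoint mulmxN mulNmx; congr (- _).
  rewrite !mulmxA JJ mul1mx -!mulmxA; congr (_ *m (_ *m (_ *m _))).
  by rewrite JJ mulmx1.
clearbody B; have KJ : K' *m J = J *m (1%:M - K).
  by apply: trmx_inj; rewrite !trmx_mul Jtr Ktr' linearB /= trmx1 Ktr.
have KJ' : J *m (1%:M - K') = K *m J.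
  by rewrite mulmxBr JK' mulmx1 mulmxBl mul1mx opprB addrC subrK.
rewrite BE mulmxN mulNmx; apply/eqP; rewrite oppr_eq0; apply/eqP.
have -> : K' *m (J *m B^T *m J) *m (1%:M - K') = J *m (K *m B *m (1%:M - K))^T *m J.
  rewrite !trmx_mul [(1%:M - K)^T]linearB /= trmx1 Ktr !mulmxA KJ -!mulmxA; congr (_ *m (_ *m (_ *m _))).
  exact: KJ'.
by rewrite Ha trmx0 mulmx0 mul0mx.
Qed.

Theorem symI_infsym : symI R k l = [set A | infsym X K1 A].
Proof.
apply/seteqP; split=> A /=.
  move=> /symI_adjoint; rewrite (symII_infsym R hk hl) /= => H.
  rewrite -[A]adjointK.
  exact: infsym_adjoint idem2 idem1 tr2 tr1 (revmx_K2 _ hk hl) (revmx_K1 _ hk hl) H.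
move=> H; apply/symI_adjoint; rewrite (symII_infsym R hk hl) /=.
exact: infsym_adjoint idem1 idem2 tr1 tr2 (revmx_K1 _ hk hl) (revmx_K2 _ hk hl) H.
Qed.

End SymmetryI.

(** * The distributions F_1 and D *)

Section Distributions.
Variables (R : realType) (k l : nat).
Hypotheses (hk : (2 <= k)%N) (hl : (2 <= l)%N).
Local Notation n := (k + l)%N.
Local Notation V := 'cV[R]_n.
Local Notation EE := 'cV[R]_(1 + n).
Local Notation X := (Xmx R k l).
Implicit Types (p h : EE) (w : V).

Definition vertical (s1 : seq 'I_k) (s2 : seq 'I_l) : seq (vfield R (1 + n)) :=
  [seq ddy R l i | i <- s1] ++ [seq ddz R k j | j <- s2].

Lemma mem_vertical s1 s2 p h : h \in span_at (vertical s1 s2) p <->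
  exists2 w, w \in <<[seq basis_e R l i | i <- s1] ++ [seq basis_f R k j | j <- s2]>>%VS
    & h = col_mx 0 w.
Proof.
have vlin : linear (fun w : V => col_mx 0 w : EE).
  by move=> a u v; rewrite scale_col_mx add_col_mx scaler0 addr0.
pose vL := GRing.isLinear.Build _ _ _ _ _ vlin.
pose F : {linear V -> EE} := HB.pack (fun w : V => col_mx 0 w : EE) vL.
have -> : span_at (vertical s1 s2) p =
    (linfun F @: <<[seq basis_e R l i | i <- s1] ++ [seq basis_f R k j | j <- s2]>>)%VS.
  rewrite limg_span /span_at; congr <<_>>%VS; rewrite !map_cat -!map_comp.
  congr (_ ++ _); apply: eq_map => i; rewrite /comp lfunE.
    apply/colP => m; case: (split_ordP m) => j ->; rewrite ?col_mxEu ?col_mxEd !mxE.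
      by rewrite eq_lrshift.
    by rewrite (inj_eq (@rshift_inj _ _)).
  apply/colP => m; case: (split_ordP m) => j ->; rewrite ?col_mxEu ?col_mxEd !mxE.
    by rewrite eq_lrshift.
  by rewrite (inj_eq (@rshift_inj _ _)).
split=> [/memv_imgP[w wU ->]|[w wU ->]]; first by exists w => //; rewrite lfunE.
by have := memv_img (linfun F) wU; rewrite lfunE.
Qed.

Lemma col_sg p h : h - xc h *: calX R k l p = col_mx 0 (sg p h).
Proof.
rewrite calXE scale_col_mx -[X in X - _](vsubmxK h) opp_col_mx add_col_mx; congr col_mx.
by apply/colP => i; rewrite !mxE ord1 eqxx mulr1 /xc /ix; rewrite (_ : lshift n 0 = lshift n ord0) ?subrr.
Qed.

Lemma span_distF1 p h : h \in span_at (distF1 R k l) p <->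
  K1 R k l *m sg p h = 0 /\ (false \/ xc h = 0).
Proof.
rewrite mem_vertical; split=> [[w /(mem_baseI hk hl) wK ->]|[Kh [//|h0]]].
  by rewrite sg_col0 xc_col0; split=> //; right.
exists (sg p h); first exact/(mem_baseI hk hl).
by rewrite -col_sg h0 scale0r subr0.
Qed.

Lemma span_distD p h : h \in span_at (distD R k l) p <->
  K2 R k l *m sg p h = 0 /\ (true \/ xc h = 0).
Proof.
rewrite /span_at /= span_cons; split.
  move=> /memv_addP[_ /vlineP[c ->]] [u] /mem_vertical[w /(mem_baseII hk hl) wK ->] ->.
  by rewrite sg_linear sg_calX scaler0 add0r sg_col0; split=> //; left.
move=> [Kh _]; apply/memv_addP; exists (xc h *: calX R k l p).
  by apply/vlineP; exists (xc h).
exists (h - xc h *: calX R k l p); last by rewrite addrC subrK.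
by apply/mem_vertical; exists (sg p h); [exact/(mem_baseII hk hl)|exact: col_sg].
Qed.

End Distributions.

(** * The two instances *)

Section ConcreteMain.
Variables (R : realType) (k l : nat).
Hypotheses (hk : (2 <= k)%N) (hl : (2 <= l)%N).
Local Notation n := (k + l)%N.
Local Notation V := 'cV[R]_n.
Local Notation X := (Xmx R k l).

(** The basis vectors of index [u1] and [u2] lie in ker K, and X sends them to those of index [a1]
    and [a2], which are independent modulo ker K: this witnesses rank at least 2. *)
Variables (q : pred 'I_n) (a1 u1 a2 u2 : 'I_n).
Hypotheses (n1 : next a1 u1) (n2 : next a2 u2) (a12 : a1 != a2).
Hypotheses (qa1 : q a1) (qa2 : q a2) (qu1 : ~~ q u1) (qu2 : ~~ q u2).
Local Notation K := (projmx R q).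

Lemma projmx_delta u : ~~ q u -> K *m (delta_mx u 0 : V) = 0.
Proof.
move=> qu; apply/projmx_ker => i qi; rewrite mxE andbT.
by case: eqP qi => // ->; rewrite (negbTE qu).
Qed.

Lemma projmx_rank (w : V) : K *m w = 0 -> exists2 w' : V, K *m w' = 0 &
  forall c : R, K *m (X *m w') <> c *: (K *m (X *m w)).
Proof.
move=> Kw; have u12 : u1 != u2.
  apply: contra a12 => /eqP uu; apply/eqP/val_inj => /=.
  by move: n1 n2; rewrite /next uu => /andP[/eqP -> _] /andP[/eqP [] ->].
have E1 (v : V) : (K *m (X *m v)) a1 0 = v u1 0 by rewrite projmx_entry qa1; exact: Xmul_next.
have E2 (v : V) : (K *m (X *m v)) a2 0 = v u2 0 by rewrite projmx_entry qa2; exact: Xmul_next.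
(* If the coordinate of [w] at [u1] is zero, the a1-coordinate separates; otherwise it forces c = 0,
   and the a2-coordinate contradicts this. *)
have [w1|w1] := eqVneq (w u1 0) 0.
  exists (delta_mx u1 0); first exact: projmx_delta.
  move=> c /(congr1 (fun v : V => v a1 0)); rewrite E1 [RHS]mxE E1 w1 mulr0 mxE !eqxx.
  exact/eqP/oner_neq0.
exists (delta_mx u2 0); first exact: projmx_delta.
move=> c H; have := congr1 (fun v : V => v a1 0) H; have := congr1 (fun v : V => v a2 0) H.
rewrite E1 E2 [RHS]mxE E2 => H2; rewrite [RHS]mxE E1 => H1.
move: H1; rewrite mxE (negbTE u12) => /esym/eqP; rewrite mulf_eq0 (negbTE w1) orbF => /eqP c0.
by move: H2; rewrite mxE c0 mul0r !eqxx => /eqP; rewrite oner_eq0.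
Qed.

Lemma projmx_symmetry_isomorphism (a : set 'M[R]_n) (L : seq (vfield R (1 + n))) (flag : bool) :
  a = [set A | infsym X K A] ->
  (forall S : seq R, uniq S -> (n <= size S)%N -> forall v : V,
    exists2 c : R -> V, (forall s, memW X K s (c s)) & v = \sum_(s <- S) c s) ->
  (forall S : seq R, uniq S -> (n <= size S)%N -> forall v : V,
    (forall s, s \in S -> memW X K s v) -> v = 0) ->
  (forall p h, h \in span_at L p <-> K *m sg p h = 0 /\ (flag \/ xc h = 0)) ->
  finite_dimensional (sternberg_prolongation a) /\
  exists phi : vfield R (1 + n) -> pvfield R n,
    lie_isomorphism (@vbracket R (1 + n)) (@pbracket R n)
      [set S | [/\ smooth S, preserves S (distX R k l) & preserves S L]]
      (sternberg_prolongation a) phi /\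
    pushes_forward [set S | [/\ smooth S, preserves S (distX R k l) & preserves S L]] phi.
Proof.
move=> aE span cap spanL.
pose lam : 'rV[R]_n := delta_mx 0 a1.
have lamE (v : V) : lam *m v = (v a1 0)%:M.
  by apply/matrixP => i j; rewrite !ord1 -rowE !mxE eqxx mulr1n.
pose P (d : nat) : 'M[R]_n := \matrix_(i, j)
  if [&& (i <= j)%N, same_block k i j & d == (j - i)%N] then (d`!%:R)^-1 else 0.
(* Here N = D = n: [expmx_X_poly] has n terms, and [span] and [cap] ask for n values of s. *)
apply: (sternberg_symmetry_isomorphism (P := P) (lam := lam) (w0 := delta_mx u1 0) _ _ _ projmx_rank
  (@expmx_X_poly R k l) span cap aE spanL).
- by move=> w /projmx_ker Kw; rewrite lamE (Kw a1 qa1) -scalemx1 scale0r.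
- exact: projmx_delta.
- by rewrite lamE (Xmul_next _ n1) !mxE !eqxx mulr1n.
Qed.

End ConcreteMain.

Theorem theorem3 (R : realType) (k l : nat) (hk : (2 <= k)%N) (hkl : (k < l)%N) :
  (finite_dimensional (sternberg_prolongation (symI R k l)) /\
   exists phi : vfield R (1 + (k + l)) -> pvfield R (k + l),
     lie_isomorphism (@vbracket R (1 + (k + l))) (@pbracket R (k + l))
       (gI R k l) (sternberg_prolongation (symI R k l)) phi /\
     pushes_forward (gI R k l) phi) /\
  (finite_dimensional (sternberg_prolongation (symII R k l)) /\
   exists phi : vfield R (1 + (k + l)) -> pvfield R (k + l),
     lie_isomorphism (@vbracket R (1 + (k + l))) (@pbracket R (k + l))
       (gII R k l) (sternberg_prolongation (symII R k l)) phi /\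
     pushes_forward (gII R k l) phi).
Proof.
have hl : (2 <= l)%N by lia.
split.
  (* The pairs are e_0, e_1 and f_0, f_1, in which [bottom] selects the first members. *)
  have a1n : (0 < k + l)%N by lia.
  have u1n : (1 < k + l)%N by lia.
  have a2n : (k < k + l)%N by lia.
  have u2n : (k.+1 < k + l)%N by lia.
  apply: (@projmx_symmetry_isomorphism R k l (@bottom k l) (Ordinal a1n) (Ordinal u1n)
    (Ordinal a2n) (Ordinal u2n) _ _ _ _ _ _ _ _ _ false (symI_infsym R hk hl)
    (spanW1 hk hl) (capW1 hk hl) (span_distF1 hk hl));
    rewrite ?/next ?/bottom -?val_eqE /=; lia.
(* The pairs are e_{k-2}, e_{k-1} and f_{l-2}, f_{l-1}, whose second members are the top indices. *)
have a1n : (k.-2 < k + l)%N by lia.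
have u1n : (k.-1 < k + l)%N by lia.
have a2n : ((k + l).-2 < k + l)%N by lia.
have u2n : ((k + l).-1 < k + l)%N by lia.
apply: (@projmx_symmetry_isomorphism R k l (predC (@top k l)) (Ordinal a1n) (Ordinal u1n)
  (Ordinal a2n) (Ordinal u2n) _ _ _ _ _ _ _ _ _ true (symII_infsym R hk hl)
  (spanW2 hk hl) (capW2 hk hl) (span_distD hk hl));
  rewrite ?/next ?/top -?val_eqE /=; lia.
Qed.
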